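(* Let $(\mathcal A,\mathcal B)$ be a quantum Gelfand pair of CQG algebras. Let $K:=(\mathcal A,\mathcal B)\,\widehat{\;}$, endowed with the discrete topology. For $\alpha,\beta\in K$ define the convolution $p_\alpha*p_\beta$ by $$(p_\alpha*p_\beta)(\gamma):=c_{\alpha\beta}(\gamma),\qquad \gamma\in K,$$ where the $c_{\alpha\beta}(\gamma)$ are the coefficients in the linearization formula $t_{11}^\alpha t_{11}^\beta=\sum_{\gamma\in K}c_{\alpha\beta}(\gamma)\,t_{11}^\gamma$. Take $\alpha\mapsto\overline\alpha$ (where $\overline\alpha$ is the class of $((t_{ij}^\alpha)^-)$) as involution on $K$, and let $e\in K$ be the class of the trivial corepresentation of $\mathcal A$. Then the quadruple $(K,*,{}^-,e)$ forms a DJS-hypergroup.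
   Context: All algebras are complex, associative and unital. A Hopf $*$-algebra is a Hopf algebra $\mathcal A$ (comultiplication $\Delta$, counit $\varepsilon$, antipode $S$) with an involutive antilinear antimultiplicative map $a\mapsto a^*$ such that $\Delta$ and $\varepsilon$ are $*$-homomorphisms (with $(a\otimes b)^*=a^*\otimes b^*$). The algebraic linear dual is $\mathcal A^*$. For $f\in\mathcal A^*$, $a\in\mathcal A$ put $f.a:=(\mathrm{id}\otimes f)(\Delta(a))$ and $a.f:=(f\otimes\mathrm{id})(\Delta(a))$; these left and right actions commute. A matrix corepresentation of $\mathcal A$ is a square matrix $t=(t_{ij})$ over $\mathcal A$ with $\Delta(t_{ij})=\sum_k t_{ik}\otimes t_{kj}$ and $\varepsilon(t_{ij})=\delta_{ij}$; it is unitary if $S(t_{ij})=(t_{ji})^*$. Matrix corepresentations $s,t$ of the same dimension are equivalent if $Bs=tB$ for some invertible complex matrix $B$; $t$ is irreducible if it is not equivalent to one of block form $\left(\begin{smallmatrix}*&*\\0&*\end{smallmatrix}\right)$ with nontrivial blocks. A CQG algebra is a Hopf $*$-algebra that is the linear span of the matrix elements of its unitary matrix corepresentations. Let $\mathcal A$ be a CQG algebra. $\widehat{\mathcal A}$ denotes the set of equivalence classes of irreducible unitary matrix corepresentations; for each $\alpha\in\widehat{\mathcal A}$ a unitary representative $t^\alpha=(t_{ij}^\alpha)_{i,j=1,\dots,d_\alpha}$ is chosen; all $t_{ij}^\alpha$ together form a basis of $\mathcal A$. $e\in\widehat{\mathcal A}$ is the class of the trivial one-dimensional corepresentation $(1)$.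 The matrix $t''$ with entries $S^2(t_{ij}^\alpha)$ is equivalent to $t^\alpha$, and $F_\alpha$ denotes the unique invertible complex matrix with $F_\alpha t^\alpha=t''F_\alpha$ and $\operatorname{tr}F_\alpha=\operatorname{tr}F_\alpha^{-1}>0$; it is positive definite. For $z\in\mathbb C$, $f_z\in\mathcal A^*$ is defined by $f_z(t_{ij}^\alpha):=(F_\alpha^z)_{ij}$. A second involution on $\mathcal A$ is defined by $a^-:=f_{1/2}.a^*.f_{-1/2}$. For $\alpha\in\widehat{\mathcal A}$, the matrix $((t_{ij}^\alpha)^-)$ is an irreducible unitary matrix corepresentation of $\mathcal A$, and $\overline\alpha\in\widehat{\mathcal A}$ denotes its class. A sub-CQG algebra of $\mathcal A$ is a pair $(\mathcal B,\Psi)$ with $\mathcal B$ a CQG algebra and $\Psi:\mathcal A\to\mathcal B$ a surjective homomorphism of Hopf $*$-algebras ($\Psi$ is suppressed in notation). An element $a\in\mathcal A$ is $\mathcal B$-biinvariant if $(\Psi\otimes\mathrm{id})(\Delta(a))=1_{\mathcal B}\otimes a$ and $(\mathrm{id}\otimes\Psi)(\Delta(a))=a\otimes1_{\mathcal B}$. $(\mathcal A,\mathcal B)$ is a quantum Gelfand pair of CQG algebras if for each $\alpha\in\widehat{\mathcal A}$ the $\mathcal B$-biinvariant elements of $\mathrm{Span}\{t_{ij}^\alpha\}$ form a subspace of dimension 0 or 1; $(\mathcal A,\mathcal B)\,\widehat{\;}$ is the set of $\alpha\in\widehat{\mathcal A}$ for which this dimension is 1. For $\alpha\in(\mathcal A,\mathcal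 B)\,\widehat{\;}$ the representative $t^\alpha$ is chosen such that $t_{11}^\alpha$ is $\mathcal B$-biinvariant (always possible). The elements $t_{11}^\alpha$, $\alpha\in(\mathcal A,\mathcal B)\,\widehat{\;}$, form a basis of the algebra of $\mathcal B$-biinvariant elements, so that for $\alpha,\beta\in(\mathcal A,\mathcal B)\,\widehat{\;}$ there is a unique expansion $t_{11}^\alpha t_{11}^\beta=\sum_{\gamma}c_{\alpha\beta}(\gamma)\,t_{11}^\gamma$ over $\gamma\in(\mathcal A,\mathcal B)\,\widehat{\;}$, with finitely many nonzero terms. DJS-hypergroup: let $K$ be a locally compact Hausdorff space, $M(K)$ the complex regular Borel measures on $K$, $M^1(K)$ the probability measures among them, $p_x$ the point measure at $x$. Data: a continuous map $(x,y)\mapsto p_x*p_y:K\times K\to M^1(K)$ (convolution), where $M^1(K)$ carries the weak topology with respect to $C_c(K)$, extended to a bilinear map $M(K)\times M(K)\to M(K)$ by $\mu*\nu=\int\!\int p_x*p_y\,d\mu(x)\,d\nu(y)$; an involutive homeomorphism $x\mapsto\overline x$ of $K$ (involution), with $\mu^-$ denoting the image of a probability measure $\mu$ under the involution; and an element $e\in K$ (unit). $(K,*,{}^-,e)$ is a DJS-hypergroup if: (H1) $p_x*(p_y*p_z)=(p_x*p_y)*p_z$ for all $x,y,z$; (H2) $\mathrm{supp}(p_x*p_y)$ is compact for all $x,y$; (H3) $(p_x*p_y)^-=p_{\overline y}*p_{\overline x}$ for all $x,y$; (H4) $p_e*p_x=p_x=p_x*p_e$ for all $x$; (H5) $e\in\mathrm{supp}(p_x*p_{\overline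 y})$ if and only if $x=y$; (H6) $(x,y)\mapsto\mathrm{supp}(p_x*p_y)$ is continuous from $K\times K$ to the space of nonvoid compact subsets of $K$ with the topology generated by the sets $\{A: A\cap U\neq\emptyset,\ A\subset V\}$, $U,V\subset K$ open. *)

(* Defs.v *)
From HB Require Import structures.
From mathcomp Require Import all_boot all_order all_algebra.
From mathcomp Require Import complex.
From mathcomp Require Import all_classical all_reals all_analysis.

Set Implicit Arguments.
Unset Strict Implicit.
Unset Printing Implicit Defensive.

Import Order.TTheory GRing.Theory Num.Theory.
Import numFieldNormedType.Exports.

Local Open Scope classical_set_scope.
Local Open Scope ring_scope.
Local Open Scope quotient_scope.

(** * Algebraic tensor products *)

(* A formal sum [:: (u1, v1); ...; (un, vn)] stands for u1 (x) v1 + ... + un (x) vn.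
   Two formal sums are identified when no balanced biadditive map into an
   abelian group separates them: the quotient is the tensor product over C. *)
Section Tensor.
Variables (C : numClosedFieldType) (U V : lmodType C).

Record balanced (W : zmodType) (f : U -> V -> W) : Prop := Balanced {
  balancedDl : forall u u' v, f (u + u') v = f u v + f u' v;
  balancedDr : forall u v v', f u (v + v') = f u v + f u v';
  balancedZ : forall k u v, f (k *: u) v = f u (k *: v) }.

Definition formal_eq (s t : seq (U * V)) : bool :=
  `[< forall (W : zmodType) (f : U -> V -> W), balanced f ->
        \sum_(p <- s) f p.1 p.2 = \sum_(p <- t) f p.1 p.2 >].

Lemma formal_eq_refl : reflexive formal_eq.
Proof. by move=> s; apply/asboolP. Qed.

Lemma formal_eq_sym : symmetric formal_eq.
Proof.
by move=> s t; apply/asboolP/asboolP => st W f bf; rewrite (st W f bf).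
Qed.

Lemma formal_eq_trans : transitive formal_eq.
Proof.
move=> t s r /asboolP st /asboolP tr; apply/asboolP => W f bf.
by rewrite (st W f bf) (tr W f bf).
Qed.

Definition formal_equiv :=
  EquivRel formal_eq formal_eq_refl formal_eq_sym formal_eq_trans.

Definition tensor : Type := {eq_quot formal_equiv}.
HB.instance Definition _ := Choice.on tensor.
HB.instance Definition _ := EqQuotient.on tensor.

Definition pure (u : U) (v : V) : tensor := \pi_tensor [:: (u, v)].

(* The map u (x) v |-> f u v, for balanced f (see tlift_pure and tliftD). *)
Definition tlift (W : zmodType) (f : U -> V -> W) (x : tensor) : W :=
  \sum_(p <- repr x) f p.1 p.2.

Lemma tlift_pi (W : zmodType) (f : U -> V -> W) s : balanced f ->
  tlift f (\pi_tensor s) = \sum_(p <- s) f p.1 p.2.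
Proof.
move=> bf; have /eqmodP/asboolP : repr (\pi_tensor s) = s %[mod tensor].
  by rewrite reprK.
exact.
Qed.

Lemma tlift_pure (W : zmodType) (f : U -> V -> W) u v : balanced f ->
  tlift f (pure u v) = f u v.
Proof. by move=> bf; rewrite tlift_pi// big_seq1. Qed.

Lemma tensor_sep (x y : tensor) :
  (forall (W : zmodType) (f : U -> V -> W), balanced f ->
     tlift f x = tlift f y) -> x = y.
Proof.
by move=> xy; rewrite -(reprK x) -(reprK y); apply/eqmodP/asboolP => W f /xy.
Qed.

Definition tadd (x y : tensor) : tensor := \pi_tensor (repr x ++ repr y).
Definition tzero : tensor := \pi_tensor [::].
Definition tscale (k : C) (x : tensor) : tensor :=
  \pi_tensor [seq (k *: p.1, p.2) | p <- repr x].
Definition topp (x : tensor) : tensor := tscale (-1) x.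

Let liftD (W : zmodType) (f : U -> V -> W) x y : balanced f ->
  tlift f (tadd x y) = tlift f x + tlift f y.
Proof. by move=> bf; rewrite tlift_pi// big_cat. Qed.

Let lift0 (W : zmodType) (f : U -> V -> W) : balanced f -> tlift f tzero = 0.
Proof. by move=> bf; rewrite tlift_pi// big_nil. Qed.

Let balanced_scale (W : zmodType) (f : U -> V -> W) k : balanced f ->
  balanced (fun u v => f (k *: u) v).
Proof.
move=> [fDl fDr fZ]; split=> [u u' v|u v v'|h u v].
- by rewrite scalerDr fDl.
- exact: fDr.
- by rewrite scalerA mulrC -scalerA fZ.
Qed.

Let liftZ (W : zmodType) (f : U -> V -> W) k x : balanced f ->
  tlift f (tscale k x) = tlift (fun u v => f (k *: u) v) x.
Proof. by move=> bf; rewrite tlift_pi// big_map. Qed.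

Let liftE (W : zmodType) (f g : U -> V -> W) x : (forall u v, f u v = g u v) ->
  tlift f x = tlift g x.
Proof. by move=> fg; apply: eq_bigr => p _. Qed.

Let addA : associative tadd.
Proof. by move=> x y z; apply: tensor_sep => W f bf; rewrite !liftD// addrA. Qed.

Let addC : commutative tadd.
Proof. by move=> x y; apply: tensor_sep => W f bf; rewrite !liftD// addrC. Qed.

Let add0 : left_id tzero tadd.
Proof. by move=> x; apply: tensor_sep => W f bf; rewrite liftD// lift0// add0r. Qed.

Let addN : left_inverse tzero topp tadd.
Proof.
move=> x; apply: tensor_sep => W f bf; rewrite liftD// liftZ// lift0//.
rewrite /tlift -big_split big1 => //= p _.
rewrite -balancedDl// scaleN1r addNr.
by have := balancedDl bf 0 0 p.2; rewrite addr0 -{1}[f 0 _]addr0 => /addrI.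
Qed.

HB.instance Definition _ := GRing.isZmodule.Build tensor addA addC add0 addN.

Let scaleA a b x : tscale a (tscale b x) = tscale (a * b) x.
Proof.
apply: tensor_sep => W f bf; rewrite !liftZ//; last exact: balanced_scale.
by apply: liftE => u v; rewrite scalerA.
Qed.

Let scale1 : left_id 1 tscale.
Proof.
move=> x; apply: tensor_sep => W f bf; rewrite liftZ//.
by apply: liftE => u v; rewrite scale1r.
Qed.

Let scaleDr : right_distributive tscale +%R.
Proof.
move=> k x y; apply: tensor_sep => W f bf.
by rewrite liftZ// !liftD// ?liftZ//; exact: balanced_scale.
Qed.

Let scaleDl x : {morph tscale^~ x : a b / a + b}.
Proof.
move=> a b; apply: tensor_sep => W f bf; rewrite liftD// !liftZ//.
rewrite /tlift -big_split; apply: eq_bigr => p _ /=.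
by rewrite scalerDl (balancedDl bf).
Qed.

HB.instance Definition _ :=
  GRing.Zmodule_isLmodule.Build C tensor scaleA scale1 scaleDr scaleDl.

Lemma tliftD (W : zmodType) (f : U -> V -> W) x y : balanced f ->
  tlift f (x + y) = tlift f x + tlift f y.
Proof. exact: liftD. Qed.

Lemma tlift_scale (W : zmodType) (f : U -> V -> W) k x : balanced f ->
  tlift f (k *: x) = tlift (fun u v => f (k *: u) v) x.
Proof. exact: liftZ. Qed.

Lemma pureZ k u v : k *: pure u v = pure (k *: u) v.
Proof.
apply: tensor_sep => W f bf; rewrite tlift_scale// !tlift_pure//.
exact: balanced_scale.
Qed.

Lemma pure_balanced : balanced pure.
Proof.
split=> [u u' v|u v v'|k u v]; apply: tensor_sep => W f bf.
- by rewrite liftD// !tlift_pure// (balancedDl bf).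
- by rewrite liftD// !tlift_pure// (balancedDr bf).
- by rewrite !tlift_pure// (balancedZ bf).
Qed.

Lemma tensor_sum (x : tensor) : x = \sum_(p <- repr x) pure p.1 p.2.
Proof.
apply: tensor_sep => W f bf; rewrite {1}/tlift.
elim: (repr x) => [|p s ih]; first by rewrite !big_nil -(lift0 bf).
by rewrite !big_cons liftD// ih tlift_pure.
Qed.

End Tensor.

Arguments tensor {C} (U V)%_type_scope.
Notation "U ⊗ V" := (tensor U V) (at level 40, left associativity) : type_scope.
Notation "u ⊗ v" := (pure u v) (at level 40, left associativity) : ring_scope.

Section TensorMaps.
Variable C : numClosedFieldType.

Definition tmap (U V U' V' : lmodType C) (f : U -> U') (g : V -> V')
  : U ⊗ V -> U' ⊗ V' := tlift (fun u v => f u ⊗ g v).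

Definition tassoc (U V W : lmodType C) : U ⊗ (V ⊗ W) -> (U ⊗ V) ⊗ W :=
  tlift (fun u => tlift (fun v w => (u ⊗ v) ⊗ w)).

Definition tmul (A B : algType C) (x y : A ⊗ B) : A ⊗ B :=
  tlift (fun a b => tlift (fun a' b' => (a * a') ⊗ (b * b')) y) x.

Lemma tmap_pure (U V U' V' : lmodType C) (f : {linear U -> U'})
  (g : {linear V -> V'}) u v : tmap f g (u ⊗ v) = f u ⊗ g v.
Proof.
apply: tlift_pure; split=> [a b c|a b c|k a b].
- by rewrite linearD (balancedDl (pure_balanced _ _)).
- by rewrite linearD (balancedDr (pure_balanced _ _)).
- by rewrite !linearZ (balancedZ (pure_balanced _ _)).
Qed.

End TensorMaps.

(** * Linear spans and dimensions in a possibly infinite-dimensional space *)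

Section Span.
Variables (C : numClosedFieldType) (V : lmodType C).

Definition lspan (X : set V) : set V :=
  [set v | exists n (c : 'I_n -> C) (x : 'I_n -> V),
     (forall i, X (x i)) /\ v = \sum_(i < n) c i *: x i].

Definition lin_indep n (b : 'I_n -> V) : Prop :=
  forall c : 'I_n -> C, \sum_(i < n) c i *: b i = 0 -> forall i, c i = 0.

Definition has_dim (W : set V) (n : nat) : Prop :=
  exists b : 'I_n -> V, lin_indep b /\ W = lspan (range b).

End Span.

(** * Hopf *-algebras and CQG algebras *)

Record hopfStarAlgebra (C : numClosedFieldType) := HopfStarAlgebra {
  hopf_alg :> algType C;
  comul : {linear hopf_alg -> (hopf_alg ⊗ hopf_alg)%type};
  counit : {lrmorphism hopf_alg -> C | *%R};
  antipode : {linear hopf_alg -> hopf_alg};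
  star : hopf_alg -> hopf_alg;
  comul1 : comul 1 = (1 : hopf_alg) ⊗ (1 : hopf_alg);
  comulM : forall a b, comul (a * b) = tmul (comul a) (comul b);
  comulA : forall a, tmap comul id (comul a) = tassoc (tmap id comul (comul a));
  counitL : forall a, tlift (fun x y => counit x *: y) (comul a) = a;
  counitR : forall a, tlift (fun x y => counit y *: x) (comul a) = a;
  antipodeL : forall a,
    tlift (fun x y => antipode x * y) (comul a) = (counit a)%:A;
  antipodeR : forall a,
    tlift (fun x y => x * antipode y) (comul a) = (counit a)%:A;
  starK : involutive star;
  star_antilinear : forall (k : C) a b,
    star (k *: a + b) = k^* *: star a + star b;
  starM : forall a b, star (a * b) = star b * star a;
  comul_star : forall a, comul (star a) = tmap star star (comul a);
  counit_star : forall a, counit (star a) = (counit a)^* }.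

Section Corepresentations.
Variables (C : numClosedFieldType) (A : hopfStarAlgebra C).

Definition lift_scalars m n (M : 'M[C]_(m, n)) : 'M[A]_(m, n) :=
  map_mx (fun k : C => k%:A : A) M.

Definition is_corep n (t : 'M[A]_n) : Prop :=
  forall i j, comul A (t i j) = \sum_k t i k ⊗ t k j /\
              counit A (t i j) = (i == j)%:R.

Definition is_unitary n (t : 'M[A]_n) : Prop :=
  forall i j, antipode A (t i j) = star (t j i).

(* M is an invertible matrix with inverse M' (in particular m = n); letting
   the sizes differ a priori avoids casts between them. *)
Definition corep_equiv m n (s : 'M[A]_m) (t : 'M[A]_n) : Prop :=
  exists (M : 'M[C]_(n, m)) (M' : 'M[C]_(m, n)),
    [/\ M *m M' = 1%:M, M' *m M = 1%:M &
        lift_scalars M *m s = t *m lift_scalars M].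

Definition is_irreducible n (t : 'M[A]_n) : Prop :=
  ~ exists p q (a : 'M[A]_p.+1) (b : 'M[A]_(p.+1, q.+1)) (d : 'M[A]_q.+1),
      corep_equiv t (block_mx a b 0 d).

Record irr_unitary_corep n (t : 'M[A]_n) : Prop := IrrUnitaryCorep {
  iuc_corep : is_corep t;
  iuc_unitary : is_unitary t;
  iuc_irreducible : is_irreducible t }.

(* Irreducible unitary matrix corepresentations, of size deg.+1 >= 1. *)
Record iurep := IURep {
  deg : nat;
  iumx :> 'M[A]_deg.+1;
  iumxP : irr_unitary_corep iumx }.

HB.instance Definition _ := gen_eqMixin iurep.
HB.instance Definition _ := gen_choiceMixin iurep.

Lemma lift_scalarsM m n p (M : 'M[C]_(m, n)) (N : 'M[C]_(n, p)) :
  lift_scalars (M *m N) = lift_scalars M *m lift_scalars N.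
Proof.
apply/matrixP => i j; rewrite !mxE scaler_suml; apply: eq_bigr => k _.
by rewrite !mxE -scalerAl mul1r scalerA.
Qed.

Lemma lift_scalars1 n : lift_scalars 1%:M = 1%:M :> 'M[A]_n.
Proof.
apply/matrixP => i j; rewrite !mxE.
by case: (i == j); rewrite ?scale1r ?scale0r.
Qed.

Definition iurep_equiv (s t : iurep) : bool := `[< corep_equiv s t >].

Lemma iurep_equiv_refl : reflexive iurep_equiv.
Proof.
move=> t; apply/asboolP; exists 1%:M, 1%:M; rewrite !mulmx1; split=> //.
by rewrite !lift_scalars1 mul1mx mulmx1.
Qed.

Lemma corep_equiv_sym m n (s : 'M[A]_m) (t : 'M[A]_n) :
  corep_equiv s t -> corep_equiv t s.
Proof.
move=> [M [M' [MM' M'M st]]]; exists M', M; split=> //.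
have -> : s = lift_scalars M' *m t *m lift_scalars M.
  by rewrite -mulmxA -st mulmxA -lift_scalarsM M'M lift_scalars1 mul1mx.
by rewrite -!mulmxA -lift_scalarsM MM' lift_scalars1 mulmx1.
Qed.

Lemma iurep_equiv_sym : symmetric iurep_equiv.
Proof. by move=> s t; apply/asboolP/asboolP; exact: corep_equiv_sym. Qed.

Lemma iurep_equiv_trans : transitive iurep_equiv.
Proof.
move=> t s r /asboolP [M [M' [MM' M'M st]]] /asboolP [N [N' [NN' N'N tr]]].
apply/asboolP; exists (N *m M), (M' *m N'); split.
- by rewrite mulmxA -(mulmxA N) MM' mulmx1.
- by rewrite mulmxA -(mulmxA M') N'N mulmx1.
- by rewrite lift_scalarsM -mulmxA st mulmxA tr mulmxA.
Qed.

Definition iurep_equivalence :=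
  EquivRel iurep_equiv iurep_equiv_refl iurep_equiv_sym iurep_equiv_trans.

Definition cqg_dual : Type := {eq_quot iurep_equivalence}.
HB.instance Definition _ := Choice.on cqg_dual.
HB.instance Definition _ := EqQuotient.on cqg_dual.

Definition class_of (t : iurep) : cqg_dual := \pi_cqg_dual t.

Definition entries n (t : 'M[A]_n) : set A :=
  [set a | exists i j, a = t i j].

Definition is_cqg : Prop := forall a : A,
  lspan [set x | exists n (t : 'M[A]_n),
           [/\ is_corep t, is_unitary t & entries t x]] a.

Lemma antipode1 : antipode A 1 = 1.
Proof.
have bal : balanced (fun x y => antipode A x * y).
  split=> [u u' v|u v v'|k u v]; first by rewrite linearD mulrDl.
    by rewrite mulrDr.
  by rewrite linearZ -scalerAl -scalerAr.
have := antipodeL (1 : A).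
by rewrite comul1 (tlift_pure _ _ bal) mulr1 rmorph1 scale1r.
Qed.

Lemma star1 : star (1 : A) = 1.
Proof. by rewrite -[LHS]mul1r -{1}(starK (1 : A)) -starM mul1r starK. Qed.

Lemma trivial_irr_unitary : irr_unitary_corep (1%:M : 'M[A]_1).
Proof.
split=> [i j|i j|].
- rewrite big_ord1 !ord1 !mxE eqxx comul1; split=> //.
  by rewrite rmorph1.
- by rewrite !ord1 !mxE eqxx antipode1 star1.
- move=> [p [q [a [b [d [M [M' [MM' _ _]]]]]]]].
  have : (\rank (1%:M : 'M[C]_(p.+1 + q.+1)) <= 1)%N.
    by rewrite -MM' (leq_trans (mxrankM_maxl _ _))// rank_leq_col.
  by rewrite mxrank1 addSn addnS.
Qed.

Definition trivial_class : cqg_dual := class_of (IURep trivial_irr_unitary).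

Definition is_F_matrix n (t : 'M[A]_n) (M : 'M[C]_n) : Prop :=
  [/\ M \in unitmx,
      lift_scalars M *m t
        = map_mx (fun a => antipode A (antipode A a)) t *m lift_scalars M,
      \tr M = \tr (invmx M) & 0 < \tr M].

Definition lact (f : {scalar A}) (a : A) : A :=
  tlift (fun x y => f y *: x) (comul A a).

Definition ract (a : A) (f : {scalar A}) : A :=
  tlift (fun x y => f x *: y) (comul A a).

(* a^- = f_{1/2} . a^* . f_{-1/2} *)
Definition second_star (f : C -> {scalar A}) (a : A) : A :=
  ract (lact (f 2^-1) (star a)) (f (- 2^-1)).

End Corepresentations.

Record cqgAlgebra (C : numClosedFieldType) := CQGAlgebra {
  cqg_hopf :> hopfStarAlgebra C;
  cqgP : is_cqg cqg_hopf }.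

(** * The complex field and complex powers of positive definite matrices *)

Definition complexField (R : realType) : numClosedFieldType :=
  [the numClosedFieldType of R[i]].

Section ComplexPowers.
Local Open Scope complex_scope.
Variable R : realType.
Local Notation C := (complexField R).

(* x ^ z for a positive real x and a complex exponent z. *)
Definition cpowr (x : R) (z : C) : C :=
  (x `^ complex.Re z * cos (complex.Im z * ln x)) +i*
  (x `^ complex.Re z * sin (complex.Im z * ln x)).

(* M ^ z for a positive definite matrix M, through its unitary
   diagonalisation. *)
Definition mxpow n (M : 'M[C]_n) (z : C) : 'M[C]_n :=
  invmx (spectralmx M) *m
  diag_mx (map_mx (fun l : C => cpowr (complex.Re l) z) (spectral_diag M)) *m
  spectralmx M.

End ComplexPowers.

(** * Quantum Gelfand pairs *)

Record hopfStarMorphism (C : numClosedFieldType) (A B : hopfStarAlgebra C) :=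
  HopfStarMorphism {
  hopf_map :> {lrmorphism A -> B};
  hopf_map_comul : forall a, comul B (hopf_map a)
                             = tmap hopf_map hopf_map (comul A a);
  hopf_map_counit : forall a, counit B (hopf_map a) = counit A a;
  hopf_map_antipode : forall a, antipode B (hopf_map a)
                                = hopf_map (antipode A a);
  hopf_map_star : forall a, hopf_map (star a) = star (hopf_map a) }.

Record subCQG (C : numClosedFieldType) (A : cqgAlgebra C) := SubCQG {
  sub_cqg : cqgAlgebra C;
  sub_map : hopfStarMorphism A sub_cqg;
  sub_map_surj : forall b, exists a, sub_map a = b }.

Section GelfandPairs.
Variables (C : numClosedFieldType) (A : cqgAlgebra C) (B : subCQG A).
Local Notation Psi := (sub_map B).

Definition biinvariant : set A :=
  [set a | tmap Psi id (comul A a) = 1 ⊗ a /\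
           tmap id Psi (comul A a) = a ⊗ 1].

(* Span {t_ij} depends only on the class alpha, so that the representative
   picked by repr is as good as any other. *)
Definition biinvariant_part (alpha : cqg_dual A) : set A :=
  biinvariant `&` lspan (entries (repr alpha)).

Definition quantum_gelfand_pair : Prop := forall alpha : cqg_dual A,
  has_dim (biinvariant_part alpha) 0 \/ has_dim (biinvariant_part alpha) 1.

Definition is_spherical (alpha : cqg_dual A) : bool :=
  `[< has_dim (biinvariant_part alpha) 1 >].

Definition spherical_dual : Type := {alpha : cqg_dual A | is_spherical alpha}.

Lemma trivial_spherical : is_spherical (trivial_class A).
Proof.
have S : lspan (entries (repr (trivial_class A))) = range (fun k => k%:A : A).
  move: (reprK (trivial_class A)) => /eqmodP/asboolP.
  move: (repr _) => u /= [M [M' [MM' M'M E]]].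
  have u1 : (u : 'M[A]_((deg u).+1)) = 1%:M.
    by rewrite -(mul1mx (iumx u)) -lift_scalars1 -M'M lift_scalarsM -mulmxA E mul1mx.
  have uE i j : u i j = (i == j)%:R%:A :> A.
    by rewrite u1 mxE; case: (i == j); rewrite ?scale1r ?scale0r.
  apply/seteqP; split=> [a [n [c [x [xu ->]]]]|_ [k _ <-]].
    exists (\sum_(i < n) c i * counit A (x i)) => //.
    rewrite scaler_suml; apply: eq_bigr => i _; have [p [q ->]] := xu i.
    by rewrite uE linearZ /= rmorph1 mulr1 scalerA.
  exists 1%N, (fun=> k), (fun=> 1); rewrite big_ord1; split=> // _.
  by exists ord0, ord0; rewrite uE eqxx scale1r.
apply/asboolP; exists (fun=> 1); split=> [c|].
  rewrite big_ord1 => /eqP; rewrite scaler_eq0 oner_eq0 orbF => /eqP c0 i.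
  by rewrite ord1.
have -> : lspan (range (fun _ : 'I_1 => 1 : A)) = range (fun k => k%:A : A).
  apply/seteqP; split=> [a [n [c [x [xu ->]]]]|_ [k _ <-]].
    exists (\sum_(i < n) c i) => //; rewrite scaler_suml.
    by apply: eq_bigr => i _; have [_ _ <-] := xu i.
  exists 1%N, (fun=> k), (fun=> 1); rewrite big_ord1; split=> // _.
  by exists ord0.
rewrite /biinvariant_part S setIidr// => _ [k _ <-].
split; rewrite linearZ /= comul1 pureZ.
  rewrite (tmap_pure Psi (idfun : {linear A -> A})).
  by rewrite linearZ /= rmorph1 (balancedZ (pure_balanced _ _)).
rewrite (tmap_pure (idfun : {linear A -> A}) Psi).
by rewrite rmorph1.
Qed.

HB.instance Definition _ := Choice.on spherical_dual.
HB.instance Definition _ :=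
  isPointed.Build spherical_dual (exist _ (trivial_class A) trivial_spherical).

Definition spherical_space : Type := discrete_topology spherical_dual.
HB.instance Definition _ := Pointed.copy spherical_space spherical_dual.
HB.instance Definition _ :=
  DiscreteTopology.copy spherical_space (discrete_topology spherical_dual).

Definition trivial_point : spherical_space := point.

Definition dual_of (alpha : spherical_space) : cqg_dual A := sval alpha.

End GelfandPairs.

(** * DJS-hypergroups *)

(* Measurable types are pointed, hence K is: this excludes no hypergroup, since
   a hypergroup has a unit. *)
Section ComplexMeasures.
Local Open Scope complex_scope.
Variables (R : realType) (K : ptopologicalType).
Local Notation C := (complexField R).

Definition borel : Type := g_sigma_algebraType (@open K).
HB.instance Definition _ := Measurable.on borel.

Record cmeasure := CMeasure {
  cmeasure_re : {charge set borel -> \bar R};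
  cmeasure_im : {charge set borel -> \bar R} }.

Definition mval (mu : cmeasure) (E : set K) : C :=
  fine (cmeasure_re mu E) +i* fine (cmeasure_im mu E).

(* Charges are total functions on sets; their values outside of the
   sigma-algebra are meaningless. *)
Definition meq (mu nu : cmeasure) : Prop :=
  forall E : set borel, measurable E -> mval mu E = mval nu E.

(* Inner and outer regularity of the variation of mu, expressed through the
   values of mu on the Borel subsets of U `\` D. *)
Definition regular (mu : cmeasure) : Prop :=
  forall (E : set borel) (eps : R), measurable E -> 0 < eps ->
  exists D U : set K, [/\ compact D, open U, D `<=` E, E `<=` U &
    forall G : set borel, measurable G -> G `<=` U `\` D ->
      `|mval mu G| < eps%:C].

Definition charge_integral (nu : {charge set borel -> \bar R})
    (f : K -> R) : R :=
  let: exist P hP := cid (Hahn_decomposition nu) in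
  let: exist N hN := cid hP in
  Rintegral (jordan_pos hN) [set: borel] f -
  Rintegral (jordan_neg hN) [set: borel] f.

Definition cintegral (mu : cmeasure) (f : K -> C) : C :=
  let u x := complex.Re (f x) in
  let v x := complex.Im (f x) in
  (charge_integral (cmeasure_re mu) u - charge_integral (cmeasure_im mu) v) +i*
  (charge_integral (cmeasure_re mu) v + charge_integral (cmeasure_im mu) u).

Definition is_probability (mu : cmeasure) : Prop :=
  [/\ regular mu, forall E : set borel, measurable E -> 0 <= mval mu E &
      mval mu setT = 1].

Definition point_measure (x : K) : cmeasure :=
  CMeasure (charge_of_finite_measure (dirac (x : borel))) czero.

Definition supp (mu : cmeasure) : set K :=
  [set x | forall U, open U -> U x -> 0 < mval mu U].

Definition Cc (f : K -> C) : Prop :=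
  continuous (f : K -> C^o) /\ compact (closure [set x | f x != 0]).

(* cv is the convolution of M(K) extending p_x * p_y: bilinear, and given by
   the weak integral of p_x * p_y against mu and nu. *)
Record convolution_extension (conv : K -> K -> cmeasure)
    (cv : cmeasure -> cmeasure -> cmeasure) : Prop := ConvolutionExtension {
  cv_regular : forall mu nu, regular mu -> regular nu -> regular (cv mu nu);
  cv_linearl : forall (k : C) mu mu1 mu2 nu,
    regular mu -> regular mu1 -> regular mu2 -> regular nu ->
    (forall E : set borel, measurable E ->
       mval mu E = k * mval mu1 E + mval mu2 E) ->
    forall E : set borel, measurable E ->
      mval (cv mu nu) E = k * mval (cv mu1 nu) E + mval (cv mu2 nu) E;
  cv_linearr : forall (k : C) mu nu nu1 nu2,
    regular mu -> regular nu -> regular nu1 -> regular nu2 ->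
    (forall E : set borel, measurable E ->
       mval nu E = k * mval nu1 E + mval nu2 E) ->
    forall E : set borel, measurable E ->
      mval (cv mu nu) E = k * mval (cv mu nu1) E + mval (cv mu nu2) E;
  cv_integral : forall mu nu, regular mu -> regular nu ->
    forall f, Cc f ->
      cintegral (cv mu nu) f =
      cintegral nu (fun y => cintegral mu (fun x => cintegral (conv x y) f)) }.

(* Continuity into the weak topology of M^1(K), and into the space of nonvoid
   compact sets, is stated on the maps, resp. on the sets, that generate these
   topologies. *)
Record DJS_hypergroup (conv : K -> K -> cmeasure) (inv : K -> K) (e : K)
    : Prop := DJSHypergroup {
  djs_locally_compact : locally_compact [set: K];
  djs_hausdorff : hausdorff_space K;
  djs_conv_probability : forall x y, is_probability (conv x y);
  djs_conv_continuous : forall f, Cc f ->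
    continuous (fun xy : K * K => cintegral (conv xy.1 xy.2) f : C^o);
  djs_inv_involutive : involutive inv;
  djs_inv_continuous : continuous inv;
  djs_assoc : exists2 cv, convolution_extension conv cv &
    forall x y z, meq (cv (point_measure x) (conv y z))
                      (cv (conv x y) (point_measure z));
  djs_supp_compact : forall x y, compact (supp (conv x y));
  djs_inv_conv : forall x y (E : set borel), measurable E ->
    mval (conv x y) (inv @^-1` E) = mval (conv (inv y) (inv x)) E;
  djs_unitl : forall x, meq (conv e x) (point_measure x);
  djs_unitr : forall x, meq (conv x e) (point_measure x);
  djs_unit_supp : forall x y, supp (conv x (inv y)) e <-> x = y;
  djs_supp_nonvoid : forall x y, supp (conv x y) !=set0;
  djs_supp_continuous : forall U V : set K, open U -> open V ->
    open [set xy : K * K | supp (conv xy.1 xy.2) `&` U !=set0 /\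
                           supp (conv xy.1 xy.2) `<=` V] }.

End ComplexMeasures.

(* Main.v *)
Require Import Defs.
From HB Require Import structures.
From Stdlib Require List.
From mathcomp Require Import all_boot all_order all_algebra.
From mathcomp Require Import complex.
From mathcomp Require Import all_classical all_reals all_analysis.
From mathcomp Require Import ring.
Set Implicit Arguments.
Unset Strict Implicit.
Unset Printing Implicit Defensive.
Import Order.TTheory GRing.Theory Num.Theory.
Import numFieldNormedType.Exports.
Local Open Scope classical_set_scope.
Local Open Scope ring_scope.
Local Open Scope sesquilinear_scope.
Local Notation is_unitary := Defs.is_unitary.

(* A matrix corepresentation t is a representation phi |-> phi(t) of the
   convolution algebra of linear functionals on A, and a family of matrices over
   A is determined by these values.  Complete reducibility of unitary
   corepresentations and Schur's lemma make the entries of the t^alpha a basis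
   of A.  Let phi_gamma be the functional dual to t_11^gamma.  It is a
   self-adjoint idempotent, and
   c_{alpha beta}(gamma) = phi_gamma(t_11^alpha t_11^beta) is a diagonal entry of
   its image in the unitary corepresentation t^alpha (x) t^beta, so it is a sum of
   squares; the counit gives total mass 1, and associativity of A gives (H1).

   The entrywise conjugate u of t^alpha is equivalent to some t^beta, say
   M u = t^beta M.  Uniqueness of F forces F_alpha^T = lam M^* M with lam > 0, and
   f_z(u) = (F_alpha^{-z})^T, so that ((t_ij^alpha)^-) = (F^{1/2})^T u (F^{-1/2})^T
   is unitary of class beta.  By uniqueness of the biinvariant element of
   counit 1, t_11^beta = (t_11^alpha)^*, whence (H3).  For (H5), with h the Haar
   functional, c_{alpha, bar beta}(e) = h(t_11^alpha (t_11^beta)^* ), which Schur's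
   lemma evaluates: it vanishes for alpha <> beta, and for alpha = beta it is a
   nonzero multiple of the diagonal entry (M^* M)_11.

   As K is discrete, a measure on K is regular iff it is concentrated on a
   countable set, and the convolution extends to all measures by integration. *)

(** * Linear functionals and tensor products *)

Section LinearFunctionals.
Variables (C : numClosedFieldType) (V : lmodType C).

(** The tensor product is a quotient with no basis at hand, so equalities in it are tested on pairs
    of functionals, whose existence rests on Zorn's lemma. Independence of the matrix coefficients
    must come before any Haar functional: it is obtained from Schur's lemma alone, and the Haar
    functional is then the dual-basis functional of the unit, whose invariance is checked on the
    basis.

    The conjugate [u] need not be unitary, so complete reducibility says nothing about it; its class
    is found by building an intertwiner out of dual functionals. Conjugating [u] by a power of F
    does not change that class, so the choice of the involution on K and its relation to the star
    come from [u], while the powers of F serve to identify the class of the second involution.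

    On the measure side the obstacle is that the integral against a charge goes through a Hahn
    decomposition of that very charge, so additivity in the charge is not formal, and K may be
    uncountable. Regularity supplies a countable carrier; exhausting it by finite sets reduces
    everything to point masses and dominated convergence. *)

Definition is_subspace (S : set V) : Prop :=
  S 0 /\ forall k a b, S a -> S b -> S (k *: a + b).

Lemma is_subspaceZ S k a : is_subspace S -> S a -> S (k *: a).
Proof. by move=> [S0 Sl] Sa; rewrite -[_ *: _]addr0; exact: Sl. Qed.

Lemma is_subspaceD S a b : is_subspace S -> S a -> S b -> S (a + b).
Proof. by move=> [S0 Sl] Sa Sb; rewrite -[a]scale1r; exact: Sl. Qed.

Lemma is_subspaceB S a b : is_subspace S -> S a -> S b -> S (a - b).
Proof. by move=> [S0 Sl] Sa Sb; rewrite -scaleN1r addrC; exact: Sl. Qed.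

Lemma is_subspace_sum S (I : Type) (r : seq I) (P : pred I) (a : I -> V) :
  is_subspace S -> (forall i, P i -> S (a i)) -> S (\sum_(i <- r | P i) a i).
Proof.
move=> sS aS; elim/big_ind: _ => //; first by case: sS.
by move=> x y; exact: is_subspaceD.
Qed.

Lemma lspan_is_subspace (X : set V) : is_subspace (lspan X).
Proof.
split=> [|k _ _ [n [c [x [xX ->]]]] [m [d [y [yX ->]]]]].
  exists 0%N, (fun=> 0), (fun=> 0); split; first by case.
  by rewrite big_ord0.
exists (n + m)%N, (fun i => match fintype.split i with inl j => k * c j | inr j => d j end),
  (fun i => match fintype.split i with inl j => x j | inr j => y j end); split.
  by move=> i; case: fintype.split.
rewrite big_split_ord /= scaler_sumr; congr (_ + _); apply: eq_bigr => i _.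
  by have := unsplitK (inl i : 'I_n + 'I_m)%type => /= ->; rewrite scalerA.
by have := unsplitK (inr i : 'I_n + 'I_m)%type => /= ->.
Qed.

Lemma sub_lspan (X : set V) : X `<=` lspan X.
Proof.
move=> a Xa; exists 1%N, (fun=> 1), (fun=> a).
by rewrite big_ord1 scale1r.
Qed.

Lemma lspan_sub (X S : set V) : is_subspace S -> X `<=` S -> lspan X `<=` S.
Proof.
move=> sS XS _ [n [c [x [xX ->]]]]; apply: is_subspace_sum => // i _.
by apply: is_subspaceZ => //; exact/XS.
Qed.

(** A subspace containing [H] and maximal among those that avoid [v] is a complement of the line
    through [v]; [phi] is the coordinate along [v]. *)
Lemma functional_separation (H : set V) (v : V) : is_subspace H -> ~ H v ->
  exists2 phi : {scalar V}, forall h, H h -> phi h = 0 & phi v = 1.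
Proof.
(* The empty chain has empty union, so [P] only asks that the union with [H] be a subspace; for the
   empty set this is the hypothesis on [H]. *)
move=> sH Hv; pose P (X : set V) := is_subspace (X `|` H) /\ ~ X v.
have [F FP tF|X [[sX Xv] Xmax]] := @Zorn_bigcup V P.
  split=> [|[X /FP[_ Xv]] //]; split; first by right; case: sH.
  move=> k a b.
  have key X : F X -> (X `|` H) a -> (X `|` H) b ->
      (\bigcup_(X in F) X `|` H) (k *: a + b).
    move=> FX Xa Xb; have [[_ sX] _] := FP _ FX.
    by case: (sX k _ _ Xa Xb); [left; exists X | right].
  move=> [[X FX Xa]|Ha] [[Y FY Yb]|Hb].
  - have [XY|YX] := tF _ _ FX FY.
      by apply: (key Y) => //; left => //; exact: XY.
    by apply: (key X) => //; left => //; exact: YX.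
  - by apply: (key X) => //; [left | right].
  - by apply: (key Y) => //; [right | left].
  - by right; apply: sH.2.
pose Y := X `|` H; have Yv : ~ Y v by case.
have dec x : exists k, Y (x - k *: v).
  apply: contrapT => nx.
  pose Z := [set z | exists k y, Y y /\ z = y + k *: x].
  have YZ : Y `<=` Z by move=> y Yy; exists 0, y; rewrite scale0r addr0.
  have Zx : Z x.
    by exists 1, 0; rewrite scale1r add0r; split=> //; case: sX.
  have xY : ~ Y x by move=> Yx; apply: nx; exists 0; rewrite scale0r subr0.
  apply: (Xmax Z).
    split=> [|XZ]; first by move=> y Xy; apply: YZ; left.
    by apply: xY; left; apply: XZ.
  have ZH : Z `|` H = Z.
    by apply/setUidPl => y Hy; apply: YZ; right.
  split.
    rewrite ZH; split; first by apply: YZ; case: sX.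
    move=> k _ _ [i [y [Yy ->]]] [j [z [Yz ->]]].
    exists (k * i + j), (k *: y + z); split; first exact: sX.2.
    by rewrite scalerDr scalerA scalerDl addrACA.
  move=> [k [y [Yy vE]]]; apply: nx; exists k^-1.
  have k0 : k != 0.
    by apply/eqP => k0; move: vE; rewrite k0 scale0r addr0 => vy; apply: Yv; rewrite vy.
  rewrite vE scalerDr scalerA mulVf// scale1r opprD addrCA subrr addr0 -scaleNr.
  exact: is_subspaceZ.
have uniq x i j : Y (x - i *: v) -> Y (x - j *: v) -> i = j.
  move=> Yi Yj; apply/eqP; rewrite -subr_eq0; apply/eqP; apply: contrapT => /eqP ij.
  apply: Yv; have := is_subspaceZ (i - j)^-1 sX (is_subspaceB sX Yj Yi).
  have -> : x - j *: v - (x - i *: v) = (i - j) *: v.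
    by rewrite scalerBl opprB addrC addrA subrK.
  by rewrite scalerA mulVf// scale1r.
pose phi x := sval (cid (dec x)).
have phiP x : Y (x - phi x *: v) by rewrite /phi; case: cid.
have phi_lin : GRing.linear_for *%R phi.
  move=> k a b /=; apply: (uniq (k *: a + b)); first exact: phiP.
  have := sX.2 k _ _ (phiP a) (phiP b).
  by rewrite scalerBr scalerA addrACA -opprD -scalerDl.
pose phiL := GRing.isLinear.Build C V C *%R phi phi_lin.
pose phiF : {scalar V} := HB.pack phi phiL.
exists phiF => [h Hh|]; first by apply: (uniq h (phi h)) => //; rewrite scale0r subr0; right.
by apply: (uniq v (phi v)) => //; rewrite scale1r subrr; case: sX.
Qed.

Lemma functional_eq0 (v : V) : (forall phi : {scalar V}, phi v = 0) -> v = 0.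
Proof.
move=> v0; apply: contrapT => nv.
have [|phi _ /eqP] := @functional_separation [set 0] v _ nv.
  by split=> // k a b /= -> ->; rewrite scaler0 addr0.
by rewrite v0 eq_sym oner_eq0.
Qed.

End LinearFunctionals.

Section TensorFunctionals.
Variable C : numClosedFieldType.

Lemma tlift0 (U V : lmodType C) (W : zmodType) (f : U -> V -> W) :
  balanced f -> tlift f 0 = 0.
Proof.
move=> bf; have := tliftD 0 0 bf; rewrite addr0 -{1}[tlift f 0]addr0.
by move/addrI.
Qed.

Lemma tlift_sum (U V : lmodType C) (W : zmodType) (f : U -> V -> W)
    (I : Type) (r : seq I) (x : I -> U ⊗ V) : balanced f ->
  tlift f (\sum_(i <- r) x i) = \sum_(i <- r) tlift f (x i).
Proof.
move=> bf; elim: r => [|i r ih]; first by rewrite !big_nil tlift0.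
by rewrite !big_cons tliftD// ih.
Qed.

Lemma tlift_sum_pure (U V : lmodType C) (W : zmodType) (f : U -> V -> W)
    (I : Type) (r : seq I) (a : I -> U) (b : I -> V) : balanced f ->
  tlift f (\sum_(i <- r) a i ⊗ b i) = \sum_(i <- r) f (a i) (b i).
Proof.
by move=> bf; rewrite tlift_sum//; apply: eq_bigr => i _; rewrite tlift_pure.
Qed.

Lemma balanced_functionals (U V : lmodType C) (phi : {scalar U})
    (psi : {scalar V}) : balanced (fun u v => phi u * psi v).
Proof.
split=> [u u' v|u v v'|k u v]; rewrite ?linearD ?mulrDl ?mulrDr//.
by rewrite !linearZ/= mulrCA mulrA.
Qed.

Lemma balanced_functionalr (U V : lmodType C) (phi : {scalar V}) :
  balanced (fun (u : U) (v : V) => phi v *: u).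
Proof.
split=> [u u' v|u v v'|k u v]; rewrite ?linearD ?scalerDl ?scalerDr//.
by rewrite !linearZ/= !scalerA mulrC.
Qed.

Lemma pureDl (U V : lmodType C) (u u' : U) (v : V) : (u + u') ⊗ v = u ⊗ v + u' ⊗ v.
Proof. exact: (balancedDl (pure_balanced U V)). Qed.

Lemma pureDr (U V : lmodType C) (u : U) (v v' : V) : u ⊗ (v + v') = u ⊗ v + u ⊗ v'.
Proof. exact: (balancedDr (pure_balanced U V)). Qed.

Lemma pureZr (U V : lmodType C) k (u : U) (v : V) : u ⊗ (k *: v) = (k *: u) ⊗ v.
Proof. by rewrite (balancedZ (pure_balanced U V)). Qed.

Lemma pure0l (U V : lmodType C) (v : V) : (0 : U) ⊗ v = 0.
Proof.
have := pureDl (0 : U) 0 v; rewrite addr0 -{1}[0 ⊗ v]addr0.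
by move/addrI.
Qed.

Lemma pure_sumr (U V : lmodType C) (I : Type) (r : seq I) (P : pred I)
    (u : U) (a : I -> V) :
  u ⊗ (\sum_(i <- r | P i) a i) = \sum_(i <- r | P i) u ⊗ a i.
Proof.
elim/big_rec2: _ => [|i x y _ <-]; last by rewrite pureDr.
by rewrite -[X in u ⊗ X](scale0r 0) pureZr scale0r pure0l.
Qed.

Definition tensor_functional (U V : lmodType C) (phi : {scalar U})
  (psi : {scalar V}) (x : U ⊗ V) : C := tlift (fun u v => phi u * psi v) x.

Lemma tensor_functional_eq0 (U V : lmodType C) (x : U ⊗ V) :
  (forall (phi : {scalar U}) (psi : {scalar V}), tensor_functional phi psi x = 0) ->
  x = 0.
Proof.
(* A representation of x of minimal length has linearly independent right
   factors. *)
rewrite (tensor_sum x); move: (repr x) => s.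
have [n] := ubnP (size s); elim: n s => // n ih s; rewrite ltnS => sn s0.
rewrite (big_nth (0, 0)) big_mkord; pose a (i : 'I_(size s)) := nth (0, 0) s i.
have [ind|] := pselect (forall c : 'I_(size s) -> C,
    \sum_i c i *: (a i).2 = 0 -> forall i, c i = 0).
  rewrite big1// => i _; have -> : (nth (0, 0) s i).1 = 0.
    apply: functional_eq0 => phi; apply: (ind (fun i => phi (a i).1)).
    apply: functional_eq0 => psi; rewrite linear_sum -[RHS](s0 phi psi).
    rewrite /tensor_functional tlift_sum_pure; last exact: balanced_functionals.
    rewrite [RHS](big_nth (0, 0)) big_mkord; apply: eq_bigr => j _.
    by rewrite linearZ.
  by rewrite pure0l.
move=> /existsNP[c /not_implyP[c0 /existsNP[i0 /eqP ci0]]].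
pose b i := ((a i).1 - (c i / c i0) *: (a i0).1, (a i).2).
have E : \sum_(i < size s) (nth (0, 0) s i).1 ⊗ (nth (0, 0) s i).2 =
    \sum_(p <- [seq b i | i <- enum (predC1 i0)]) p.1 ⊗ p.2.
  rewrite big_map big_enum [LHS](bigD1 i0)//=.
  transitivity (\sum_(i | i != i0) ((a i).1 ⊗ (a i).2 - (c i / c i0) *: ((a i0).1 ⊗ (a i).2))).
    rewrite sumrB [RHS]addrC; congr (_ + _).
    have := c0; rewrite (bigD1 i0)//= => /eqP; rewrite addr_eq0 => /eqP ci0E.
    have -> : nth (0, 0) s i0 = a i0 by [].
    have -> : (a i0).2 = \sum_(i | i != i0) - (c i / c i0) *: (a i).2.
      rewrite -[LHS]scale1r -(mulVf ci0) -scalerA ci0E scalerN scaler_sumr -sumrN.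
      by apply: eq_bigr => i _; rewrite scalerA mulrC scaleNr.
    rewrite pure_sumr -sumrN; apply: eq_bigr => i _.
    by rewrite pureZr -pureZ scaleNr.
  apply: eq_bigr => i _ /=.
  by rewrite -scaleNr pureZ -pureDl scaleNr.
have := ih [seq b i | i <- enum (predC1 i0)].
rewrite -E; apply.
  rewrite size_map -cardE.
  have := cardC (pred1 i0); rewrite card1 card_ord add1n => E'.
  exact: leq_trans (eq_leq E') sn.
by move=> phi psi; rewrite -(s0 phi psi) [in RHS](big_nth (0, 0)) big_mkord.
Qed.

End TensorFunctionals.

(** * The dual algebra and Schur's lemma *)

Section MatrixFamilies.
Variables (C : numClosedFieldType) (I : Type).

(** Invariant subspaces are row spaces, acted on from the right, and [W] is any matrix of
    generators. The index type carries no algebra structure, so that the family may run over all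
    functionals. *)
Definition mxirr n (rho : I -> 'M[C]_n) : Prop :=
  forall r (W : 'M[C]_(r, n)), (forall i, (W *m rho i <= W)%MS) ->
    W = 0 \/ row_full W.

(** Schur's lemma: the row space of [X] is invariant under [sigma], its left kernel under [rho]. *)
Lemma mxirr_intertwiner m n (rho : I -> 'M[C]_m) (sigma : I -> 'M[C]_n)
    (X : 'M[C]_(m, n)) : mxirr rho -> mxirr sigma ->
  (forall i, rho i *m X = X *m sigma i) -> X = 0 \/ row_free X && row_full X.
Proof.
move=> irho isigma XE.
have [->|Xfull] := isigma _ X (fun i => eq_ind _ (fun Y => Y <= X)%MS (submxMl _ _) _ (XE i)).
  by left.
have [K0|Kfull] : kermx X = 0 \/ row_full (kermx X).
  by apply: irho => i; apply/sub_kermxP; rewrite -mulmxA XE mulmxA mulmx_ker mul0mx.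
- by right; rewrite Xfull -kermx_eq0 K0 eqxx.
- left; have := mulmx_ker X => KX.
  by have [B BK] := row_fullP Kfull; rewrite -[X]mul1mx -BK -mulmxA KX mulmx0.
Qed.

(** For an eigenvalue [a] of [X], the intertwiner [X - a%:M] has a nonzero kernel, hence vanishes.
    Size 0 is treated apart because it has no eigenvalue. *)
Lemma mxirr_scalar n (rho : I -> 'M[C]_n) (X : 'M[C]_n) : mxirr rho ->
  (forall i, rho i *m X = X *m rho i) -> exists a, X = a%:M.
Proof.
case: n rho X => [|n] rho X irho XE; first by exists 0; rewrite [X]flatmx0 [RHS]flatmx0.
have [//|a Xa] := @eigenvalue_closed C n.+1 X.
exists a; apply/eqP; rewrite -subr_eq0; apply/eqP.
have XaE i : rho i *m (X - a%:M) = (X - a%:M) *m rho i.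
  by rewrite mulmxBl mulmxBr XE scalar_mxC.
have [//|/andP[]] := mxirr_intertwiner irho irho XaE.
by rewrite -kermx_eq0 => /eqP X0; move: Xa; rewrite /eigenvalue /eigenspace X0 eqxx.
Qed.

Lemma mxirr_conjg n (rho sigma : I -> 'M[C]_n) (P Q : 'M[C]_n) :
  P *m Q = 1%:M -> (forall i, sigma i = P *m rho i *m Q) -> mxirr rho -> mxirr sigma.
Proof.
move=> PQ sE irho r W Winv; have QP := mulmx1C PQ.
have [|WP0|WPf] := irho r (W *m P).
- move=> i; have -> : W *m P *m rho i = W *m sigma i *m P.
    by rewrite sE -!mulmxA QP mulmx1.
  exact: submxMr.
- by left; rewrite -[W]mulmx1 -PQ mulmxA WP0 mul0mx.
- right; have [B BW] := row_fullP WPf; apply/row_fullP; exists (P *m B).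
  by rewrite -[W]mulmx1 -PQ mulmxA -!mulmxA (mulmxA B) (mulmxA (B *m W)) -(mulmxA B) BW mul1mx.
Qed.

End MatrixFamilies.

(** The size is a successor because [is_irreducible] speaks of diagonal blocks of successor
    sizes. *)
Lemma row_base_succ (C : fieldType) m n (W : 'M[C]_(m, n)) : W != 0 ->
  exists q (B : 'M[C]_(q.+1, n)), row_free B /\ (B :=: W)%MS.
Proof.
rewrite -mxrank_eq0; case E : (\rank W) => [//|q] _; exists q.
move: (row_base W) (row_base_free W) (eq_row_base W); rewrite E => B fB BW.
by exists B.
Qed.

Lemma mxrank_gt_size (C : fieldType) m n (M : 'M[C]_(m, n)) (M' : 'M[C]_(n, m)) :
  M *m M' = 1%:M -> (m <= n)%N.
Proof.
by move=> MM'; rewrite -(@mxrank1 C m) -MM' (leq_trans (mxrankM_maxl _ _))// rank_leq_col.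
Qed.

Section DualAlgebra.
Variables (C : numClosedFieldType) (A : hopfStarAlgebra C).
Implicit Types (phi psi : {scalar A}).

Lemma starD (a b : A) : star (a + b) = star a + star b.
Proof. by rewrite -[a]scale1r star_antilinear rmorph1 !scale1r. Qed.

Lemma star0 : star (0 : A) = 0.
Proof. by have := starD 0 0; rewrite addr0 -{1}[star 0]addr0 => /addrI. Qed.

Lemma starZ k (a : A) : star (k *: a) = k^* *: star a.
Proof. by rewrite -[k *: a]addr0 star_antilinear star0 addr0. Qed.

Lemma star_sum (I : Type) (r : seq I) (P : pred I) (a : I -> A) :
  star (\sum_(i <- r | P i) a i) = \sum_(i <- r | P i) star (a i).
Proof. exact: (big_morph _ starD star0). Qed.

Lemma tensor_functional_linear phi psi :
  GRing.linear_for *%R (tensor_functional phi psi).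
Proof.
move=> k x y; rewrite /tensor_functional tliftD; last exact: balanced_functionals.
congr (_ + _); rewrite tlift_scale; last exact: balanced_functionals.
by rewrite /tlift mulr_sumr; apply: eq_bigr => p _; rewrite linearZ/= mulrA.
Qed.

Definition convol phi psi (a : A) : C := tensor_functional phi psi (comul A a).

Lemma convol_linear phi psi : GRing.linear_for *%R (convol phi psi).
Proof. by move=> k a b; rewrite /convol linearP tensor_functional_linear. Qed.

HB.instance Definition _ phi psi :=
  GRing.isLinear.Build C A C *%R (convol phi psi) (convol_linear phi psi).

(** The involution of the dual algebra: [t] is unitary exactly when evaluation on [t] carries it to
    the conjugate transpose ([is_unitaryP]). *)
Definition adjoint_functional phi (a : A) : C := (phi (star (antipode A a)))^*.

Lemma adjoint_functional_linear phi : GRing.linear_for *%R (adjoint_functional phi).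
Proof.
move=> k a b; rewrite /adjoint_functional linearP/= star_antilinear linearP/=.
by rewrite rmorphD rmorphM /= conjCK.
Qed.

HB.instance Definition _ phi :=
  GRing.isLinear.Build C A C *%R (adjoint_functional phi) (adjoint_functional_linear phi).

Definition conj_functional phi (a : A) : C := (phi (star a))^*.

Lemma conj_functional_linear phi : GRing.linear_for *%R (conj_functional phi).
Proof.
move=> k a b; rewrite /conj_functional star_antilinear linearP/=.
by rewrite rmorphD rmorphM /= conjCK.
Qed.

HB.instance Definition _ phi :=
  GRing.isLinear.Build C A C *%R (conj_functional phi) (conj_functional_linear phi).

Definition ev phi m n (t : 'M[A]_(m, n)) : 'M[C]_(m, n) := map_mx phi t.

Lemma evE phi m n (t : 'M[A]_(m, n)) i j : ev phi t i j = phi (t i j).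
Proof. by rewrite mxE. Qed.

Lemma ev_inj m n (s t : 'M[A]_(m, n)) : (forall phi, ev phi s = ev phi t) -> s = t.
Proof.
move=> st; apply/matrixP => i j; apply/eqP; rewrite -subr_eq0; apply/eqP.
apply: functional_eq0 => phi; rewrite linearB -!evE.
by rewrite st subrr.
Qed.

Lemma ev_liftl phi m n p (M : 'M[C]_(m, n)) (t : 'M[A]_(n, p)) :
  ev phi (lift_scalars A M *m t) = M *m ev phi t.
Proof.
apply/matrixP => i j; rewrite !mxE linear_sum; apply: eq_bigr => k _.
by rewrite !mxE mulr_algl linearZ.
Qed.

Lemma ev_liftr phi m n p (M : 'M[C]_(n, p)) (t : 'M[A]_(m, n)) :
  ev phi (t *m lift_scalars A M) = ev phi t *m M.
Proof.
apply/matrixP => i j; rewrite !mxE linear_sum; apply: eq_bigr => k _.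
by rewrite !mxE mulr_algr linearZ/= mulrC.
Qed.

Lemma corep_convol n (t : 'M[A]_n) phi psi : is_corep t ->
  ev (convol phi psi) t = ev phi t *m ev psi t.
Proof.
move=> ct; apply/matrixP => i j; rewrite !mxE /= /convol (ct i j).1 /tensor_functional.
rewrite tlift_sum_pure; last exact: balanced_functionals.
by apply: eq_bigr => k _; rewrite !mxE.
Qed.

Lemma corep_counit n (t : 'M[A]_n) : is_corep t -> ev (counit A) t = 1%:M.
Proof. by move=> ct; apply/matrixP => i j; rewrite evE [RHS]mxE; exact: (ct i j).2. Qed.

(** Pairs of functionals separate the elements of the tensor product, so multiplicativity of
    evaluation is the same as the comultiplication formula. *)
Lemma is_corepP n (t : 'M[A]_n) :
  (forall phi psi, ev (convol phi psi) t = ev phi t *m ev psi t) ->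
  ev (counit A) t = 1%:M -> is_corep t.
Proof.
move=> tM t1 i j; split; last by have /matrixP/(_ i j) := t1; rewrite evE [RHS]mxE.
apply/eqP; rewrite -subr_eq0; apply/eqP; apply: tensor_functional_eq0 => phi psi.
have lin x y : tensor_functional phi psi (x - y) =
    tensor_functional phi psi x - tensor_functional phi psi y.
  by rewrite -scaleN1r addrC tensor_functional_linear mulN1r addrC.
have /matrixP/(_ i j) := tM phi psi; rewrite !mxE /= /convol lin => ->.
rewrite /tensor_functional tlift_sum_pure; last exact: balanced_functionals.
by apply/eqP; rewrite subr_eq0; apply/eqP; apply: eq_bigr => k _; rewrite !mxE.
Qed.

Lemma is_unitaryP n (t : 'M[A]_n) :
  is_unitary t <-> forall phi, ev (adjoint_functional phi) t = (ev phi t)^t*.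
Proof.
split=> [ut phi|ut i j].
  by apply/matrixP => i j; rewrite !mxE /= /adjoint_functional ut starK.
apply: (can_inj (@starK _ A)); rewrite starK.
apply/eqP; rewrite -subr_eq0; apply/eqP; apply: functional_eq0 => phi.
have /matrixP/(_ i j) := ut phi; rewrite !mxE /= /adjoint_functional.
by move=> /(can_inj conjCK) E; rewrite linearB/= E subrr.
Qed.

Lemma corep_equivP m n (s : 'M[A]_m) (t : 'M[A]_n) : corep_equiv s t <->
  exists (M : 'M[C]_(n, m)) (M' : 'M[C]_(m, n)),
    [/\ M *m M' = 1%:M, M' *m M = 1%:M &
        forall phi, M *m ev phi s = ev phi t *m M].
Proof.
split=> [[M [M' [MM' M'M st]]]|[M [M' [MM' M'M st]]]]; exists M, M'; split=> //.
  by move=> phi; rewrite -ev_liftl st ev_liftr.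
by apply: ev_inj => phi; rewrite ev_liftl st ev_liftr.
Qed.

(** Since the lower left block is 0, the lower rows [W] of the change of basis span an invariant
    subspace. They are independent, hence not 0, and too few to span everything. *)
Lemma mxirr_is_irreducible n (t : 'M[A]_n) :
  mxirr (fun phi => ev phi t) -> is_irreducible t.
Proof.
move=> irr [p [q [a [b [d /corep_equivP[M [M' [MM' M'M tE]]]]]]]].
pose W := dsubmx M; have WE phi : W *m ev phi t = ev phi d *m W.
  rewrite /W mul_dsub_mx tE -[M in RHS]vsubmxK /ev map_block_mx.
  by rewrite -[M in LHS]vsubmxK mul_block_col col_mxKd col_mxKd map_mx0 mul0mx add0r.
have [W0|Wf] := irr _ W (fun phi => eq_ind_r (fun Y => Y <= W)%MS (submxMl _ _) (WE phi)).
  have : W *m M' = row_mx 0 1%:M.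
    by rewrite /W mul_dsub_mx MM' scalar_mx_block /block_mx col_mxKd.
  rewrite W0 mul0mx => /matrixP/(_ ord0 (rshift _ ord0)).
  by rewrite row_mxEr !mxE eqxx => /eqP; rewrite eq_sym oner_eq0.
have := mxrank_gt_size MM'; have := rank_leq_row W; rewrite (eqP Wf).
by move=> h1 h2; have := leq_trans h2 h1; rewrite addSn ltnNge leq_addl.
Qed.

(** A basis of a complement stacked above a basis of a proper nonzero invariant subspace is a change
    of basis to block triangular form. *)
Lemma is_irreducible_mxirr n (t : 'M[A]_n) :
  is_irreducible t -> mxirr (fun phi => ev phi t).
Proof.
move=> irr r W Winv; apply: contrapT => /not_orP[/eqP W0 /negP Wf].
apply: irr; have W0' : (W^C)%MS != 0.
  apply: contra Wf; rewrite -mxrank_eq0 mxrank_compl /row_full.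
  by rewrite subn_eq0 => h; rewrite eqn_leq h rank_leq_col.
have [q [B [fB BW]]] := row_base_succ W0.
have [p [D [fD DW]]] := row_base_succ W0'.
pose M := col_mx D B.
have rM : \rank M = n.
  rewrite -addsmxE (adds_eqmx DW BW) addsmxC.
  by have := addsmx_compl_full W => /eqP.
have sM : (p.+1 + q.+1)%N = n.
  have := mxrank_compl W; rewrite -DW -BW.
  rewrite (eqP fB) (eqP fD) => ->; rewrite subnK//.
  by rewrite -(eqP fB) rank_leq_col.
(* The two sizes of [M] agree only propositionally, so a left and a right inverse are obtained
   separately from the rank and then identified. *)
have [M' M'M] : exists M', M' *m M = 1%:M by apply/row_fullP; rewrite /row_full rM.
have [M'' MM''] : exists M', M *m M' = 1%:M by apply/row_freeP; rewrite /row_free rM sM.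
have E : M' = M'' by rewrite -[M']mulmx1 -MM'' mulmxA M'M mul1mx.
subst M''; pose X := lift_scalars A M *m t *m lift_scalars A M'.
exists p, q, (ulsubmx X), (ursubmx X), (drsubmx X); exists M, M'; split=> //.
have <- : dlsubmx X = 0.
  apply: ev_inj => phi; rewrite [RHS]map_mx0 /ev map_dlsubmx -/(ev phi X).
  rewrite /X ev_liftr ev_liftl /M mul_col_mx mul_col_mx.
  rewrite /dlsubmx col_mxKd.
  have /submxP[Y ->] : (B *m ev phi t <= B)%MS.
    by rewrite (eqmxMr _ BW) BW.
  rewrite -mulmxA -mulmx_lsub.
  have := MM''; rewrite /M mul_col_mx scalar_mx_block /block_mx => /eq_col_mx[_ ->].
  by rewrite mulmx_lsub mul_mx_row row_mxKl mulmx0.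
rewrite submxK /X -mulmxA -lift_scalarsM M'M lift_scalars1 mulmx1.
by [].
Qed.

End DualAlgebra.

(** * Bases of matrix coefficients *)

Section Decomposition.
Variables (C : numClosedFieldType) (A : hopfStarAlgebra C).

Lemma subspace_lift_scalars (S : set A) m n p q (M : 'M[C]_(m, n))
    (X : 'M[A]_(n, p)) (N : 'M[C]_(p, q)) : is_subspace S ->
  (forall i j, S (X i j)) ->
  forall i j, S ((lift_scalars A M *m X *m lift_scalars A N) i j).
Proof.
move=> sS SX i j; rewrite mxE; apply: is_subspace_sum => // k _.
rewrite [lift_scalars _ _ _ _]mxE mulr_algr; apply: is_subspaceZ => //.
rewrite mxE; apply: is_subspace_sum => // l _.
by rewrite [lift_scalars _ _ _ _]mxE mulr_algl; exact: is_subspaceZ.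
Qed.

Lemma corep_equiv_conj m n (s : 'M[A]_m) (t : 'M[A]_n) : corep_equiv s t ->
  exists (M : 'M[C]_(n, m)) (M' : 'M[C]_(m, n)),
    M' *m M = 1%:M /\ s = lift_scalars A M' *m t *m lift_scalars A M.
Proof.
move=> [M [M' [_ M'M st]]]; exists M, M'; split=> //.
by rewrite -mulmxA -st mulmxA -lift_scalarsM M'M lift_scalars1 mul1mx.
Qed.

Lemma corep_equiv_entries m n (s : 'M[A]_m) (t : 'M[A]_n) (S : set A) :
  corep_equiv s t -> is_subspace S -> (forall i j, S (t i j)) ->
  forall i j, S (s i j).
Proof.
by move=> /corep_equiv_conj[M [M' [_ ->]]] sS St; exact: subspace_lift_scalars.
Qed.

(** The rows of [B] are an orthonormal basis of an invariant subspace. The compression of [T] to it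
    is multiplicative by invariance, and compatible with adjoints because the basis is
    orthonormal. *)
Lemma unitary_subcorep r n (B : 'M[C]_(r, n)) (T : 'M[A]_n) :
  is_corep T -> is_unitary T -> B \is unitarymx ->
  (forall phi : {scalar A}, (B *m ev phi T <= B)%MS) ->
  exists T1 : 'M[A]_r, [/\ is_corep T1, is_unitary T1 &
    forall phi : {scalar A}, B *m ev phi T = ev phi T1 *m B].
Proof.
move=> cT uT /unitarymxP BB Binv.
pose T1 := lift_scalars A B *m T *m lift_scalars A (B^t*).
have T1E phi : ev phi T1 = B *m ev phi T *m B^t* by rewrite ev_liftr ev_liftl.
have T1B phi : B *m ev phi T = ev phi T1 *m B.
  have /submxP[D E] := Binv phi.
  by rewrite T1E E -(mulmxA D) BB mulmx1.
exists T1; split=> //.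
- apply: is_corepP => [phi psi|].
    by rewrite (T1E (convol _ _)) (T1E psi) corep_convol// mulmxA T1B !mulmxA.
  by rewrite T1E corep_counit// mulmx1.
- apply/is_unitaryP => phi; rewrite !T1E; have /is_unitaryP -> := uT.
  by rewrite !trmx_mul !map_mxM /= trmxCK mulmxA.
Qed.

Local Notation "B ^!" :=
  (orthomx Num.Def.conjC (mx_of_hermitian (hermitian1mx _)) B) : matrix_set_scope.

Variables (t : cqg_dual A -> iurep A).
Hypothesis t_class : forall alpha, class_of (t alpha) = alpha.

Definition matrix_coefficients : set A :=
  [set a | exists alpha i j, a = t alpha i j].

Lemma iurep_equiv_rep (u : iurep A) : corep_equiv u (t (class_of u)).
Proof.
have /eqmodP/asboolP := t_class (class_of u).
exact: corep_equiv_sym.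
Qed.

(** Complete reducibility, by strong induction on the size: a reducible [T] splits along an
    invariant subspace and its orthogonal complement into two smaller unitary corepresentations,
    whose entries span those of [T]. *)
Lemma unitary_corep_span n (T : 'M[A]_n) : is_corep T -> is_unitary T ->
  forall i j, lspan matrix_coefficients (T i j).
Proof.
have [k] := ubnP n; elim: k n T => // k ih n T; rewrite ltnS => nk cT uT.
have [irrT|nirrT] := pselect (is_irreducible T).
  case: n T nk cT uT irrT => [|n] T nk cT uT irrT; first by case.
  pose u := IURep (IrrUnitaryCorep cT uT irrT).
  apply: (corep_equiv_entries (iurep_equiv_rep u)).
    exact: lspan_is_subspace.
  by move=> i j; apply: sub_lspan; exists (class_of u), i, j.
have /existsNP[r /existsNP[W /not_implyP[Winv /not_orP[/eqP W0 /negP Wf]]]] :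
    ~ mxirr (fun phi : {scalar A} => ev phi T).
  by move=> /mxirr_is_irreducible.
pose B1 := schmidt (row_base W); pose B2 := schmidt (row_base W^!%MS).
have Q := schmidt_complete_unitarymx W; rewrite /schmidt_complete in Q.
have B1W : (B1 :=: W)%MS.
  exact: (eqmx_trans (eqmx_schmidt_free (row_base_free W)) (eq_row_base W)).
have B2W : (B2 :=: W^!)%MS.
  exact: (eqmx_trans (eqmx_schmidt_free (row_base_free _)) (eq_row_base _)).
have rW : (\rank W < n)%N by rewrite ltn_neqAle rank_leq_col andbT.
have rW' : (\rank W^!%MS < n)%N.
  by rewrite rank_ortho ltn_subrL lt0n mxrank_eq0 W0 (leq_ltn_trans _ rW).
have uB1 : B1 \is unitarymx by rewrite schmidt_unitarymx// ltnW.
have uB2 : B2 \is unitarymx by rewrite schmidt_unitarymx// ltnW.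
(* The adjoint of the value of [T] at [phi] is its value at [adjoint_functional phi], which
   preserves [W]; so the value at [phi] preserves the orthogonal complement. *)
have W'inv (phi : {scalar A}) : (W^! *m ev phi T <= W^!)%MS.
  apply/orthomx1P; have /is_unitaryP uT' := uT.
  rewrite -mulmxA -[ev phi T]trmxCK -map_mxM -trmx_mul -uT'.
  have /submxP[D ->] := Winv (adjoint_functional phi).
  rewrite trmx_mul map_mxM mulmxA.
  by have /orthomx1P -> := submx_refl (W^!)%MS; rewrite mul0mx.
have B1inv (phi : {scalar A}) : (B1 *m ev phi T <= B1)%MS.
  by rewrite (eqmxMr _ B1W) B1W; exact: Winv.
have B2inv (phi : {scalar A}) : (B2 *m ev phi T <= B2)%MS.
  by rewrite (eqmxMr _ B2W) B2W; exact: W'inv.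
have [T1 [cT1 uT1 E1]] := unitary_subcorep cT uT uB1 B1inv.
have [T2 [cT2 uT2 E2]] := unitary_subcorep cT uT uB2 B2inv.
have TE : T = lift_scalars A (B1^t*) *m T1 *m lift_scalars A B1 +
    lift_scalars A (B2^t*) *m T2 *m lift_scalars A B2.
  apply: ev_inj => phi.
  rewrite [RHS](map_mxD phi) -!/(ev _ _) !ev_liftr !ev_liftl -!mulmxA -E1 -E2 !mulmxA.
  rewrite -mulmxDl -[LHS]mul1mx; congr (_ *m _).
  have := mulmxKtV 1%:M Q (add_rank_ortho W).
  by rewrite tr_col_mx map_row_mx mul1mx mul_row_col => <-.
move=> i j; rewrite TE mxE; apply: is_subspaceD; first exact: lspan_is_subspace.
  apply: subspace_lift_scalars; first exact: lspan_is_subspace.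
  by apply: ih => //; exact: leq_trans rW nk.
apply: subspace_lift_scalars; first exact: lspan_is_subspace.
by apply: ih => //; exact: leq_trans rW' nk.
Qed.

End Decomposition.

Lemma cqg_span (C : numClosedFieldType) (A : cqgAlgebra C) (t : cqg_dual A -> iurep A) :
  (forall alpha, class_of (t alpha) = alpha) ->
  forall a : A, lspan (matrix_coefficients t) a.
Proof.
move=> t_class a; apply: (lspan_sub (lspan_is_subspace _) _ (cqgP a)).
move=> _ [n [T [cT uT [i [j ->]]]]].
exact: unitary_corep_span.
Qed.

Lemma cqg_functional_ext (C : numClosedFieldType) (A : cqgAlgebra C)
    (t : cqg_dual A -> iurep A) (V : lmodType C) (f g : A -> V) :
  (forall alpha, class_of (t alpha) = alpha) ->
  is_subspace [set a | f a = g a] ->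
  (forall alpha i j, f (t alpha i j) = g (t alpha i j)) -> f =1 g.
Proof.
move=> t_class fg fgt a; apply: (lspan_sub fg _ (cqg_span t_class a)).
by move=> _ [alpha [i [j ->]]]; exact: fgt.
Qed.

Lemma functional_inj (C : numClosedFieldType) (V : lmodType C) (a b : V) :
  (forall phi : {scalar V}, phi a = phi b) -> a = b.
Proof.
move=> ab; apply/eqP; rewrite -subr_eq0; apply/eqP; apply: functional_eq0 => phi.
by rewrite linearB/= ab subrr.
Qed.

(** * Subspaces of row vectors given as sets *)

Section RowSubspaces.
Variable C : numClosedFieldType.

(** A matrix of maximal rank with row space inside [S] generates [S], since adjoining any further
    vector of [S] would raise the rank. *)
Lemma rV_subspaceP n (S : set 'rV[C]_n) : is_subspace S ->
  exists W : 'M[C]_n, forall x, S x <-> (x <= W)%MS.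
Proof.
move=> sS; pose P k := `[< exists W : 'M[C]_n, (forall x : 'rV_n, (x <= W)%MS -> S x) /\ \rank W = k >].
have exP : exists k, P k.
  exists 0%N; apply/asboolP; exists 0; split; last by rewrite mxrank0.
  by move=> x; rewrite submx0 => /eqP ->; case: sS.
have ubP k : P k -> (k <= n)%N by move=> /asboolP[W [_ <-]]; exact: rank_leq_col.
case: (ex_maxnP exP ubP) => k /asboolP[W [WS rW]] kmax.
exists W => x; split; last exact: WS.
move=> Sx; have WxS (y : 'rV_n) : (y <= W + x)%MS -> S y.
  move=> /sub_addsmxP[[u1 u2] /= ->]; apply: is_subspaceD => //.
    by apply: WS; exact: submxMl.
  have -> : u2 *m x = u2 0 0 *: x.
    by apply/rowP => j; rewrite !mxE big_ord1.
  exact: is_subspaceZ.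
have := kmax (\rank (W + x)%MS); rewrite -rW => h.
have := mxrank_leqif_sup (addsmxSl W x); rewrite addsmx_sub submx_refl /= => <-.
rewrite eqn_leq mxrankS ?addsmxSl//=; apply: h.
by apply/asboolP; exists (W + x)%MS.
Qed.

Lemma mxirr_subspace (I : Type) n (rho : I -> 'M[C]_n) (S : set 'rV[C]_n) :
  mxirr rho -> is_subspace S -> (forall i x, S x -> S (x *m rho i)) ->
  (forall x, S x -> x = 0) \/ (forall x, S x).
Proof.
move=> irr sS Sinv; have [W SW] := rV_subspaceP sS.
have [i|W0|Wf] := irr _ W.
- by apply/row_subP => j; rewrite row_mul; apply/SW/Sinv/SW; exact: row_sub.
- by left=> x /SW; rewrite W0 submx0 => /eqP.
- by right=> x; apply/SW; exact: submx_full.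
Qed.

End RowSubspaces.

Section Ract.
Variables (C : numClosedFieldType) (A : hopfStarAlgebra C).

Lemma ract_functional (phi psi : {scalar A}) a : psi (ract a phi) = convol phi psi a.
Proof.
by rewrite /ract /tlift linear_sum; apply: eq_bigr => p _; rewrite linearZ.
Qed.

Lemma ractB (phi : {scalar A}) a b : ract (a - b) phi = ract a phi - ract b phi.
Proof. by apply: functional_inj => psi; rewrite [RHS]linearB !ract_functional linearB. Qed.

Lemma ract0 (phi : {scalar A}) : ract 0 phi = 0.
Proof. by apply: functional_inj => psi; rewrite ract_functional !linear0. Qed.

End Ract.

Lemma irreducible_intertwiner (C : numClosedFieldType) (A : hopfStarAlgebra C)
    m n (s : 'M[A]_m) (u : 'M[A]_n) (X : 'M[C]_(n, m)) :
  mxirr (fun phi : {scalar A} => ev phi s) ->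
  mxirr (fun phi : {scalar A} => ev phi u) ->
  (forall phi : {scalar A}, X *m ev phi s = ev phi u *m X) ->
  X = 0 \/ exists X' : 'M[C]_(m, n), X *m X' = 1%:M /\ X' *m X = 1%:M.
Proof.
move=> irrs irru XE.
have [|/andP[/row_freeP[Y XY] /row_fullP[Z ZX]]] :=
  mxirr_intertwiner irru irrs (fun phi => esym (XE phi)).
  by left.
right; exists Y; split=> //.
by rewrite -[Y]mul1mx -ZX -(mulmxA Z) XY mulmx1.
Qed.

(** * Linear independence of the matrix coefficients *)

Section MatrixCoefficients.
Variables (C : numClosedFieldType) (A : hopfStarAlgebra C).
Variables (t : cqg_dual A -> iurep A).
Hypothesis t_class : forall alpha, class_of (t alpha) = alpha.

Lemma t_corep alpha : is_corep (t alpha). Proof. exact: iuc_corep (iumxP _). Qed.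
Lemma t_unitary alpha : is_unitary (t alpha). Proof. exact: iuc_unitary (iumxP _). Qed.
Lemma t_mxirr alpha : mxirr (fun phi : {scalar A} => ev phi (t alpha)).
Proof. exact/is_irreducible_mxirr/(iuc_irreducible (iumxP _)). Qed.

Lemma rep_intertwiner alpha beta X :
  (forall phi : {scalar A}, X *m ev phi (t alpha) = ev phi (t beta) *m X) ->
  X = 0 \/ alpha = beta.
Proof.
move=> XE; have [|[X' [XX' X'X]]] :=
  irreducible_intertwiner (@t_mxirr alpha) (@t_mxirr beta) XE.
  by left.
right; rewrite -(t_class alpha) -(t_class beta); apply/eqmodP/asboolP.
by apply/corep_equivP; exists X, X'.
Qed.

Lemma rep_scalar alpha X :
  (forall phi : {scalar A}, X *m ev phi (t alpha) = ev phi (t alpha) *m X) ->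
  exists a, X = a%:M.
Proof.
move=> XE; apply: mxirr_scalar (@t_mxirr alpha) _ => phi.
by rewrite XE.
Qed.

(** The action [ract] of functionals moves only the row [x] ([coef_ract]). For fixed [v] the
    elements [coef x v] thus form a stable space on which functionals act as on the rows of
    t^alpha. *)
Definition coef alpha (x : 'rV[C]_(deg (t alpha)).+1) (v : 'cV[C]_(deg (t alpha)).+1) : A :=
  (lift_scalars A x *m t alpha *m lift_scalars A v) 0 0.

Lemma coef_functional (phi : {scalar A}) alpha x v :
  phi (@coef alpha x v) = (x *m ev phi (t alpha) *m v) 0 0.
Proof. by rewrite -evE ev_liftr ev_liftl. Qed.

Lemma coef_delta alpha i j : @coef alpha (delta_mx 0 i) (delta_mx j 0) = t alpha i j.
Proof.
by apply: functional_inj => phi; rewrite coef_functional -rowE -colE !mxE.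
Qed.

Lemma coef_ract (phi : {scalar A}) alpha x v :
  ract (@coef alpha x v) phi = coef (x *m ev phi (t alpha)) v.
Proof.
apply: functional_inj => psi; rewrite ract_functional !coef_functional.
by rewrite corep_convol ?mulmxA//; exact: t_corep.
Qed.

Lemma coefP alpha k x y v :
  @coef alpha (k *: x + y) v = k *: coef x v + coef y v.
Proof.
apply: functional_inj => phi; rewrite linearP/= !coef_functional.
by rewrite !mulmxDl -!scalemxAl !mxE.
Qed.

Lemma coef0 alpha v : @coef alpha 0 v = 0.
Proof.
by apply: functional_inj => phi; rewrite coef_functional !mul0mx mxE linear0.
Qed.

Notation column := {alpha & 'cV[C]_(deg (t alpha)).+1}.

(** Membership in the sum of the spaces of all [coef x v], one for each column [v] listed in [L].
    The recursive form lets columns be removed one at a time. *)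
Fixpoint in_columns (L : seq column) (a : A) : Prop :=
  if L is p :: L' then exists x, in_columns L' (a - coef x (tagged p)) else a = 0.

Lemma in_columns_subspace L : is_subspace (in_columns L).
Proof.
elim: L => [|p L ih]; first by split=> // k a b /= -> ->; rewrite scaler0 addr0.
split=> [|k a b [x ax] [y by_]]; first by exists 0; rewrite coef0 subr0; case: ih.
exists (k *: x + y); rewrite coefP.
have -> : k *: a + b - (k *: coef x (tagged p) + coef y (tagged p)) =
    k *: (a - coef x (tagged p)) + (b - coef y (tagged p)).
  by rewrite scalerBr opprD addrACA.
exact: ih.2.
Qed.

Lemma in_columns_ract L phi a : in_columns L a -> in_columns L (ract a phi).
Proof.
elim: L a => [|p L ih] a /=; first by move=> ->; rewrite ract0.
move=> [x ax]; exists (x *m ev phi (t (tag p))).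
by rewrite -coef_ract -ractB; exact: ih.
Qed.

Lemma in_columns_cat L1 L2 a b :
  in_columns L1 a -> in_columns L2 b -> in_columns (L1 ++ L2) (a + b).
Proof.
elim: L1 a => [|p L ih] a /=; first by move=> ->; rewrite add0r.
by move=> [x ax] Lb; exists x; rewrite addrAC; exact: ih.
Qed.

(* If column w of t^gamma is contained in a sum of further columns, Schur's
   lemma exchanges it, one column at a time, for a combination of those columns
   that belong to the same class gamma. *)
Lemma in_columns_full L gamma (w : 'cV[C]_(deg (t gamma)).+1) :
  (forall x, in_columns L (coef x w)) ->
  forall r : 'rV[C]_(deg (t gamma)).+1,
    (forall v, List.In (existT _ gamma v) L -> r *m v = 0) -> r *m w = 0.
Proof.
elim: L w => [|[alpha v] L ih] w Lw r rL.
  have := congr1 (counit A) (Lw r); rewrite /= coef_functional corep_counit; last first.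
    exact: t_corep.
  by rewrite mulmx1 linear0 => rw; apply/matrixP => i j; rewrite !ord1 rw mxE.
pose P x y := in_columns L (coef x w - @coef alpha y v).
have PE x : exists y, P x y by exact: Lw.
have Pl k x y x' y' : P x y -> P x' y' -> P (k *: x + x') (k *: y + y').
  move=> xy x'y'; rewrite /P !coefP.
  have -> : k *: coef x w + coef x' w - (k *: coef y v + coef y' v) =
      k *: (coef x w - coef y v) + (coef x' w - coef y' v).
    by rewrite scalerBr opprD addrACA.
  exact: (in_columns_subspace L).2.
have P0 : P 0 0 by rewrite /P !coef0 subrr; case: (in_columns_subspace L).
have Pact phi x y : P x y -> P (x *m ev phi (t gamma)) (y *m ev phi (t alpha)).
  by move=> /(in_columns_ract phi); rewrite ractB !coef_ract.
have caseA : (forall x, in_columns L (coef x w)) -> r *m w = 0.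
  by move=> Lw'; apply: ih => // u Lu; apply: rL; right.
have sN : is_subspace [set y | in_columns L (@coef alpha y v)].
  split=> [|k y y' /= Ly Ly']; first by rewrite /= coef0; case: (in_columns_subspace L).
  by rewrite coefP; exact: (in_columns_subspace L).2.
have Ninv phi y : in_columns L (@coef alpha y v) ->
    in_columns L (coef (y *m ev phi (t alpha)) v).
  by move=> Ly; rewrite -coef_ract; exact: in_columns_ract.
(* The rows [y] for which [coef y v] already lies in the other columns form an invariant space. If
   it is everything, column [v] is redundant; if it is 0, [P] is the graph of a linear intertwiner,
   given by the matrix [X]. *)
have [N0|Nall] := mxirr_subspace (@t_mxirr alpha) sN Ninv; last first.
  apply: caseA => x; have [y Pxy] := PE x; rewrite -[coef x w](subrK (coef y v)).
  by apply: is_subspaceD => //; [exact: in_columns_subspace | exact: Nall].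
have Pu x y y' : P x y -> P x y' -> y = y'.
  move=> xy xy'; apply/eqP; rewrite -subr_eq0; apply/eqP/N0 => /=.
  have := Pl (-1) _ _ _ _ xy xy'; rewrite /P !scaleN1r addNr coef0 sub0r.
  move=> /(is_subspaceZ (-1) (in_columns_subspace L)); rewrite scaleN1r opprK.
  move=> /(is_subspaceZ (-1) (in_columns_subspace L)).
  congr in_columns; apply: functional_inj => phi.
  rewrite linearZ/= !coef_functional !mulmxDl !mulNmx !mxE.
  by rewrite mulrDr mulN1r opprK mulN1r.
pose X := \matrix_i sval (cid (PE (delta_mx 0 i))).
have PX x : P x (x *m X).
  rewrite [x in P x _]row_sum_delta mulmx_sum_row.
  elim/big_rec2: _ => // i y z _ yz.
  by apply: Pl => //; rewrite rowK; case: cid.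
have XE phi : X *m ev phi (t alpha) = ev phi (t gamma) *m X.
  apply/row_matrixP => i; rewrite !rowE !mulmxA.
  by apply: (Pu (delta_mx 0 i *m ev phi (t gamma))) => //; exact: Pact.
have [X0|agE] := rep_intertwiner XE.
  by apply: caseA => x; have := PX x; rewrite X0 mulmx0 /P coef0 subr0.
subst alpha; have [a Xa] := rep_scalar XE.
have rv : r *m v = 0 by apply: rL; left.
have -> : w = (w - a *: v) + a *: v by rewrite subrK.
rewrite mulmxDr -scalemxAr rv scaler0 addr0; apply: ih => [x|u Lu]; last first.
  by apply: rL; right.
have := PX x; rewrite Xa /P; congr in_columns; apply: functional_inj => phi.
rewrite linearB/= !coef_functional mulmxBr -scalemxAr mul_mx_scalar -!scalemxAl.
by rewrite !mxE.
Qed.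

(** In [Q], coefficients of column [q] of t^gamma outside row [p] are collected in [y], all others
    in the columns [L]. If t_pq were in [Q], the nonzero row e_p - y would lie in the invariant
    space of those [x] whose coefficient against e_q lies in the columns [L]. By irreducibility all
    of column [q] would then lie there, although the row e_q kills every column of class gamma in
    [L] and not the column e_q. *)
Lemma matrix_coefficient_independent gamma (p q : 'I_(deg (t gamma)).+1) :
  ~ lspan [set a | exists alpha (i j : 'I_(deg (t alpha)).+1),
      a = t alpha i j /\
      ~~ [&& alpha == gamma, i == p :> nat & j == q :> nat]] (t gamma p q).
Proof.
move=> Hpq; pose Q a := exists (L : seq column) (y : 'rV[C]_(deg (t gamma)).+1),
  [/\ forall v, List.In (existT _ gamma v) L -> v q 0 = 0, y 0 p = 0 &
      in_columns L (a - coef y (delta_mx q 0))].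
have sQ : is_subspace Q.
  split=> [|k a b [L [y [Lq yp Ly]]] [M [z [Mq zp Mz]]]].
    exists [::], 0; split=> //; first by rewrite mxE.
    by rewrite coef0 subr0.
  exists (L ++ M), (k *: y + z); split.
  + by move=> v /(@List.in_app_or _ _ _ _)[/Lq|/Mq].
  + by rewrite !mxE yp zp mulr0 addr0.
  + rewrite coefP opprD addrACA -scalerBr; apply: in_columns_cat => //.
    by apply: is_subspaceZ => //; exact: in_columns_subspace.
have {}Hpq : Q (t gamma p q).
  apply: lspan_sub sQ _ _ Hpq => _ [alpha [i [j [-> ne]]]].
  have [agE|ag] := eqVneq alpha gamma.
    subst alpha; have [jq|jq] := eqVneq j q.
      exists [::], (delta_mx 0 i); rewrite jq coef_delta subrr; split=> //.
      rewrite mxE eqxx /=; case: eqP => // pi; move: ne.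
      by rewrite pi jq !eqxx.
    exists [:: existT _ gamma (delta_mx j 0)], 0; split; rewrite ?mxE//.
      move=> v [e|//]; rewrite -(eq_from_Tagged e).
      by rewrite mxE eq_sym (negPf jq).
    by exists (delta_mx 0 i); rewrite /= coef_delta coef0 subr0 subrr.
  exists [:: existT _ alpha (delta_mx j 0)], 0; split; rewrite ?mxE//.
    by move=> v [/(congr1 (@projT1 _ _)) /= agE|//]; rewrite agE eqxx in ag.
  by exists (delta_mx 0 i); rewrite /= coef_delta coef0 subr0 subrr.
have [L [y [Lq yp Ly]]] := Hpq.
pose S := [set x | in_columns L (@coef gamma x (delta_mx q 0))].
have sS : is_subspace S.
  split=> [|k x x' /= Lx Lx']; first by rewrite /S /= coef0; case: (in_columns_subspace L).
  by rewrite /S /= coefP; exact: (in_columns_subspace L).2.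
have Sinv phi x : S x -> S (x *m ev phi (t gamma)).
  by move=> Sx; rewrite /S /= -coef_ract; exact: in_columns_ract.
have Sy : S (delta_mx 0 p - y).
  move: Ly; rewrite /S /= -coef_delta; congr in_columns; apply: functional_inj => phi.
  by rewrite linearB/= !coef_functional !mulmxBl !mxE.
have [S0|Sall] := mxirr_subspace (@t_mxirr gamma) sS Sinv.
  have /matrixP/(_ 0 p) := S0 _ Sy.
  by rewrite !mxE !eqxx yp subr0 => /eqP; rewrite oner_eq0.
have rL v : List.In (existT _ gamma v) L -> delta_mx 0 q *m v = 0 :> 'M[C]_1.
  by move=> Lv; apply/matrixP => i j; rewrite !ord1 -rowE !mxE Lq.
have /matrixP/(_ 0 0) := in_columns_full Sall rL.
by rewrite mul_delta_mx !mxE !eqxx => /eqP; rewrite oner_eq0.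
Qed.

(** Indices are compared as natural numbers because [i] and [p] live in different types until
    [alpha] and [gamma] are identified. *)
Lemma dual_functional gamma (p q : 'I_(deg (t gamma)).+1) :
  exists phi : {scalar A}, forall alpha i j, phi (t alpha i j) =
    [&& alpha == gamma, i == p :> nat & j == q :> nat]%:R.
Proof.
have [phi phi0 phi1] := functional_separation (lspan_is_subspace _)
  (@matrix_coefficient_independent gamma p q).
exists phi => alpha i j; have [/and3P[/eqP ag]|ne] := boolP [&& _, _ & _].
  by subst alpha => /eqP/val_inj -> /eqP/val_inj ->.
by apply: phi0; apply: sub_lspan; exists alpha, i, j.
Qed.

End MatrixCoefficients.

(** * Tensor products and conjugates of corepresentations *)

Section CorepProducts.
Variables (C : numClosedFieldType) (A : hopfStarAlgebra C).

Lemma balanced_mul2 (y : A ⊗ A) :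
  balanced (fun a b : A => tlift (fun a' b' => (a * a') ⊗ (b * b')) y).
Proof.
rewrite /tlift; split=> [u u' v|u v v'|k u v].
- by rewrite -big_split; apply: eq_bigr => p _ /=; rewrite mulrDl pureDl.
- by rewrite -big_split; apply: eq_bigr => p _ /=; rewrite mulrDl pureDr.
- by apply: eq_bigr => p _; rewrite -!scalerAl pureZr.
Qed.

Lemma balanced_mul1 (a b : A) : balanced (fun a' b' => (a * a') ⊗ (b * b')).
Proof.
split=> [u u' v|u v v'|k u v]; rewrite ?mulrDr ?pureDl ?pureDr//.
by rewrite -!scalerAr pureZr.
Qed.

Lemma balanced_antipodel : balanced (fun x y => antipode A x * y).
Proof.
split=> [u u' v|u v v'|k u v]; rewrite ?linearD ?mulrDl ?mulrDr//.
by rewrite linearZ -scalerAl -scalerAr.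
Qed.

Lemma balanced_antipoder : balanced (fun x y => x * antipode A y).
Proof.
split=> [u u' v|u v v'|k u v]; rewrite ?linearD ?mulrDl ?mulrDr//.
by rewrite linearZ -scalerAl -scalerAr.
Qed.

Lemma corep_antipodel n (s : 'M[A]_n) i j : is_corep s ->
  \sum_k antipode A (s i k) * s k j = (i == j)%:R.
Proof.
move=> cs; have := antipodeL (s i j).
rewrite (cs i j).1 (cs i j).2 tlift_sum_pure; last exact: balanced_antipodel.
by move=> ->; case: (i == j); rewrite ?scale1r ?scale0r.
Qed.

Lemma corep_antipoder n (s : 'M[A]_n) i j : is_corep s ->
  \sum_k s i k * antipode A (s k j) = (i == j)%:R.
Proof.
move=> cs; have := antipodeR (s i j).
rewrite (cs i j).1 (cs i j).2 tlift_sum_pure; last exact: balanced_antipoder.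
by move=> ->; case: (i == j); rewrite ?scale1r ?scale0r.
Qed.

Lemma comul_corep_mul m n (s : 'M[A]_m) (u : 'M[A]_n) i j k l :
  is_corep s -> is_corep u ->
  comul A (s i j * u k l) =
    \sum_p \sum_q (s i p * u k q) ⊗ (s p j * u q l).
Proof.
move=> cs cu; rewrite comulM (cs i j).1 (cu k l).1 /tmul.
rewrite tlift_sum_pure; last exact: balanced_mul2.
by apply: eq_bigr => p _; rewrite tlift_sum_pure//; exact: balanced_mul1.
Qed.

Lemma tlift_comul_corep_mul (W : zmodType) (f : A -> A -> W) m n (s : 'M[A]_m)
    (u : 'M[A]_n) i j k l : balanced f -> is_corep s -> is_corep u ->
  tlift f (comul A (s i j * u k l)) =
    \sum_p \sum_q f (s i p * u k q) (s p j * u q l).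
Proof.
move=> bf cs cu; rewrite comul_corep_mul// tlift_sum//.
by apply: eq_bigr => p _; rewrite tlift_sum_pure.
Qed.

(* The matrix of conjugates (s_ji u_lk)^* is a right inverse of the tensor
   product of s and u, and the antipode provides a left inverse. *)
Lemma antipode_unitary_mul m n (s : 'M[A]_m) (u : 'M[A]_n) i j k l :
  is_corep s -> is_corep u -> is_unitary s -> is_unitary u ->
  antipode A (s i j * u k l) = star (s j i * u l k).
Proof.
move=> cs cu us uu.
have right_inv p q p0 q0 :
    \sum_j \sum_l (s p j * u q l) * star (s p0 j * u q0 l) =
    ((p == p0) && (q == q0))%:R.
  transitivity (\sum_j s p j * ((q == q0)%:R * antipode A (s j p0))).
    apply: eq_bigr => a _; rewrite -(corep_antipoder q q0 cu) mulr_suml mulr_sumr.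
    by apply: eq_bigr => b _; rewrite starM uu us !mulrA.
  case: (q == q0); last by rewrite andbF big1// => a _; rewrite mul0r mulr0.
  by rewrite andbT -(corep_antipoder p p0 cs); apply: eq_bigr => a _; rewrite mul1r.
have left_inv a b : \sum_p \sum_q antipode A (s i p * u k q) * (s p a * u q b) =
    ((i == a) && (k == b))%:R.
  have := antipodeL (s i a * u k b).
  rewrite tlift_comul_corep_mul//; last exact: balanced_antipodel.
  move=> ->; rewrite rmorphM/= (cs i a).2 (cu k b).2.
  by case: (i == a); case: (k == b); rewrite ?mulr1 ?mulr0 ?scale1r ?scale0r.
transitivity (\sum_p \sum_q antipode A (s i p * u k q) *
    (\sum_a \sum_b (s p a * u q b) * star (s j a * u l b))).
  rewrite (bigD1 j)//= (bigD1 l)//= right_inv !eqxx mulr1.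
  rewrite !big1 ?addr0// => [p pj|q ql].
    by rewrite big1// => q _; rewrite right_inv (negPf pj) mulr0.
  by rewrite right_inv (negPf ql) andbF mulr0.
transitivity (\sum_a \sum_b (\sum_p \sum_q antipode A (s i p * u k q) *
    (s p a * u q b)) * star (s j a * u l b)).
  under eq_bigr => p _ do under eq_bigr => q _ do rewrite mulr_sumr.
  under eq_bigr => p _ do rewrite exchange_big /=.
  rewrite exchange_big /=; apply: eq_bigr => a _.
  under eq_bigr => p _ do under eq_bigr => q _ do rewrite mulr_sumr.
  under eq_bigr => p _ do rewrite exchange_big /=.
  rewrite exchange_big /=; apply: eq_bigr => b _.
  rewrite mulr_suml; apply: eq_bigr => p _.
  by rewrite mulr_suml; apply: eq_bigr => q _; rewrite mulrA.
rewrite (bigD1 i)//= (bigD1 k)//= left_inv !eqxx mul1r.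
rewrite !big1 ?addr0// => [a ai|b bk].
  by rewrite big1// => b _; rewrite left_inv eq_sym (negPf ai) mul0r.
by rewrite left_inv [k == b]eq_sym (negPf bk) andbF mul0r.
Qed.

(** A self-adjoint functional takes a Hermitian matrix as its value on a unitary corepresentation,
    here on the tensor product of [s] and [u]. *)
Lemma hermitian_functional_mul (phi : {scalar A}) m n (s : 'M[A]_m) (u : 'M[A]_n) i j k l :
  is_corep s -> is_corep u -> is_unitary s -> is_unitary u ->
  adjoint_functional phi =1 phi ->
  phi (s i j * u k l) = (phi (s j i * u l k))^*.
Proof.
move=> cs cu us uu adj; rewrite -adj /adjoint_functional.
by rewrite antipode_unitary_mul// starK.
Qed.

Lemma projection_functional_mul_ge0 (phi : {scalar A}) m n (s : 'M[A]_m) (u : 'M[A]_n) i k :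
  is_corep s -> is_corep u -> is_unitary s -> is_unitary u ->
  adjoint_functional phi =1 phi -> convol phi phi =1 phi ->
  0 <= phi (s i i * u k k).
Proof.
move=> cs cu us uu adj idem; rewrite -idem /convol /tensor_functional.
rewrite tlift_comul_corep_mul//; last exact: balanced_functionals.
apply: sumr_ge0 => p _; apply: sumr_ge0 => q _.
by rewrite (hermitian_functional_mul _ _ _ _ cs cu us uu adj) mulrC mul_conjC_ge0.
Qed.

Definition conj_corep n (s : 'M[A]_n) : 'M[A]_n := map_mx (@star C A) s.

Lemma balanced_star2 : balanced (fun u v : A => star u ⊗ star v).
Proof.
split=> [u u' v|u v v'|k u v]; rewrite ?starD ?pureDl ?pureDr//.
by rewrite !starZ pureZr.
Qed.

Lemma conj_is_corep n (s : 'M[A]_n) : is_corep s -> is_corep (conj_corep s).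
Proof.
move=> cs i j; rewrite !mxE comul_star counit_star (cs i j).1 (cs i j).2 conjC_nat.
split=> //; rewrite /tmap tlift_sum_pure; last exact: balanced_star2.
by apply: eq_bigr => k _; rewrite !mxE.
Qed.

Lemma conj_functionalK (phi : {scalar A}) : conj_functional (conj_functional phi) =1 phi.
Proof. by move=> a; rewrite /conj_functional /= /conj_functional starK conjCK. Qed.

Lemma ev_eq (phi psi : {scalar A}) m n (s : 'M[A]_(m, n)) :
  phi =1 psi -> ev phi s = ev psi s.
Proof. by move=> e; apply/matrixP => i j; rewrite !evE e. Qed.

Lemma ev_conj_corep (phi : {scalar A}) n (s : 'M[A]_n) :
  ev phi (conj_corep s) = map_mx Num.conj (ev (conj_functional phi) s).
Proof. by apply/matrixP => i j; rewrite !mxE /conj_functional /= conjCK. Qed.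

(** The values of the conjugate are the complex conjugates of the values of [s], and entrywise
    conjugation preserves inclusion of row spaces and rank. *)
Lemma conj_corep_mxirr n (s : 'M[A]_n) :
  mxirr (fun phi : {scalar A} => ev phi s) ->
  mxirr (fun phi : {scalar A} => ev phi (conj_corep s)).
Proof.
move=> irr r W Winv; have cK k l (X : 'M[C]_(k, l)) : map_mx Num.conj (map_mx Num.conj X) = X.
  by apply/matrixP => i j; rewrite !mxE conjCK.
have [phi|W0|Wf] := irr r (map_mx Num.conj W).
- rewrite -(map_submx Num.conj) map_mxM /= cK.
  have := Winv (conj_functional phi); rewrite ev_conj_corep.
  by rewrite (ev_eq _ (conj_functionalK _)).
- by left; rewrite -[W]cK W0 map_mx0.
- by right; move: Wf; rewrite /row_full mxrank_map.
Qed.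

End CorepProducts.

(** * The dual basis and the classes of irreducible corepresentations *)

Section DualBasis.
Variables (C : numClosedFieldType) (A : cqgAlgebra C).
Variables (t : cqg_dual A -> iurep A).
Hypothesis t_class : forall alpha, class_of (t alpha) = alpha.

Lemma functional_ext (phi psi : {scalar A}) :
  (forall alpha i j, phi (t alpha i j) = psi (t alpha i j)) -> phi =1 psi.
Proof.
apply: (cqg_functional_ext (V := C^o)) => //.
by split=> [|k a b /= ea eb]; rewrite /= ?linear0// !linearP ea eb.
Qed.

(** The matrix units of the dual algebra: evaluation on t^gamma gives the matrix unit at [(p, q)],
    evaluation on any other t^alpha gives 0. *)
Definition dual_coef gamma (p q : 'I_(deg (t gamma)).+1) : {scalar A} :=
  sval (cid (dual_functional t_class p q)).

Lemma dual_coefE gamma p q alpha i j : @dual_coef gamma p q (t alpha i j) =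
  [&& alpha == gamma, i == p :> nat & j == q :> nat]%:R.
Proof. by rewrite /dual_coef; case: cid. Qed.

Lemma convol_t phi psi alpha i j :
  convol phi psi (t alpha i j) = \sum_k phi (t alpha i k) * psi (t alpha k j).
Proof.
have /matrixP/(_ i j) := corep_convol phi psi (@t_corep _ _ t alpha).
by rewrite !mxE => ->; apply: eq_bigr => k _; rewrite !mxE.
Qed.

Lemma adjoint_t phi alpha i j :
  adjoint_functional phi (t alpha i j) = (phi (t alpha j i))^*.
Proof. by rewrite /adjoint_functional t_unitary starK. Qed.

Lemma dual_coef_convol gamma p : convol (@dual_coef gamma p p) (dual_coef p p) =1 dual_coef p p.
Proof.
apply: functional_ext => alpha i j; rewrite /= convol_t dual_coefE.
under eq_bigr => k _ do rewrite !dual_coefE.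
have [ag|_] := eqVneq alpha gamma; last by rewrite big1// => k _; rewrite mul0r.
subst alpha; rewrite (bigD1 p)//= eqxx andbT big1 ?addr0 => [|k kp].
  by case: (_ == _); rewrite ?mul0r ?mul1r.
have -> : (k == p :> nat) = false by apply: negbTE.
by rewrite andbF mul0r.
Qed.

Lemma dual_coef_adjoint gamma p : adjoint_functional (@dual_coef gamma p p) =1 dual_coef p p.
Proof.
apply: functional_ext => alpha i j; rewrite /= adjoint_t !dual_coefE conjC_nat.
by rewrite [X in _ && X]andbC.
Qed.

(** Left multiplication by [phi] acts on a column of matrix units through the matrix of [phi] on
    t^gamma. This makes matrix units a source of intertwiners in [irr_corep_equiv]. *)
Lemma convol_dual_coef phi gamma p q a :
  convol phi (@dual_coef gamma p q) a = \sum_r phi (t gamma r p) * dual_coef r q a.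
Proof.
apply: (cqg_functional_ext (V := C^o) t_class (f := convol phi (dual_coef p q))
  (g := fun a => \sum_r phi (t gamma r p) * dual_coef r q a)).
  split=> [|k b c /= eb ec] /=.
    by rewrite linear0 big1// => r _; rewrite linear0 mulr0.
  rewrite linearP /= eb ec mulr_sumr -big_split; apply: eq_bigr => r _ /=.
  by rewrite linearP /= mulrDr mulrCA.
move=> alpha i j; rewrite convol_t.
under eq_bigr => k _ do rewrite dual_coefE.
under [RHS]eq_bigr => k _ do rewrite dual_coefE.
have [ag|_] := eqVneq alpha gamma; last first.
  by rewrite !big1// => k _; rewrite mulr0.
subst alpha; rewrite (bigD1 p)//= [RHS](bigD1 i)//= !eqxx /=.
rewrite !big1 ?addr0// => k; rewrite -val_eqE => /negPf kp.
  by rewrite eq_sym kp mulr0.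
by rewrite kp mulr0.
Qed.

Definition coef_index := {gamma : cqg_dual A & ('I_(deg (t gamma)).+1 * 'I_(deg (t gamma)).+1)%type}.
Definition coef_at (x : coef_index) : A := t (tag x) (tagged x).1 (tagged x).2.
Definition dual_at (x : coef_index) : {scalar A} := dual_coef (tagged x).1 (tagged x).2.

Lemma dual_at_coef x y : dual_at x (coef_at y) = (y == x)%:R.
Proof.
rewrite /dual_at dual_coefE; congr (nat_of_bool _)%:R.
case: x y => [al [i j]] [be [k l]] /=; apply/and3P/eqP => [[/eqP ab]|e].
  by subst be => /eqP/val_inj -> /eqP/val_inj ->.
have ab : be = al := congr1 (@tag _ _) e.
by subst be; have [-> ->] := eq_from_Tagged e; rewrite !eqxx.
Qed.

(** The matrix coefficients span. The expansion is taken over a duplicate-free list, so that each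
    dual functional isolates exactly one coefficient. *)
Lemma dual_at_eq0 a : (forall x, dual_at x a = 0) -> a = 0.
Proof.
pose S := [set b | exists (L : seq coef_index) (c : coef_index -> C),
  uniq L /\ b = \sum_(x <- L) c x *: coef_at x].
have sS : is_subspace S.
  split=> [|k _ _ [L [c [uL ->]]] [M [d [uM ->]]]].
    by exists [::], (fun=> 0); rewrite big_nil.
  exists (undup (L ++ M)), (fun x => (x \in L)%:R * (k * c x) + (x \in M)%:R * d x).
  split; first exact: undup_uniq.
  under [RHS]eq_bigr => x _ do rewrite scalerDl.
  rewrite big_split /= scaler_sumr; congr (_ + _).
    rewrite [RHS](bigID [in L]) /= [X in _ + X]big1 ?addr0 => [|x /negPf ->]; last first.
      by rewrite mul0r scale0r.
    rewrite -[RHS]big_filter [RHS](perm_big L) /=; last first.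
      apply: uniq_perm => //; first by rewrite filter_uniq ?undup_uniq.
      by move=> x; rewrite mem_filter mem_undup mem_cat; case: (x \in L).
    by apply: eq_big_seq => x ->; rewrite mul1r scalerA.
  rewrite [RHS](bigID [in M]) /= [X in _ + X]big1 ?addr0 => [|x /negPf ->]; last first.
    by rewrite mul0r scale0r.
  rewrite -[RHS]big_filter [RHS](perm_big M) /=; last first.
    apply: uniq_perm => //; first by rewrite filter_uniq ?undup_uniq.
    by move=> x; rewrite mem_filter mem_undup mem_cat orbC; case: (x \in M).
  by apply: eq_big_seq => x ->; rewrite mul1r.
have [L [c [uL ->]]] : S a.
  apply: (lspan_sub sS _ (cqg_span t_class a)) => _ [alpha [i [j ->]]].
  exists [:: existT _ alpha (i, j)], (fun=> 1).
  by rewrite big_seq1 scale1r.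
move=> a0; rewrite big_seq big1// => x xL.
have := a0 x; rewrite linear_sum (bigD1_seq x)//= linearZ /= dual_at_coef eqxx mulr1.
rewrite big1 ?addr0 => [->|y yx]; first by rewrite scale0r.
by rewrite linearZ /= dual_at_coef (negPf yx) mulr0.
Qed.

(** Unitarity of [u] is not assumed. As the counit of [u 0 0] is 1, some matrix unit of class
    [gamma] is nonzero on it; evaluating the matrix units of the same column on column 0 of [u]
    yields a nonzero intertwiner [Y], invertible by Schur's lemma. *)
Lemma irr_corep_equiv n (u : 'M[A]_n.+1) : is_corep u ->
  mxirr (fun phi : {scalar A} => ev phi u) ->
  exists gamma (M : 'M[C]_((deg (t gamma)).+1, n.+1)) M',
    [/\ M *m M' = 1%:M, M' *m M = 1%:M &
        forall phi : {scalar A}, M *m ev phi u = ev phi (t gamma) *m M].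
Proof.
move=> cu irr.
have [[gamma [p q]] /eqP ux] : exists x, dual_at x (u 0 0) <> 0.
  apply: contrapT => /forallNP u0.
  have := (cu 0 0).2; rewrite eqxx (dual_at_eq0 (a := u 0 0)); last first.
    by move=> x; apply: contrapT; exact: u0.
  by rewrite linear0 => /eqP; rewrite eq_sym oner_eq0.
pose Y : 'M[C]_(n.+1, (deg (t gamma)).+1) := \matrix_(i, r) dual_coef r q (u i 0).
have YE (phi : {scalar A}) : Y *m ev phi (t gamma) = ev phi u *m Y.
  apply/matrixP => i r; have /matrixP/(_ i 0) := corep_convol phi (dual_coef r q) cu.
  rewrite !mxE /= => E.
  transitivity (convol phi (dual_coef r q) (u i 0)).
    by rewrite convol_dual_coef; apply: eq_bigr => k _; rewrite !mxE mulrC.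
  by rewrite E; apply: eq_bigr => k _; rewrite !mxE.
have [/matrixP/(_ 0 p)|[M [YM MY]]] := irreducible_intertwiner (@t_mxirr _ _ t gamma) irr YE.
  by rewrite !mxE => /eqP; rewrite (negPf ux).
exists gamma, M, Y; split=> // phi.
by rewrite -[LHS]mulmx1 -YM mulmxA -(mulmxA M) -YE !mulmxA MY mul1mx.
Qed.

Lemma conj_class alpha :
  exists beta (M : 'M[C]_((deg (t beta)).+1, (deg (t alpha)).+1)) M',
    [/\ M *m M' = 1%:M, M' *m M = 1%:M &
        forall phi : {scalar A},
          M *m ev phi (conj_corep (t alpha)) = ev phi (t beta) *m M].
Proof.
apply: irr_corep_equiv; first exact/conj_is_corep/t_corep.
exact/conj_corep_mxirr/t_mxirr.
Qed.

End DualBasis.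

(** * The matrices F and the second involution *)

Lemma invmx_eq (C : fieldType) n (X Y : 'M[C]_n) : X *m Y = 1%:M -> invmx X = Y.
Proof.
move=> XY; have [uX _] := mulmx1_unit XY.
by rewrite -[Y](mulKmx uX) XY mulmx1.
Qed.

Lemma mxtrace_gram_gt0 (C : numClosedFieldType) m n (M : 'M[C]_(m, n)) :
  M != 0 -> 0 < \tr (M^t* *m M).
Proof.
move=> M0; have [i [j Mij]] : exists i j, M i j != 0.
  apply: contrapT => /forallNP M00; move/eqP: M0; apply; apply/matrixP => i j.
  by rewrite mxE; apply/eqP; apply: contrapT => /negP Mij; apply: (M00 i); exists j.
have ge0 k : 0 <= \sum_l M l k * (M l k)^*.
  by apply: sumr_ge0 => l _; exact: mul_conjC_ge0.
have -> : \tr (M^t* *m M) = \sum_k \sum_l M l k * (M l k)^*.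
  by apply: eq_bigr => k _; rewrite mxE; apply: eq_bigr => l _; rewrite !mxE mulrC.
rewrite (bigD1 j)//= ltr_pwDl ?sumr_ge0// (bigD1 i)//= ltr_pwDl ?mul_conjC_gt0//.
by apply: sumr_ge0 => l _; exact: mul_conjC_ge0.
Qed.

Section FMatrices.
Variables (C : numClosedFieldType) (A : cqgAlgebra C).

Definition antipode_functional (phi : {scalar A}) (a : A) : C := phi (antipode A a).

Lemma antipode_functional_linear phi : GRing.linear_for *%R (antipode_functional phi).
Proof. by move=> k a b; rewrite /antipode_functional !linearP. Qed.

HB.instance Definition _ phi :=
  GRing.isLinear.Build C A C *%R (antipode_functional phi) (antipode_functional_linear phi).

Lemma ev_antipode_sqr phi n (s : 'M[A]_n) :
  ev phi (map_mx (fun a => antipode A (antipode A a)) s) =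
  ev (antipode_functional (antipode_functional phi)) s.
Proof. by apply/matrixP => i j; rewrite !mxE. Qed.

Lemma F_matrix_intertwiner n (s : 'M[A]_n) (M : 'M[C]_n) (phi : {scalar A}) :
  is_F_matrix s M ->
  M *m ev phi s = ev (antipode_functional (antipode_functional phi)) s *m M.
Proof. by move=> [_ E _ _]; rewrite -ev_liftl E ev_liftr ev_antipode_sqr. Qed.

(** Unitarity turns the entrywise star into the transposed antipode; this links conjugates to the
    square of the antipode, hence to F. *)
Lemma ev_conj_unitary phi n (s : 'M[A]_n) : is_unitary s ->
  ev phi (conj_corep s) = (ev (antipode_functional phi) s)^T.
Proof.
by move=> us; apply/matrixP => i j; rewrite !mxE /= /antipode_functional us.
Qed.

Variables (t : cqg_dual A -> iurep A).
Hypothesis t_class : forall alpha, class_of (t alpha) = alpha.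

(** By Schur's lemma the two matrices differ by a scalar [a]. Positive traces give a > 0, and
    equality of the traces of a matrix and its inverse gives a^2 = 1. *)
Lemma F_matrix_unique alpha (M N : 'M[C]_((deg (t alpha)).+1)) :
  is_F_matrix (t alpha) M -> is_F_matrix (t alpha) N -> M = N.
Proof.
move=> FM FN; have [uM _ trM tM] := FM; have [uN _ trN tN] := FN.
have [a aE] : exists a, invmx N *m M = a%:M.
  apply: rep_scalar => phi; rewrite -mulmxA (F_matrix_intertwiner _ FM) !mulmxA.
  congr (_ *m _); apply: (can_inj (mulKmx uN)).
  by rewrite !mulmxA mulmxV// mul1mx (F_matrix_intertwiner _ FN) mulmxK.
have ME : M = a *: N by rewrite -(mulKVmx uN M) aE mul_mx_scalar.
have a_gt0 : 0 < a by move: tM; rewrite ME mxtraceZ pmulr_lgt0.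
have iM : invmx M = a^-1 *: invmx N.
  apply: invmx_eq; rewrite ME -scalemxAl -scalemxAr scalerA mulmxV//.
  by rewrite mulfV ?gt_eqF// scale1r.
have : a ^+ 2 = 1.
  move: trM; rewrite iM ME !mxtraceZ -trN => /(mulIf (lt0r_neq0 tN)) aa.
  by rewrite expr2 {1}aa mulVf// gt_eqF.
move=> /eqP; rewrite sqrf_eq1 => /orP[|] /eqP aE'; first by rewrite ME aE' scale1r.
by move: a_gt0; rewrite aE' ltr0N1.
Qed.

Variables (alpha beta : cqg_dual A).
Variables (M : 'M[C]_((deg (t beta)).+1, (deg (t alpha)).+1))
  (M' : 'M[C]_((deg (t alpha)).+1, (deg (t beta)).+1)).
Hypothesis MM' : M *m M' = 1%:M.
Hypothesis M'M : M' *m M = 1%:M.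
Hypothesis ME : forall phi : {scalar A},
  M *m ev phi (conj_corep (t alpha)) = ev phi (t beta) *m M.

Lemma intertwiner_neq0 : M != 0.
Proof.
apply/eqP => M0; move/matrixP/(_ 0 0): MM'; rewrite M0 mul0mx !mxE eqxx => /eqP.
by rewrite eq_sym oner_eq0.
Qed.

(** Unitarity of t^beta, pulled back along [M], says that the conjugate [u] is unitary for the inner
    product with Gram matrix K = M^* M. Transposed, this makes K^T an intertwiner from t^alpha to
    its image under the squared antipode, hence a multiple of [F]; the trace of K shows that the
    factor is positive. *)
Lemma F_matrix_positive F : is_F_matrix (t alpha) F ->
  exists2 lam, 0 < lam & F^T = lam *: (M^t* *m M).
Proof.
move=> FF; pose K := M^t* *m M; have KE phi :
    (ev phi (conj_corep (t alpha)))^t* *m K = K *m ev (adjoint_functional phi) (conj_corep (t alpha)).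
  rewrite /K mulmxA -map_mxM -trmx_mul ME trmx_mul map_mxM.
  have /is_unitaryP <- := @t_unitary _ _ t beta.
  by rewrite -!mulmxA ME.
have PE psi : K^T *m ev psi (t alpha) =
    ev (antipode_functional (antipode_functional psi)) (t alpha) *m K^T.
  have := congr1 trmx (KE (conj_functional psi)).
  rewrite !trmx_mul (ev_conj_unitary _ (@t_unitary _ _ t alpha)).
  rewrite (ev_conj_unitary _ (@t_unitary _ _ t alpha)) !trmxK.
  move=> /esym E; have e1 : ev psi (t alpha) = (map_mx Num.conj
      (ev (antipode_functional (conj_functional psi)) (t alpha)))^T.
    apply/matrixP => i j; rewrite !mxE /= /antipode_functional /conj_functional /= conjCK.
    by rewrite t_unitary starK.
  have e2 : ev (antipode_functional (antipode_functional psi)) (t alpha) =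
      ev (antipode_functional (adjoint_functional (conj_functional psi))) (t alpha).
    apply/matrixP => i j; rewrite !mxE /= /antipode_functional /adjoint_functional /=.
    by rewrite /conj_functional starK conjCK.
  by rewrite e1 e2 E.
have [uF _ trF tF] := FF; have KF phi :
    invmx F *m K^T *m ev phi (t alpha) = ev phi (t alpha) *m (invmx F *m K^T).
  rewrite -mulmxA PE !mulmxA; congr (_ *m _); apply: (can_inj (mulKmx uF)).
  by rewrite !mulmxA mulmxV// mul1mx (F_matrix_intertwiner _ FF) mulmxK.
have [a aE] := rep_scalar KF.
have KFE : K^T = a *: F by rewrite -(mulKVmx uF K^T) aE mul_mx_scalar.
have a_gt0 : 0 < a.
  have := mxtrace_gram_gt0 intertwiner_neq0.
  by rewrite -mxtrace_tr KFE mxtraceZ pmulr_lgt0.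
exists a^-1; first by rewrite invr_gt0.
by rewrite -/K -[K]trmxK KFE linearZ /= scalerA mulVf ?scale1r// gt_eqF.
Qed.

(** On the conjugate, a transposed antipode of t^alpha, the squared antipode is implemented by the
    inverse transpose of [F], and [M] carries this to t^beta. The trace condition is symmetric under
    inversion, so it survives. *)
Lemma conj_F_matrix F : is_F_matrix (t alpha) F ->
  is_F_matrix (t beta) (M *m invmx F^T *m M').
Proof.
move=> FF; have [uF _ trF tF] := FF.
have uFT : F^T \in unitmx by rewrite unitmx_tr.
have GG : (M *m invmx F^T *m M') *m (M *m F^T *m M') = 1%:M.
  by rewrite !mulmxA -(mulmxA _ M' M) M'M mulmx1 -(mulmxA M) mulVmx// mulmx1.
have FE phi : ev phi (conj_corep (t alpha)) *m F^T = F^T *m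
    ev (antipode_functional (antipode_functional phi)) (conj_corep (t alpha)).
  rewrite !(ev_conj_unitary _ (@t_unitary _ _ t alpha)) -!trmx_mul.
  by rewrite (F_matrix_intertwiner _ FF).
split.
- by have [] := mulmx1_unit GG.
- apply: ev_inj => phi; rewrite ev_liftl ev_liftr ev_antipode_sqr.
  have tE psi : ev psi (t beta) = M *m ev psi (conj_corep (t alpha)) *m M'.
    by rewrite ME -mulmxA MM' mulmx1.
  rewrite !tE !mulmxA -!(mulmxA _ M' M) !M'M !mulmx1; congr (_ *m _).
  rewrite -!mulmxA; congr (_ *m _); apply: (can_inj (mulKmx uFT)).
  by rewrite !mulmxA mulmxV// mul1mx -FE mulmxK.
- rewrite (invmx_eq GG) -!mulmxA [LHS]mxtrace_mulC [RHS]mxtrace_mulC.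
  by rewrite -!mulmxA M'M !mulmx1 -trmx_inv !mxtrace_tr.
- by rewrite -!mulmxA mxtrace_mulC -!mulmxA M'M mulmx1 -trmx_inv mxtrace_tr -trF.
Qed.

End FMatrices.

(** * Intertwiners and functional calculus *)

Section DiagonalIntertwiner.
Variable C : numClosedFieldType.

(** In eigenbases the relation reads e_i Y_ij d_j = Y_ij, so [Y] lives on the pairs with e_i d_j =
    1. Functions of the two spectra that agree on these pairs are therefore intertwined as well,
    whatever diagonalisations were chosen. *)
Lemma diag_intertwiner m n (U : 'M[C]_m) (V : 'M[C]_n) (M : 'M[C]_(n, m))
    (d dz : 'rV[C]_m) (e ez : 'rV[C]_n) :
  U \is unitarymx -> V \is unitarymx ->
  (forall i j, e 0 i * d 0 j = 1 -> ez 0 i = dz 0 j) ->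
  (V^t* *m diag_mx e *m V) *m M *m (U^t* *m diag_mx d *m U)^T = M ->
  V^t* *m diag_mx ez *m V *m M = M *m (U^t* *m diag_mx dz *m U)^T.
Proof.
move=> /unitarymxP UU /unitarymxP VV ed ME0; have VV' := mulmx1C VV.
have [Y YD] : exists Y, Y = V *m M *m U^T by exists (V *m M *m U^T).
have UTT : U^T *m (U^t*)^T = 1%:M by rewrite -trmx_mul (mulmx1C UU) trmx1.
have UTT' : (U^t*)^T *m U^T = 1%:M by rewrite -trmx_mul UU trmx1.
have ME : M = V^t* *m Y *m (U^t*)^T.
  by rewrite YD !mulmxA VV' mul1mx -mulmxA UTT mulmx1.
have YE : diag_mx e *m Y *m diag_mx d = Y.
  rewrite YD -[in RHS]ME0 !trmx_mul tr_diag_mx !mulmxA VV mul1mx.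
  by rewrite -!mulmxA UTT' mulmx1 !mulmxA.
have YzE : diag_mx ez *m Y = Y *m diag_mx dz.
  rewrite mul_diag_mx mul_mx_diag; apply/matrixP => i j.
  have /matrixP/(_ i j) := YE; rewrite mul_mx_diag mul_diag_mx !mxE => Yij.
  have [->|Y0] := eqVneq (Y i j) 0; first by rewrite mulr0 mul0r.
  rewrite mulrC (ed i j)//; apply: (mulIf Y0).
  by rewrite mul1r mulrAC.
rewrite [in LHS]ME -!mulmxA (mulmxA V) VV mul1mx (mulmxA (diag_mx ez)) YzE.
by rewrite !trmx_mul tr_diag_mx YD !mulmxA VV' mul1mx.
Qed.

Lemma hermitian_inv n (G G' : 'M[C]_n) : G *m G' = 1%:M -> G^t* = G -> G'^t* = G'.
Proof.
move=> GG' Gherm; have G'G := mulmx1C GG'.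
have : G'^t* *m G = 1%:M by rewrite -[in LHS]Gherm -map_mxM -trmx_mul GG' trmx1 map_mx1.
by move=> /(congr1 (mulmx^~ G')); rewrite -mulmxA GG' mulmx1 mul1mx.
Qed.

End DiagonalIntertwiner.

(** * The second involution on a conjugate corepresentation *)

Section SecondStar.
Variables (C : numClosedFieldType) (A : cqgAlgebra C).

Lemma lact_functional (phi psi : {scalar A}) a :
  psi (lact phi a) = convol psi phi a.
Proof.
rewrite /lact /tlift linear_sum; apply: eq_bigr => p _.
by rewrite linearZ /= mulrC.
Qed.

Variables (f : C -> {scalar A}) (t : cqg_dual A -> iurep A).
Hypothesis t_class : forall alpha, class_of (t alpha) = alpha.

(** The value of [psi] at a^- is the value at a^* of the convolution product of f_{-1/2}, [psi] and
    f_{1/2}, in this order. *)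
Lemma ev_second_star (psi : {scalar A}) n (s : 'M[A]_n) : is_corep s ->
  ev psi (map_mx (second_star f) s) =
  ev (f (- 2^-1)) (conj_corep s) *m ev psi (conj_corep s) *m ev (f 2^-1) (conj_corep s).
Proof.
move=> cs; have cu := conj_is_corep cs.
transitivity (ev (convol (convol (f (- 2^-1)) psi) (f 2^-1)) (conj_corep s)).
  apply/matrixP => i j; rewrite !mxE /second_star ract_functional.
  by rewrite lact_functional.
by rewrite !corep_convol.
Qed.

Variables (alpha beta : cqg_dual A).
Variables (M : 'M[C]_((deg (t beta)).+1, (deg (t alpha)).+1))
  (M' : 'M[C]_((deg (t alpha)).+1, (deg (t beta)).+1)).
Hypothesis MM' : M *m M' = 1%:M.
Hypothesis M'M : M' *m M = 1%:M.
Hypothesis ME : forall phi : {scalar A},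
  M *m ev phi (conj_corep (t alpha)) = ev phi (t beta) *m M.
Variables (G G' : 'M[C]_((deg (t alpha)).+1)) (lam : C).
Hypothesis GG' : G *m G' = 1%:M.
Hypothesis Gherm : G^t* = G.
Hypothesis GG : G *m G = lam *: (M^t* *m M).
Hypothesis fG : ev (f (- 2^-1)) (conj_corep (t alpha)) = G.
Hypothesis fG' : ev (f 2^-1) (conj_corep (t alpha)) = G'.

Lemma ev_second_star_t psi :
  ev psi (map_mx (second_star f) (t alpha)) = G *m ev psi (conj_corep (t alpha)) *m G'.
Proof. by rewrite ev_second_star ?fG ?fG'//; exact: t_corep. Qed.

(** The conjugate is unitary for the inner product with Gram matrix M^* M, and [G] is a Hermitian
    square root of it up to the scalar [lam]; conjugating by [G] makes the inner product
    standard. *)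
Lemma second_star_unitary : is_unitary (map_mx (second_star f) (t alpha)).
Proof.
have G'G := mulmx1C GG'.
have G'herm := hermitian_inv GG' Gherm.
have KE phi : (ev phi (conj_corep (t alpha)))^t* *m (M^t* *m M) =
    M^t* *m M *m ev (adjoint_functional phi) (conj_corep (t alpha)).
  rewrite mulmxA -map_mxM -trmx_mul ME trmx_mul map_mxM.
  have /is_unitaryP <- := @t_unitary _ _ t beta.
  by rewrite -!mulmxA ME.
apply/is_unitaryP => phi; rewrite !ev_second_star_t !trmx_mul !map_mxM Gherm G'herm.
have := congr1 ( *:%R lam) (KE phi); rewrite scalemxAr scalemxAl -GG => E.
rewrite -[LHS]mul1mx -G'G !mulmxA -(mulmxA G' G G) -(mulmxA G') -E.
by rewrite -!mulmxA GG' mulmx1.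
Qed.

Lemma second_star_irr_unitary : irr_unitary_corep (map_mx (second_star f) (t alpha)).
Proof.
have G'G := mulmx1C GG'; split; last 2 first.
- exact: second_star_unitary.
- apply: mxirr_is_irreducible.
  apply: (mxirr_conjg GG' ev_second_star_t).
  exact/conj_corep_mxirr/t_mxirr.
apply: is_corepP => [phi psi|]; rewrite !ev_second_star_t.
  rewrite corep_convol; last exact/conj_is_corep/t_corep.
  by rewrite !mulmxA -(mulmxA _ G' G) G'G mulmx1.
by rewrite corep_counit ?mulmx1//; exact/conj_is_corep/t_corep.
Qed.

Lemma second_star_class (h : irr_unitary_corep (map_mx (second_star f) (t alpha))) :
  class_of (IURep h) = beta.
Proof.
have G'G := mulmx1C GG'; rewrite -[RHS]t_class; apply/eqmodP/asboolP/corep_equivP.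
exists (M *m G'), (G *m M'); split.
- by rewrite -mulmxA (mulmxA G') G'G mul1mx.
- by rewrite -mulmxA (mulmxA M') M'M mul1mx.
- move=> phi; rewrite /= ev_second_star_t !mulmxA -(mulmxA M G' G) G'G mulmx1.
  by rewrite ME.
Qed.

End SecondStar.

(** * Complex powers of positive definite matrices *)

Section ComplexPowers.
Local Open Scope complex_scope.
Variable R : realType.
Local Notation C := (complexField R).

Lemma complex_gt0E (x : C) : 0 < x -> x = (complex.Re x)%:C /\ 0 < complex.Re x.
Proof.
rewrite (@ltcE R) /= => /andP[/eqP x0 xgt0]; split=> //.
by apply/eqP; rewrite eq_complex /= eqxx /= x0.
Qed.

Lemma cpowr_inv (x : R) (z : C) : 0 < x -> cpowr x^-1 z = cpowr x (- z).
Proof.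
case: z => a b x0; have x'0 : 0 < x^-1 by rewrite invr_gt0.
rewrite /cpowr /= /powR !gt_eqF// lnV ?posrE//.
by rewrite !mulrN !mulNr.
Qed.

Lemma cpowr_half (x : R) : 0 < x -> cpowr x 2^-1 = (Num.sqrt x)%:C.
Proof.
move=> x0; have -> : 2^-1 = (2^-1)%:C :> C by rewrite fmorphV rmorph_nat.
by rewrite /cpowr /= mul0r cos0 sin0 mulr1 mulr0 powR12_sqrt// ltW.
Qed.

Lemma cpowr_Nhalf (x : R) : 0 < x -> cpowr x (- 2^-1) = (Num.sqrt x)%:C^-1.
Proof.
move=> x0; rewrite -cpowr_inv// cpowr_half ?invr_gt0// sqrtrV ?ltW//.
by rewrite fmorphV.
Qed.

(** Positive definiteness as a Gram factorisation. [N] is rectangular because it will be the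
    conjugate of an intertwiner between corepresentations of a priori different degrees; the left
    inverse [N'] gives definiteness. *)
Definition positive_mx n (F : 'M[C]_n) : Prop :=
  exists m (N : 'M[C]_(m, n)) (N' : 'M[C]_(n, m)) lam,
    [/\ 0 < lam, N' *m N = 1%:M & F = lam *: (N^t* *m N)].

(** In the eigenbasis each eigenvalue is [lam] times the squared norm of a column of [N *m U^t*],
    and no column vanishes because this matrix has a left inverse. *)
Lemma positive_mx_spectral n (F : 'M[C]_n) : positive_mx F ->
  F = (spectralmx F)^t* *m diag_mx (spectral_diag F) *m spectralmx F /\
  forall j, 0 < spectral_diag F 0 j.
Proof.
move=> [m [N [N' [lam [lam0 N'N FE]]]]].
have Fherm : F^t* = F.
  rewrite FE linearZ /= map_mxZ /= trmx_mul map_mxM /= trmxCK; congr (_ *: _).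
  by apply/CrealP; rewrite realE ltW.
have /orthomx_spectralP E : F \is normalmx by apply/normalmxP; rewrite Fherm.
rewrite invmx_unitary ?spectral_unitarymx// in E.
split=> // j; set U := spectralmx F in E *; set d := spectral_diag F in E *.
have UU : U *m U^t* = 1%:M by apply/unitarymxP; exact: spectral_unitarymx.
have dE : diag_mx d = lam *: ((N *m U^t*)^t* *m (N *m U^t*)).
  rewrite trmx_mul map_mxM trmxCK -!mulmxA (mulmxA (N^t*)) scalemxAr scalemxAl -FE E.
  by rewrite !mulmxA UU mul1mx -mulmxA UU mulmx1.
have -> : d 0 j = lam * \sum_k (N *m U^t*) k j * ((N *m U^t*) k j)^*.
  have /matrixP/(_ j j) := dE; rewrite [LHS]mxE eqxx mulr1n => ->.
  rewrite !mxE; congr (_ * _); apply: eq_bigr => k _.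
  by rewrite !mxE mulrC.
have [k Nk] : exists k, (N *m U^t*) k j != 0.
  apply: contrapT => /forallNP N0.
  have : U *m N' *m (N *m U^t*) = 1%:M.
    by rewrite -mulmxA (mulmxA N') N'N mul1mx.
  move=> /matrixP/(_ j j); rewrite [RHS]mxE eqxx mxE big1 => [/eqP|k _].
    by rewrite eq_sym oner_eq0.
  have /negP := N0 k; rewrite negbK => /eqP ->.
  by rewrite mulr0.
rewrite mulr_gt0// (bigD1 k)//= ltr_pwDl ?mul_conjC_gt0//.
by apply: sumr_ge0 => l _; exact: mul_conjC_ge0.
Qed.

Lemma mxpow_positive n (F : 'M[C]_n) z : mxpow F z = (spectralmx F)^t* *m
  diag_mx (map_mx (fun l : C => cpowr (complex.Re l) z) (spectral_diag F)) *m spectralmx F.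
Proof. by rewrite /mxpow invmx_unitary ?spectral_unitarymx. Qed.

(** Wherever the intertwiner is nonzero in eigenbases, an eigenvalue of [G] meets its inverse as
    eigenvalue of [F]; raising an inverse to the power [z] changes the sign of the exponent. *)
Lemma mxpow_intertwiner m n (F : 'M[C]_m) (G : 'M[C]_n) (M : 'M[C]_(n, m)) :
  positive_mx F -> positive_mx G -> G *m M *m F^T = M ->
  forall z, mxpow G z *m M = M *m (mxpow F (- z))^T.
Proof.
move=> pF pG GMF z; have [FE dF] := positive_mx_spectral pF.
have [GE dG] := positive_mx_spectral pG.
rewrite !mxpow_positive; apply: (@diag_intertwiner _ _ _ _ _ _ (spectral_diag F) _ (spectral_diag G)); try exact: spectral_unitarymx.
- move=> i j ed1; rewrite !mxE.
  have [ei ei0] := complex_gt0E (dG i); have [dj dj0] := complex_gt0E (dF j).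
  have dE : complex.Re (spectral_diag F 0 j) = (complex.Re (spectral_diag G 0 i))^-1.
    apply: (mulfI (lt0r_neq0 ei0)); rewrite divff ?lt0r_neq0//.
    have := congr1 (@complex.Re R) ed1; rewrite ei dj /= mulr0 subr0.
    exact.
  by rewrite dE cpowr_inv// opprK.
- by rewrite -GE -FE.
Qed.

Lemma mxpow_half_sqr n (F : 'M[C]_n) : positive_mx F ->
  mxpow F 2^-1 *m mxpow F 2^-1 = F.
Proof.
move=> pF; have [FE dF] := positive_mx_spectral pF.
rewrite [RHS]FE !mxpow_positive; set U := spectralmx F.
have UU : U *m U^t* = 1%:M by apply/unitarymxP; exact: spectral_unitarymx.
rewrite -!mulmxA (mulmxA U) UU mul1mx; congr (_ *m _); rewrite !mulmxA; congr (_ *m _).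
rewrite mulmx_diag; congr diag_mx; apply/rowP => j; rewrite !mxE.
have [dj dj0] := complex_gt0E (dF j).
by rewrite !cpowr_half// -rmorphM -expr2 sqr_sqrtr ?ltW// -dj.
Qed.

Lemma mxpow_halfV n (F : 'M[C]_n) : positive_mx F ->
  mxpow F 2^-1 *m mxpow F (- 2^-1) = 1%:M.
Proof.
move=> pF; have [FE dF] := positive_mx_spectral pF.
rewrite !mxpow_positive; set U := spectralmx F.
have UU : U *m U^t* = 1%:M by apply/unitarymxP; exact: spectral_unitarymx.
rewrite -!mulmxA (mulmxA U) UU mul1mx -[RHS](mulmx1C UU); congr (_ *m _).
rewrite !mulmxA -[RHS]mul1mx; congr (_ *m _).
rewrite mulmx_diag -diag_const_mx; congr diag_mx; apply/rowP => j; rewrite !mxE.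
have [dj dj0] := complex_gt0E (dF j).
rewrite cpowr_half// cpowr_Nhalf// mulfV//.
by rewrite fmorph_eq0 sqrtr_eq0 -ltNge.
Qed.

Lemma mxpow_half_herm n (F : 'M[C]_n) : positive_mx F ->
  (mxpow F 2^-1)^t* = mxpow F 2^-1.
Proof.
move=> pF; have [FE dF] := positive_mx_spectral pF.
rewrite !mxpow_positive !trmx_mul !map_mxM trmxCK mulmxA tr_diag_mx map_diag_mx.
congr (_ *m diag_mx _ *m _); apply/rowP => j; rewrite !mxE.
have [dj dj0] := complex_gt0E (dF j).
rewrite cpowr_half//; apply/CrealP; rewrite realE.
by rewrite (@ler0c R) sqrtr_ge0.
Qed.

End ComplexPowers.

(** * The functionals f_z on conjugate corepresentations *)

Section SecondStarPowers.
Variables (R : realType).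
Local Notation C := (complexField R).
Variables (A : cqgAlgebra C) (t : cqg_dual A -> iurep A).
Hypothesis t_class : forall alpha, class_of (t alpha) = alpha.
Variables (F : forall alpha, 'M[C]_((deg (t alpha)).+1)).
Hypothesis F_matrix : forall alpha, is_F_matrix (t alpha) (F alpha).
Variable f : C -> {scalar A}.
Hypothesis f_val : forall z alpha i j, f z (t alpha i j) = mxpow (F alpha) z i j.

Lemma F_positive_mx alpha : positive_mx (F alpha).
Proof.
have [beta [M [M' [MM' M'M ME]]]] := conj_class t_class alpha.
have [lam lam0 FE] := F_matrix_positive MM' ME (F_matrix alpha).
(* The transpose of M^* M is the Gram matrix of the entrywise conjugate of [M]. *)
exists _, (map_mx Num.conj M), (map_mx Num.conj M'), lam; split=> //.
  by rewrite -map_mxM M'M map_mx1.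
rewrite -[LHS]trmxK FE linearZ /= trmx_mul; congr (_ *: (_ *m _));
  by apply/matrixP => i j; rewrite !mxE ?conjCK.
Qed.

Variables (alpha beta : cqg_dual A).
Variables (M : 'M[C]_((deg (t beta)).+1, (deg (t alpha)).+1))
  (M' : 'M[C]_((deg (t alpha)).+1, (deg (t beta)).+1)).
Hypothesis MM' : M *m M' = 1%:M.
Hypothesis M'M : M' *m M = 1%:M.
Hypothesis ME : forall phi : {scalar A},
  M *m ev phi (conj_corep (t alpha)) = ev phi (t beta) *m M.
(** Uniqueness identifies [F beta] with the inverse transpose of [F alpha] carried along [M], that
    is [F beta *m M *m (F alpha)^T = M]. Taking powers and cancelling [M] yields the value on the
    conjugate. *)
Lemma ev_f_conj z : ev (f z) (conj_corep (t alpha)) = (mxpow (F alpha) (- z))^T.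
Proof.
have uF : (F alpha)^T \in unitmx by rewrite unitmx_tr; case: (F_matrix alpha).
have FE := F_matrix_unique (F_matrix beta) (conj_F_matrix MM' M'M ME (F_matrix alpha)).
have E : F beta *m M *m (F alpha)^T = M.
  by rewrite FE -!mulmxA (mulmxA M') M'M mul1mx mulVmx// mulmx1.
have := mxpow_intertwiner (F_positive_mx alpha) (F_positive_mx beta) E z.
have -> : mxpow (F beta) z = ev (f z) (t beta).
  by apply/matrixP => i j; rewrite evE f_val.
rewrite -ME => /(congr1 (mulmx M')).
by rewrite !mulmxA M'M !mul1mx.
Qed.

Lemma second_star_corep :
  exists h : irr_unitary_corep (map_mx (second_star f) (t alpha)),
    class_of (IURep h) = beta.
Proof.
have [lam lam0 FE] := F_matrix_positive MM' ME (F_matrix alpha).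
have pF := F_positive_mx alpha.
have GG' : (mxpow (F alpha) 2^-1)^T *m (mxpow (F alpha) (- 2^-1))^T = 1%:M.
  by apply: mulmx1C; rewrite -trmx_mul mxpow_halfV// trmx1.
have Gherm : (mxpow (F alpha) 2^-1)^T^t* = (mxpow (F alpha) 2^-1)^T.
  rewrite -[in RHS](mxpow_half_herm pF).
  by apply/matrixP => i j; rewrite !mxE.
have GG : (mxpow (F alpha) 2^-1)^T *m (mxpow (F alpha) 2^-1)^T = lam *: (M^t* *m M).
  by rewrite -trmx_mul mxpow_half_sqr.
have fG : ev (f (- 2^-1)) (conj_corep (t alpha)) = (mxpow (F alpha) 2^-1)^T.
  by rewrite ev_f_conj opprK.
have fG' := ev_f_conj 2^-1.
exists (second_star_irr_unitary ME GG' Gherm GG fG fG').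
exact: (second_star_class t_class MM' M'M ME GG' fG fG').
Qed.

End SecondStarPowers.

(** * Spherical functions *)

Section Biinvariance.
Variables (C : numClosedFieldType).

Lemma balanced_tmap (U V U' V' : lmodType C) (f : {linear U -> U'}) (g : {linear V -> V'}) :
  balanced (fun u v => f u ⊗ g v).
Proof.
split=> [a b c|a b c|k a b].
- by rewrite linearD pureDl.
- by rewrite linearD pureDr.
- by rewrite !linearZ pureZr.
Qed.

Lemma balanced_star_tensor (A B : hopfStarAlgebra C) :
  balanced (fun (u : A) (v : B) => star u ⊗ star v).
Proof.
split=> [u u' v|u v v'|k u v]; rewrite ?starD ?pureDl ?pureDr//.
by rewrite !starZ pureZr.
Qed.

Lemma tmap_star (A A' B B' : hopfStarAlgebra C) (f : {linear A -> A'})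
    (g : {linear B -> B'}) (x : A ⊗ B) :
  (forall a, f (star a) = star (f a)) -> (forall b, g (star b) = star (g b)) ->
  tmap f g (tmap (@star _ A) (@star _ B) x) = tmap (@star _ A') (@star _ B') (tmap f g x).
Proof.
move=> fs gs; rewrite (tensor_sum x) /tmap.
have b1 := balanced_tmap f g.
have b2 := balanced_star_tensor A B; have b3 := balanced_star_tensor A' B'.
rewrite !tlift_sum_pure//.
by apply: eq_bigr => p _; rewrite fs gs.
Qed.

Lemma biinvariant_star (A : cqgAlgebra C) (B : subCQG A) (a : A) :
  biinvariant B a -> biinvariant B (star a).
Proof.
move=> [la ra]; have b3 := balanced_star_tensor; split; rewrite comul_star.
- rewrite (@tmap_star A (sub_cqg B) A A (Defs.sub_map B) (idfun : {linear A -> A}))//.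
    by rewrite la /tmap (tlift_pure _ _ (b3 _ _)) star1.
  exact: hopf_map_star.
- rewrite (@tmap_star A A A (sub_cqg B) (idfun : {linear A -> A}) (Defs.sub_map B))//.
    by rewrite ra /tmap (tlift_pure _ _ (b3 _ _)) star1.
  exact: hopf_map_star.
Qed.

End Biinvariance.

Section SphericalFunctions.
Variables (C : numClosedFieldType) (A : cqgAlgebra C) (B : subCQG A).
Hypothesis gelfand : quantum_gelfand_pair B.
Variable t : cqg_dual A -> iurep A.
Hypothesis t_class : forall alpha, class_of (t alpha) = alpha.
Local Notation K := (spherical_space B).
Hypothesis t_biinvariant : forall alpha : K, biinvariant B (t (dual_of alpha) ord0 ord0).

Definition spherical_function (alpha : K) : A := t (dual_of alpha) ord0 ord0.
Local Notation s := spherical_function.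

Lemma counit_spherical_function alpha : counit A (s alpha) = 1.
Proof. by rewrite (@t_corep _ _ t _ _ _).2. Qed.

Lemma entries_repr alpha n (u : 'M[A]_n) : corep_equiv u (t alpha) ->
  forall i j, lspan (entries (repr alpha)) (u i j).
Proof.
move=> ut; have tr : corep_equiv (t alpha) (repr alpha).
  have /eqmodP/asboolP // : class_of (t alpha) = class_of (repr alpha).
  by rewrite t_class; exact/esym/reprK.
apply: corep_equiv_entries ut (lspan_is_subspace _) _.
apply: corep_equiv_entries tr (lspan_is_subspace _) _ => i j.
by apply: sub_lspan; exists i, j.
Qed.

Lemma spherical_functionP alpha : biinvariant_part B (dual_of alpha) (s alpha).
Proof.
split; first exact: t_biinvariant.
by apply: entries_repr; exists 1%:M, 1%:M; rewrite !mulmx1 !lift_scalars1 mul1mx mulmx1.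
Qed.

Lemma biinvariant_counit_inj alpha a b : has_dim (biinvariant_part B alpha) 1 ->
  biinvariant_part B alpha a -> biinvariant_part B alpha b ->
  counit A a = 1 -> counit A b = 1 -> a = b.
Proof.
move=> [x [_ ->]] Xa Xb a1 b1.
have span1 c : lspan (range x) c -> exists k, c = k *: x ord0.
  move=> [n [k [y [yx ->]]]]; exists (\sum_i k i); rewrite scaler_suml.
  by apply: eq_bigr => i _; have [j _ <-] := yx i; rewrite (ord1 j).
have [k aE] := span1 _ Xa; have [l bE] := span1 _ Xb.
move: a1 b1; rewrite aE bE !linearZ /= => kx lx.
by congr (_ *: _); apply: (mulIf (x := counit A (x ord0))); rewrite ?kx//;
  apply: contra_eq_neq kx => ->; rewrite mulr0 eq_sym oner_eq0.
Qed.

(** The star of t_11^alpha is an entry of the conjugate, so it is a biinvariant element of the span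
    of t^beta. Its counit is 1, which excludes dimension 0: [beta] belongs to K, and the
    normalisation by the counit determines the element. *)
Lemma spherical_conj (alpha : K) (beta : cqg_dual A)
    (M : 'M[C]_((deg (t beta)).+1, (deg (t (dual_of alpha))).+1)) M' :
  M *m M' = 1%:M -> M' *m M = 1%:M ->
  (forall phi : {scalar A},
    M *m ev phi (conj_corep (t (dual_of alpha))) = ev phi (t beta) *m M) ->
  exists2 gamma : K, dual_of gamma = beta & s gamma = star (s alpha).
Proof.
move=> MM' M'M ME; have sbeta : biinvariant_part B beta (star (s alpha)).
  split; first exact/biinvariant_star/t_biinvariant.
  have : corep_equiv (conj_corep (t (dual_of alpha))) (t beta).
    by apply/corep_equivP; exists M, M'.
  by move=> /entries_repr/(_ ord0 ord0); rewrite mxE.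
have star_counit : counit A (star (s alpha)) = 1.
  by rewrite counit_star counit_spherical_function conjC1.
have dim1 : has_dim (biinvariant_part B beta) 1.
  case: (gelfand beta) => // -[x [_ xE]]; exfalso.
  move: sbeta; rewrite xE => -[n [k [y [yx aE]]]].
  move: star_counit; rewrite aE big1 => [|i _]; last by have [[]] := yx i.
  by rewrite linear0 => /eqP; rewrite eq_sym oner_eq0.
have sph : is_spherical B beta by apply/asboolP.
exists (exist _ beta sph : K) => //.
apply: (biinvariant_counit_inj dim1 _ sbeta) => //.
  exact: (spherical_functionP (exist _ beta sph : K)).
exact: counit_spherical_function.
Qed.

Lemma dual_of_inj : injective (@dual_of C A B).
Proof. exact: val_inj. Qed.

Definition spherical_functional (gamma : K) : {scalar A} :=
  dual_coef t_class (ord0 : 'I_(deg (t (dual_of gamma))).+1) ord0.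
Local Notation phi := spherical_functional.

Lemma spherical_functionalE gamma alpha : phi gamma (s alpha) = (alpha == gamma)%:R.
Proof. by rewrite /phi dual_coefE !eqxx !andbT (inj_eq dual_of_inj). Qed.

Lemma spherical_function_inj : injective s.
Proof.
move=> alpha beta /(congr1 (phi beta)); rewrite !spherical_functionalE eqxx.
by case: eqP => // _ /eqP; rewrite eq_sym oner_eq0.
Qed.

(** * The Haar functional and orthogonality of matrix coefficients *)

Lemma trivial_rep : t (trivial_class A) = lift_scalars A 1%:M :> 'M[A]_((deg (t (trivial_class A))).+1).
Proof.
have /eqmodP/asboolP := t_class (trivial_class A).
move=> /corep_equiv_conj[M [M' [M'M ->]]] /=.
by rewrite mulmx1 -lift_scalarsM M'M.
Qed.

Lemma spherical_function_trivial : s (trivial_point B) = 1.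
Proof.
have := trivial_rep => /matrixP/(_ ord0 ord0).
by rewrite /s => ->; rewrite !mxE scale1r.
Qed.

(** As the functional dual to the unit it is a matrix unit at a diagonal place, so it is
    self-adjoint by [dual_coef_adjoint]. *)
Definition haar : {scalar A} := phi (trivial_point B).

Lemma haar1 : haar 1 = 1.
Proof. by rewrite -spherical_function_trivial spherical_functionalE eqxx. Qed.

(** On coefficients of nontrivial classes both sides vanish; for the trivial class the
    representative is an identity matrix. *)
Lemma haar_invariant a : lact haar a = haar a *: 1.
Proof.
have lactP k b c : lact haar (k *: b + c) = k *: lact haar b + lact haar c.
  apply: functional_inj => psi; rewrite lact_functional [RHS]linearP /= !lact_functional.
  by rewrite linearP.
apply: (cqg_functional_ext t_class (f := lact haar) (g := fun a => haar a *: 1)).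
  split=> [|k b c /= Eb Ec] /=.
    have := lactP 1 0 0; rewrite !scale1r !addr0 -{1}[lact haar 0]addr0.
    by move=> /addrI <-; rewrite linear0 scale0r.
  by rewrite lactP Eb Ec linearP /= scalerDl scalerA.
move=> alpha i j.
have -> : lact haar (t alpha i j) = \sum_k haar (t alpha k j) *: t alpha i k.
  rewrite /lact (@t_corep _ _ t alpha i j).1 tlift_sum_pure//.
  exact: balanced_functionalr.
rewrite /haar /phi dual_coefE.
under eq_bigr => k _ do rewrite dual_coefE.
have [ae|_] := eqVneq alpha (dual_of (trivial_point B)); last first.
  by rewrite scale0r big1// => k _; rewrite scale0r.
subst alpha; rewrite (bigD1 ord0)//= big1 ?addr0 => [|k /negPf]; last first.
  by rewrite -val_eqE /= => ->; rewrite scale0r.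
have := trivial_rep => /matrixP/(_ i ord0) ->; rewrite !mxE -val_eqE /=.
by case: (_ == _ :> nat); case: (_ == _ :> nat); rewrite ?scale1r ?scale0r ?scaler0.
Qed.

(** Write the invariance of [haar] for the product of t_ik^alpha and the star of t_jl^beta, multiply
    on the right by t_jr^beta and sum over [j]: unitarity of t^beta cancels the starred factors. *)
Lemma haar_conj_intertwiner alpha beta k l :
  let E := \matrix_(i, j) haar (t alpha i k * star (t beta j l)) in
  forall psi : {scalar A}, E *m ev psi (t beta) = ev psi (t alpha) *m E.
Proof.
move=> E psi; rewrite -ev_liftl -ev_liftr; congr ev; apply/matrixP => i r.
have ct := @t_corep _ _ t; have cu := conj_is_corep (ct beta).
have inv j : \sum_m \sum_n E m n *: (t alpha i m * star (t beta j n)) = E i j *: 1.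
  have := haar_invariant (t alpha i k * conj_corep (t beta) j l).
  rewrite /lact (tlift_comul_corep_mul _ _ _ _ (balanced_functionalr _ _) (ct alpha) cu).
  rewrite /E !mxE => <-; apply: eq_bigr => m _; apply: eq_bigr => n _.
  by rewrite !mxE.
rewrite !mxE.
transitivity (\sum_j (E i j *: 1) * t beta j r).
  by apply: eq_bigr => j _; rewrite !mxE.
transitivity (\sum_m \sum_n E m n *: t alpha i m * \sum_j (star (t beta j n) * t beta j r)).
  under eq_bigr => j _ do rewrite -inv mulr_suml.
  rewrite exchange_big; apply: eq_bigr => m _ /=.
  under eq_bigr => j _ do rewrite mulr_suml.
  rewrite exchange_big; apply: eq_bigr => n _ /=.
  rewrite mulr_sumr; apply: eq_bigr => j _.
  by rewrite -!scalerAl mulrA.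
apply: eq_bigr => m _; rewrite (bigD1 r)//= [X in _ + X]big1 ?addr0 => [|n nr].
  under eq_bigr => j _ do rewrite -(@t_unitary _ _ t beta).
  by rewrite (corep_antipodel _ _ (ct beta)) eqxx mulr1 !mxE mulr_algr.
under eq_bigr => j _ do rewrite -(@t_unitary _ _ t beta).
by rewrite (corep_antipodel _ _ (ct beta)) (negPf nr) mulr0.
Qed.

Lemma haar_conj_neq alpha beta i k j l : alpha != beta ->
  haar (t alpha i k * star (t beta j l)) = 0.
Proof.
move=> ab; have [/matrixP/(_ i j)|ba] := rep_intertwiner t_class (haar_conj_intertwiner k l).
  by rewrite !mxE.
by rewrite ba eqxx in ab.
Qed.

Lemma haar_hermitian alpha beta i j k l :
  haar (t alpha i j * t beta k l) = (haar (t alpha j i * t beta l k))^*.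
Proof.
apply: hermitian_functional_mul; try exact: t_corep; try exact: t_unitary.
exact: dual_coef_adjoint.
Qed.

(* With Lam_kl = h(t_0k t_0l^* ), Schur's lemma gives h(t_ik t_jl^* ) = delta_ij Lam_kl;
   as h is hermitian, Lam is a nonzero multiple of the Gram matrix of M. *)
Lemma haar_conj_diag_neq0 alpha beta (M : 'M[C]_((deg (t beta)).+1, (deg (t alpha)).+1)) M' :
  M *m M' = 1%:M -> M' *m M = 1%:M ->
  (forall psi : {scalar A},
    M *m ev psi (conj_corep (t alpha)) = ev psi (t beta) *m M) ->
  haar (t alpha ord0 ord0 * star (t alpha ord0 ord0)) != 0.
Proof.
move=> MM' M'M ME; pose Lam := \matrix_(k, l) haar (t alpha ord0 k * star (t alpha ord0 l)).
have LamE i j k l : haar (t alpha i k * star (t alpha j l)) = (i == j)%:R * Lam k l.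
  have [a aE] := rep_scalar (haar_conj_intertwiner k l).
  have /matrixP/(_ i j) := aE; have /matrixP/(_ ord0 ord0) := aE.
  by rewrite !mxE eqxx mulr1n => -> ->; rewrite mulr_natl.
have trLam : \tr Lam = 1.
  rewrite -haar1 -[X in haar X](_ : \sum_k t alpha ord0 k * antipode A (t alpha k ord0) = 1).
    rewrite linear_sum; apply: eq_bigr => k _.
    by rewrite mxE (@t_unitary _ _ t alpha).
  by rewrite corep_antipoder ?eqxx//; exact: t_corep.
have tE : t beta = lift_scalars A M *m conj_corep (t alpha) *m lift_scalars A M' :> 'M[A]__.
  by apply: ev_inj => psi; rewrite ev_liftr ev_liftl ME -mulmxA MM' mulmx1.
pose N := Lam *m M'.
have P i k p q : haar (t alpha i k * t beta p q) = M p i * N k q.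
  have /matrixP/(_ p q) -> := tE; rewrite mxE mulr_sumr linear_sum.
  rewrite [N _ _]mxE mulr_sumr; apply: eq_bigr => l _.
  rewrite mxE mulr_suml mulr_sumr linear_sum (bigD1 i)//= big1 ?addr0 => [|j ji].
    rewrite !mxE mulr_algl mulr_algr scalerA -scalerAr linearZ /= !LamE !eqxx !mul1r.
    by rewrite [M' _ _ * _]mulrC -mulrA [M' _ _ * _]mulrC.
  by rewrite !mxE mulr_algl mulr_algr scalerA -scalerAr linearZ /= LamE eq_sym (negPf ji) mul0r mulr0.
(* Hermiticity exchanges the roles of the indices. Fixing [p0], [i0] with a nonzero entry of [M]
   then forces [N] to be [kappa] times the conjugate transpose of [M], and trace 1 of [Lam] excludes
   [kappa = 0]. *)
have PH i k p q : M p i * N k q = (M q k * N i p)^*.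
  by rewrite -!P haar_hermitian.
have [p0 [i0 M0]] : exists p i, M p i != 0.
  apply: contrapT => /forallNP M0; have /eqP := intertwiner_neq0 MM'; apply.
  apply/matrixP => p i; rewrite mxE; apply: contrapT => /eqP Mpi.
  by apply: (M0 p); exists i.
pose kappa := (N i0 p0)^* / M p0 i0.
have NE k q : N k q = kappa * (M q k)^*.
  apply: (mulfI M0); rewrite PH rmorphM /= /kappa mulrA mulrCA divff// mulr1.
  by rewrite mulrC.
have LamN : Lam = N *m M by rewrite /N -mulmxA M'M mulmx1.
have LamG k l : Lam k l = kappa * \sum_q (M q k)^* * M q l.
  by rewrite LamN mxE mulr_sumr; apply: eq_bigr => q _; rewrite NE mulrA.
have k0 : kappa != 0.
  apply/eqP => k0; move: trLam; rewrite /mxtrace big1 => [/eqP|k _].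
    by rewrite eq_sym oner_eq0.
  by rewrite LamG k0 mul0r.
rewrite LamE eqxx mul1r LamG mulf_neq0//.
have [q Mq] : exists q, M q ord0 != 0.
  apply: contrapT => /forallNP M00; have /matrixP/(_ ord0 ord0) := M'M.
  rewrite !mxE eqxx big1 => [/eqP|q _]; first by rewrite eq_sym oner_eq0.
  by have /negP := M00 q; rewrite negbK => /eqP ->; rewrite mulr0.
rewrite gt_eqF// (bigD1 q)//= ltr_pwDl//.
  by rewrite mulrC mul_conjC_gt0.
by apply: sumr_ge0 => l _; rewrite mulrC mul_conjC_ge0.
Qed.

(** * The linearization coefficients *)

Variable c : K -> K -> K -> C.
Hypothesis c_finite : forall alpha beta, finite_set [set gamma | c alpha beta gamma != 0].
Hypothesis c_linearization : forall alpha beta : K,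
  s alpha * s beta = \sum_(gamma \in [set: K]) c alpha beta gamma *: s gamma.

Definition csupp alpha beta : seq K :=
  finmap.enum_fset (fset_set [set gamma | c alpha beta gamma != 0]).

Lemma mem_csupp alpha beta gamma : (gamma \in csupp alpha beta) = (c alpha beta gamma != 0).
Proof. by rewrite /csupp in_fset_set//; apply/idP/idP => h; [exact: (set_mem h)|exact: (mem_set h)]. Qed.

Lemma csupp_uniq alpha beta : uniq (csupp alpha beta).
Proof. exact: finmap.fset_uniq. Qed.

Lemma linearization alpha beta :
  s alpha * s beta = \sum_(gamma <- csupp alpha beta) c alpha beta gamma *: s gamma.
Proof.
rewrite c_linearization; apply: fsbigTE => gamma.
by rewrite [_ \notin _](congr1 negb (mem_csupp _ _ _)) negbK => /eqP ->; rewrite scale0r.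
Qed.

Lemma big_csupp_delta alpha beta gamma (F : K -> C) :
  (gamma \notin csupp alpha beta -> F gamma = 0) ->
  \sum_(delta <- csupp alpha beta) F delta * (delta == gamma)%:R = F gamma.
Proof.
move=> F0; have [gs|gs] := boolP (gamma \in csupp alpha beta).
  rewrite (bigD1_seq gamma)//= ?csupp_uniq// eqxx mulr1 big1 ?addr0// => d dg.
  by rewrite (negPf dg) mulr0.
rewrite F0// big_seq big1// => d ds.
by case: eqP => [dg|_]; [rewrite -dg ds in gs | rewrite mulr0].
Qed.

Lemma coefficientE alpha beta gamma : c alpha beta gamma = phi gamma (s alpha * s beta).
Proof.
rewrite linearization linear_sum -[LHS](@big_csupp_delta alpha beta gamma (c alpha beta)).
  by apply: eq_bigr => d _; rewrite linearZ /= spherical_functionalE.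
by rewrite mem_csupp negbK => /eqP.
Qed.

Lemma coefficient_ge0 alpha beta gamma : 0 <= c alpha beta gamma.
Proof.
rewrite coefficientE; apply: projection_functional_mul_ge0;
  try exact: t_corep; try exact: t_unitary.
  exact: dual_coef_adjoint.
exact: dual_coef_convol.
Qed.

Lemma coefficient_sum alpha beta : \sum_(gamma <- csupp alpha beta) c alpha beta gamma = 1.
Proof.
have := congr1 (counit A) (linearization alpha beta).
rewrite rmorphM /= !counit_spherical_function mulr1 linear_sum => ->.
by apply: eq_bigr => d _; rewrite linearZ /= counit_spherical_function mulr1.
Qed.

Lemma coefficient_assoc alpha beta gamma eps :
  \sum_(delta <- csupp beta gamma) c beta gamma delta * c alpha delta eps =
  \sum_(delta <- csupp alpha beta) c alpha beta delta * c delta gamma eps.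
Proof.
transitivity (phi eps (s alpha * (s beta * s gamma))).
  rewrite linearization mulr_sumr linear_sum; apply: eq_bigr => d _.
  by rewrite -scalerAr linearZ /= (coefficientE alpha).
rewrite mulrA linearization mulr_suml linear_sum; apply: eq_bigr => d _.
by rewrite -scalerAl linearZ /= (coefficientE _ gamma).
Qed.

Lemma coefficient_unitl beta gamma : c (trivial_point B) beta gamma = (beta == gamma)%:R.
Proof. by rewrite coefficientE spherical_function_trivial mul1r spherical_functionalE. Qed.

Lemma coefficient_unitr beta gamma : c beta (trivial_point B) gamma = (beta == gamma)%:R.
Proof. by rewrite coefficientE spherical_function_trivial mulr1 spherical_functionalE. Qed.

Variable inv : K -> K.
Hypothesis inv_star : forall alpha, s (inv alpha) = star (s alpha).

Lemma inv_involutive : involutive inv.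
Proof. by move=> alpha; apply: spherical_function_inj; rewrite !inv_star starK. Qed.

(** The star reverses the product in the linearization formula and conjugates its coefficients,
    which are real because they are nonnegative. *)
Lemma coefficient_inv alpha beta gamma :
  c (inv beta) (inv alpha) (inv gamma) = c alpha beta gamma.
Proof.
rewrite coefficientE !inv_star -starM linearization star_sum linear_sum.
rewrite -[RHS](@big_csupp_delta alpha beta gamma (c alpha beta)).
  apply: eq_bigr => d _; rewrite starZ -inv_star linearZ /= spherical_functionalE.
  rewrite (inj_eq (can_inj inv_involutive)); congr (_ * _).
  by apply/CrealP; rewrite realE coefficient_ge0.
by rewrite mem_csupp negbK => /eqP.
Qed.

Lemma coefficient_unit_neq0 alpha beta :
  (c alpha (inv beta) (trivial_point B) != 0) = (alpha == beta).
Proof.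
rewrite coefficientE inv_star; have [<-|ab] := eqVneq alpha beta; last first.
  by rewrite [X in X != 0]haar_conj_neq ?eqxx// (inj_eq dual_of_inj).
have [gamma [M [M' [MM' M'M ME]]]] := conj_class t_class (dual_of alpha).
by rewrite [X in X != 0 = _](_ : _ = haar (s alpha * star (s alpha)))// (haar_conj_diag_neq0 MM' M'M ME).
Qed.

End SphericalFunctions.

(** * Hypergroups on discrete spaces *)

Section BoundedFunctions.
Variables (R : realType) (T : Type).

(** On a discrete space every function is Borel, so boundedness is enough for integrability against
    any finite measure. *)
Definition fbounded (f : T -> R) : Prop := exists M, forall x, `|f x| <= M.

Lemma fbounded_cst k : fbounded (fun=> k).
Proof. by exists `|k|. Qed.

Lemma fboundedD f g : fbounded f -> fbounded g -> fbounded (fun x => f x + g x).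
Proof.
move=> [M fM] [N gN]; exists (M + N) => x.
by rewrite (le_trans (ler_normD _ _))// lerD.
Qed.

Lemma fboundedZ k f : fbounded f -> fbounded (fun x => k * f x).
Proof. by move=> [M fM]; exists (`|k| * M) => x; rewrite normrM ler_wpM2l. Qed.

Lemma fboundedM f g : fbounded f -> fbounded g -> fbounded (fun x => f x * g x).
Proof.
move=> [M fM] [N gN]; exists (M * N) => x.
by rewrite normrM ler_pM.
Qed.

Lemma fbounded_indic (E : set T) : fbounded (\1_E : T -> R).
Proof.
by exists 1 => x; rewrite indicE; case: (_ \in _); rewrite ?normr1 ?normr0.
Qed.

Lemma fbounded_sum (I : Type) (r : seq I) (f : I -> T -> R) :
  (forall i, fbounded (f i)) -> fbounded (fun x => \sum_(i <- r) f i x).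
Proof.
move=> bf; elim: r => [|i r ih].
  by exists 0 => x; rewrite big_nil normr0.
have [M fM] := fboundedD (bf i) ih.
by exists M => x; rewrite big_cons.
Qed.

End BoundedFunctions.

(** * Integration against charges on a discrete space *)

Section ChargeIntegral.
Variables (R : realType) (K : ptopologicalType).
Hypothesis K_discrete : forall E : set K, open E.
Local Notation BK := (borel K).
Implicit Types (f g : K -> R) (nu : {charge set BK -> \bar R}).

Lemma borel_discrete_measurable (E : set BK) : measurable E.
Proof. exact: (@sub_sigma_algebra _ setT (@open K) E (K_discrete E)). Qed.
Hint Resolve borel_discrete_measurable : core.

Section FiniteMeasure.
Variable m : {finite_measure set BK -> \bar R}.
Local Notation I f := (Rintegral m [set: BK] f).

Lemma bounded_integrable f : fbounded f -> m.-integrable [set: BK] (EFin \o f).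
Proof.
move=> [M fM]; apply: measurable_bounded_integrable => //.
- by rewrite ltey_eq fin_num_measure.
- exists M; split; first by rewrite num_real.
  by move=> N MN x _ /=; rewrite (le_trans (fM x))// ltW.
Qed.

Lemma Rintegral_linear k f g : fbounded f -> fbounded g ->
  I (fun x => k * f x + g x) = k * I f + I g.
Proof.
move=> bf bg; rewrite RintegralD//.
- by rewrite RintegralZl//; exact: bounded_integrable.
- exact/bounded_integrable/fboundedZ.
- exact: bounded_integrable.
Qed.

Lemma Rintegral_indic (E : set BK) : I \1_E = fine (m E).
Proof. by rewrite /Rintegral integral_indic// setIT. Qed.

Lemma Rintegral_dct (f_ : nat -> K -> R) f M :
  (forall n x, `|f_ n x| <= M) -> (forall x, f_ n x @[n --> \oo] --> f x) ->
  I (f_ n) @[n --> \oo] --> I f.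
Proof.
move=> fM cf; have bf : fbounded f.
  exists M => x; apply: (cvgr_to_le (cvg_norm (cf x))).
  exact: nearW.
have [] := @dominated_convergence _ BK R m setT measurableT
  (fun n x => (f_ n x)%:E) (fun x => (f x)%:E) (cst M%:E).
- by move=> n _ Y mY; exact: borel_discrete_measurable.
- by move=> _ Y mY; exact: borel_discrete_measurable.
- by apply: aeW => x _; apply: cvg_EFin; [exact: nearW | exact: cf].
- exact: (bounded_integrable (fbounded_cst _ M)).
- by apply: aeW => x n _; rewrite lee_fin.
move=> _ _ h; rewrite /Rintegral; apply: fine_cvg.
rewrite fineK//; apply: integrable_fin_num => //.
exact: (bounded_integrable bf).
Qed.

End FiniteMeasure.

(** Extracts the two Jordan parts from the chosen Hahn decomposition hidden in [charge_integral].
    They depend on [nu], so this gives linearity in the function but not in the charge. *)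
Lemma charge_integralP nu : exists (p n : {finite_measure set BK -> \bar R}) (P N : set BK),
  [/\ forall E, p E = nu (E `&` P), forall E, n E = (- nu (E `&` N))%E,
      forall E, nu E = (p E - n E)%E &
      forall f, charge_integral nu f =
        Rintegral p [set: BK] f - Rintegral n [set: BK] f].
Proof.
rewrite /charge_integral; case: cid => P hP; case: cid => N hN.
exists (jordan_pos hN), (jordan_neg hN), P, N; split => // E.
- by rewrite -[LHS]/(jordan_pos hN E) jordan_posE cjordan_posE /crestr0 mem_set.
- by rewrite -[LHS]/(jordan_neg hN E) jordan_negE cjordan_negE /crestr0 mem_set.
- by rewrite (jordan_decomp hN)// /cadd /= cscaleN1.
Qed.

Lemma charge_integral_linear nu k f g : fbounded f -> fbounded g ->
  charge_integral nu (fun x => k * f x + g x) =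
  k * charge_integral nu f + charge_integral nu g.
Proof.
move=> bf bg; have [p [n [P [N [_ _ _ IE]]]]] := charge_integralP nu.
by rewrite !IE !Rintegral_linear// mulrBr opprD addrACA.
Qed.

Lemma charge_integral0 nu : charge_integral nu (fun=> 0) = 0.
Proof.
have b0 := @fbounded_cst R K 0.
have := charge_integral_linear nu 1 b0 b0.
under eq_fun do rewrite mulr0 addr0.
by rewrite mul1r -{1}[charge_integral nu _]addr0 => /addrI.
Qed.

Lemma charge_integralD nu f g : fbounded f -> fbounded g ->
  charge_integral nu (fun x => f x + g x) = charge_integral nu f + charge_integral nu g.
Proof.
move=> bf bg; rewrite -[X in X + _]mul1r -charge_integral_linear//.
by congr charge_integral; apply/funext => x; rewrite mul1r.
Qed.

Lemma charge_integralZ nu k f : fbounded f ->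
  charge_integral nu (fun x => k * f x) = k * charge_integral nu f.
Proof.
move=> bf; rewrite -[RHS]addr0 -[X in _ + X](charge_integral0 nu).
rewrite -charge_integral_linear//; last exact: fbounded_cst.
by congr charge_integral; apply/funext => x; rewrite addr0.
Qed.

Lemma charge_integral_sum nu (J : Type) (r : seq J) (f : J -> K -> R) :
  (forall i, fbounded (f i)) ->
  charge_integral nu (fun x => \sum_(i <- r) f i x) =
  \sum_(i <- r) charge_integral nu (f i).
Proof.
move=> bf; elim: r => [|i r ih].
  by rewrite big_nil; under eq_fun do rewrite big_nil; exact: charge_integral0.
rewrite big_cons -ih -charge_integralD//; last exact: fbounded_sum.
by congr charge_integral; apply/funext => x; rewrite big_cons.
Qed.

Lemma charge_integral_indic nu (E : set BK) : charge_integral nu \1_E = fine (nu E).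
Proof.
have [p [n [P [N [_ _ nuE IE]]]]] := charge_integralP nu.
by rewrite IE !Rintegral_indic nuE fineB ?fin_num_measure.
Qed.

Lemma charge_integral_dct nu (f_ : nat -> K -> R) f M :
  (forall n x, `|f_ n x| <= M) -> (forall x, f_ n x @[n --> \oo] --> f x) ->
  charge_integral nu (f_ n) @[n --> \oo] --> charge_integral nu f.
Proof.
move=> fM cf; have [p [m [P [N [_ _ _ IE]]]]] := charge_integralP nu.
rewrite IE; under eq_fun do rewrite IE.
by apply: cvgB; apply: Rintegral_dct fM cf.
Qed.

(** The bound involves only [M] and the total masses of the Jordan parts, so it is uniform in the
    parameter; this is what allows an inner integral to be integrated again. *)
Lemma charge_integral_bounded nu (T : Type) (f : T -> K -> R) M :
  (forall y x, `|f y x| <= M) -> fbounded (fun y => charge_integral nu (f y)).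
Proof.
move=> fM; have [p [n [P [N [_ _ _ IE]]]]] := charge_integralP nu.
have key (m : {finite_measure set BK -> \bar R}) y :
    `|Rintegral m [set: BK] (f y)| <= M * fine (m setT).
  have bf : fbounded (f y) by exists M.
  have bnf : fbounded (fun x => `|f y x|) by exists M => x; rewrite normr_id.
  rewrite (le_trans (le_normr_Rintegral _ _))//; first exact: bounded_integrable.
  rewrite -Rintegral_cst//; apply: le_Rintegral => //; first exact: bounded_integrable.
  by apply: bounded_integrable; exact: fbounded_cst.
exists (M * fine (p setT) + M * fine (n setT)) => y.
by rewrite IE (le_trans (ler_normB _ _))// lerD.
Qed.

(** All sets disjoint from [S] are tested, and not only the complement, on which positive and
    negative parts could cancel. *)
Definition concentrated nu (S : set BK) : Prop :=
  forall E : set BK, E `&` S = set0 -> nu E = 0%E.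

Lemma concentrated_sub nu (S S' : set BK) : S `<=` S' -> concentrated nu S ->
  concentrated nu S'.
Proof.
by move=> SS' cS E ES'; apply: cS; apply: subsetI_eq0 ES'.
Qed.

Lemma charge_integral_null nu (S : set BK) f : concentrated nu S -> fbounded f ->
  (forall x, S x -> f x = 0) -> charge_integral nu f = 0.
Proof.
move=> cS bf f0; have [p [n [P [N [pE nE _ IE]]]]] := charge_integralP nu.
have key (m : {finite_measure set BK -> \bar R}) : m (~` S) = 0%E ->
    Rintegral m [set: BK] f = 0.
  move=> mS; rewrite /Rintegral -(setUv S) integral_setU_EFin//; last first.
    by apply/disj_setPS; rewrite setICr.
  rewrite integral0_eq => [|x Sx]; last by rewrite f0.
  rewrite add0e null_set_integral//.
rewrite IE !key ?subrr//; rewrite ?pE ?nE cS ?oppe0//.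
  by rewrite setIAC setICl set0I.
by rewrite setIAC setICl set0I.
Qed.

End ChargeIntegral.

(** * Charges concentrated on countable sets *)

Section DiscreteCharges.
Variables (R : realType) (K : ptopologicalType).
Hypothesis K_discrete : forall E : set K, open E.
Local Notation BK := (borel K).
Implicit Types (f g : K -> R) (nu : {charge set BK -> \bar R}).

Lemma discrete_compact (E : set K) : compact E <-> finite_set E.
Proof.
split; last exact: finite_compact.
rewrite compact_cover => /(_ K E (fun x => [set x])) [|x Ex|D' _ ED'].
- by move=> *; exact: K_discrete.
- by exists x.
- apply: (sub_finite_set ED'); exact: bigcup_finite.
Qed.

Lemma charge_integral_seq nu (S : set BK) (L : seq K) f : concentrated nu S ->
  uniq L -> (forall x, S x -> x \in L) -> fbounded f ->
  charge_integral nu f = \sum_(x <- L) f x * fine (nu [set x]).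
Proof.
move=> cS uL SL bf; pose g x := \sum_(y <- L) f y * \1_[set y] x.
have bg : fbounded g.
  by apply: fbounded_sum => y; apply/fboundedZ/fbounded_indic.
have -> : charge_integral nu f = charge_integral nu g.
  apply/eqP; rewrite -subr_eq0 -mulN1r addrC -charge_integral_linear//.
  apply/eqP; apply: (charge_integral_null K_discrete cS) => [|x Sx].
    by apply: fboundedD => //; exact: fboundedZ.
  rewrite /g (bigD1_seq x)//=; last exact: SL.
  rewrite indicE mem_set// mulr1 big1 ?addr0 => [|y yx].
    by rewrite mulN1r addNr.
  by rewrite indicE memNset ?mulr0// => /= xy; rewrite xy eqxx in yx.
rewrite charge_integral_sum//; last by move=> y; apply/fboundedZ/fbounded_indic.
apply: eq_bigr => y _; rewrite charge_integralZ//; last exact: fbounded_indic.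
by rewrite charge_integral_indic.
Qed.

Definition countably_concentrated nu : Prop :=
  exists2 S : set BK, countable S & concentrated nu S.

Lemma countable_exhaustion (S : set K) : countable S ->
  exists D : nat -> set K, [/\ forall n, finite_set (D n), forall n, D n `<=` S &
    forall x, S x -> \forall n \near \oo, D n x].
Proof.
move=> /countable_injP[h hinj]; exists (fun n => S `&` h @^-1` `I_n); split.
(* The default value [n] lies outside [I_n], so the preimage contains only points of [S], where [h]
   is injective. *)
- move=> n; have : finite_set ((fun x : K => if x \in S then h x else n) @^-1` `I_n).
    apply: finite_preimage => // x y; rewrite !inE /=.
    have [xS|_] := boolP (x \in S); last by rewrite ltnn.
    have [yS|_] := boolP (y \in S); last by rewrite ltnn.
    by move=> _ _; exact: hinj.
  by apply: sub_finite_set => x [Sx hx] /=; rewrite mem_set.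
- by move=> n x [].
- by move=> x Sx; exists (h x).+1 => // n /= hn.
Qed.

Lemma indic_exhaustion (S : set K) (D : nat -> set K) x :
  (forall n, D n `<=` S) -> (forall x, S x -> \forall n \near \oo, D n x) ->
  (\1_(D n) x : R) @[n --> \oo] --> (\1_S x : R).
Proof.
move=> DS SD; apply: cvg_near_cst; have [Sx|Sx] := pselect (S x).
  near=> n; rewrite !indicE !mem_set//; near: n; exact: SD.
by apply: nearW => n; rewrite !indicE !memNset// => /DS.
Unshelve. all: by end_near. Qed.

(** Linearity in the charge, although each charge has its own Hahn decomposition. All charges share
    a countable carrier, exhausted by finite sets [D n]; the integrals of [f] cut off to [D n] are
    finite sums over point masses, where the relation is the hypothesis on singletons, and dominated
    convergence passes to the limit. *)
Lemma charge_integral_comb nu (J : Type) (r : seq J) (a : J -> R)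
    (nu_ : J -> {charge set BK -> \bar R}) f :
  countably_concentrated nu ->
  (forall j, List.In j r -> countably_concentrated (nu_ j)) ->
  (forall E : set BK, fine (nu E) = \sum_(j <- r) a j * fine (nu_ j E)) ->
  fbounded f ->
  charge_integral nu f = \sum_(j <- r) a j * charge_integral (nu_ j) f.
Proof.
move=> [S0 cS0 nuS0] cnu nuE bf.
have [S cS [nuS nu_S]] : exists2 S : set BK, countable S &
    concentrated nu S /\ forall j, List.In j r -> concentrated (nu_ j) S.
  elim: r cnu {nuE} => [|j r ih] cnu; first by exists S0.
  have [S cS [nuS nu_S]] := ih (fun i ir => cnu i (or_intror ir)).
  have [T cT nuT] := cnu j (or_introl erefl); exists (S `|` T).
    by rewrite -bigcup2E; apply: bigcup_countable => // -[|[|n]] _ //=; exact: countable0.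
  split; first by apply: concentrated_sub nuS; exact: subsetUl.
  move=> i [<-|/nu_S nuiS]; first by apply: concentrated_sub nuT; exact: subsetUr.
  by apply: concentrated_sub nuiS; exact: subsetUl.
have [D [finD DS SD]] := countable_exhaustion cS.
have [M fM] := bf.
have lim mu : concentrated mu S ->
    charge_integral mu (fun x => f x * \1_(D n) x) @[n --> \oo] --> charge_integral mu f.
  move=> muS; have -> : charge_integral mu f = charge_integral mu (fun x => f x * \1_S x).
    apply/eqP; rewrite -subr_eq0 -mulN1r addrC -charge_integral_linear//; last first.
      by apply: fboundedM => //; exact: fbounded_indic.
    apply/eqP; apply: (charge_integral_null K_discrete muS) => [|x Sx].
      by apply: fboundedD => //; apply: fboundedZ; apply: fboundedM => //; exact: fbounded_indic.
    by rewrite indicE mem_set// mulr1 mulN1r addNr.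
  apply: (@charge_integral_dct _ _ K_discrete _ _ _ M) => [n x|x].
    by rewrite indicE; case: (_ \in _); rewrite ?mulr1// mulr0 normr0 (le_trans _ (fM x)).
  by apply: cvgM; [exact: cvg_cst | exact: indic_exhaustion].
have inD n x : (x \in finmap.enum_fset (fset_set (D n))) = (x \in D n).
  exact: in_fset_set.
have fin_sum mu n : charge_integral mu (fun x => f x * \1_(D n) x) =
    \sum_(x <- finmap.enum_fset (fset_set (D n))) f x * fine (mu [set x]).
  have -> : (fun x => f x * \1_(D n) x) = (fun x =>
      \sum_(y <- finmap.enum_fset (fset_set (D n))) f y * \1_[set y] x).
    apply/funext => x; have [Dx|Dx] := pselect (D n x).
      rewrite (bigD1_seq x) ?inD ?mem_set ?finmap.fset_uniq//=.
      rewrite !indicE !mem_set// big1 ?addr0// => y yx.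
      by rewrite indicE memNset ?mulr0// => /= xy; rewrite xy eqxx in yx.
    rewrite indicE memNset// mulr0 big_seq big1// => y.
    rewrite inD => yD; rewrite indicE memNset ?mulr0//= => xy.
    by apply: Dx; rewrite xy; exact: (set_mem yD).
  rewrite charge_integral_sum//; last by move=> y; apply/fboundedZ/fbounded_indic.
  apply: eq_bigr => y _; rewrite charge_integralZ//; last exact: fbounded_indic.
  by rewrite charge_integral_indic.
have lim2 : (\sum_(j <- r) a j * charge_integral (nu_ j) (fun x => f x * \1_(D n) x)) @[n --> \oo]
    --> \sum_(j <- r) a j * charge_integral (nu_ j) f.
  elim: r nu_S {nuE cnu} => [_|j r ih nu_S].
    by rewrite big_nil; under eq_fun do rewrite big_nil; exact: cvg_cst.
  rewrite big_cons; under eq_fun do rewrite big_cons.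
  apply: cvgD; last by apply: ih => i ir; apply: nu_S; right.
  by apply: cvgM; [exact: cvg_cst | apply: lim; apply: nu_S; left].
rewrite -(cvg_lim (@Rhausdorff R) (lim _ nuS)) -(cvg_lim (@Rhausdorff R) lim2).
suff -> : (fun n => charge_integral nu (fun x => f x * \1_(D n) x)) = (fun n =>
  \sum_(j <- r) a j * charge_integral (nu_ j) (fun x => f x * \1_(D n) x)) by [].
apply/funext => n; rewrite fin_sum.
under [RHS]eq_bigr => j _ do rewrite fin_sum mulr_sumr.
rewrite exchange_big; apply: eq_bigr => x _.
by rewrite nuE mulr_sumr; apply: eq_bigr => j _; rewrite mulrCA.
Qed.

Section WeightedCharge.
Variable w : K -> R.

Definition weighted_charge (L : seq K) : {charge set BK -> \bar R} :=
  foldr (fun x (acc : {charge set BK -> \bar R}) =>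
    cadd (cscale (w x) (charge_of_finite_measure (dirac (x : BK)))) acc : {charge set BK -> \bar R})
    czero L.

Lemma weighted_chargeE L (E : set BK) :
  weighted_charge L E = (\sum_(x <- L) w x * \1_E x)%:E.
Proof.
elim: L => [|x L ih]; first by rewrite big_nil.
by rewrite big_cons /= /cadd /= ih EFinD; congr (_ + _)%E.
Qed.

Lemma weighted_charge_concentrated L : concentrated (weighted_charge L) [set` L].
Proof.
move=> E EL; rewrite weighted_chargeE big_seq big1// => x xL.
rewrite indicE memNset ?mulr0// => Ex.
by have : (E `&` [set` L]) x by []; rewrite EL.
Qed.

Lemma weighted_charge_set1 L x : uniq L -> (x \notin L -> w x = 0) ->
  weighted_charge L [set x] = (w x)%:E.
Proof.
move=> uL wx0; rewrite weighted_chargeE; congr EFin.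
have [xL|xL] := boolP (x \in L).
  rewrite (bigD1_seq x)//= indicE mem_set// mulr1 big1 ?addr0// => y yx.
  by rewrite indicE memNset ?mulr0// => /= xy; rewrite xy eqxx in yx.
rewrite wx0// big_seq big1// => y yL.
by rewrite indicE memNset ?mulr0//= => yx; rewrite -yx yL in xL.
Qed.

Lemma weighted_charge_integral L f : uniq L -> (forall x, x \notin L -> w x = 0) ->
  fbounded f -> charge_integral (weighted_charge L) f = \sum_(x <- L) w x * f x.
Proof.
move=> uL wx0 bf; rewrite (charge_integral_seq (@weighted_charge_concentrated L) uL)//.
by apply: eq_bigr => x _; rewrite (weighted_charge_set1 uL (wx0 x)) [RHS]mulrC.
Qed.

End WeightedCharge.

Lemma countable_seq (L : seq K) : countable [set` L].
Proof. by apply: finite_set_countable; exact: finite_seq. Qed.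

End DiscreteCharges.

(** * Convolution of charges from finitely supported weights *)

Section DiscreteConvolution.
Variables (R : realType) (K : ptopologicalType).
Hypothesis K_discrete : forall E : set K, open E.
Local Notation BK := (borel K).
Local Notation C := (complexField R).
Implicit Types (u v : K -> R) (nu : {charge set BK -> \bar R}).
Variables (r : K -> K -> K -> R) (L : K -> K -> seq K).
Hypothesis L_uniq : forall x y, uniq (L x y).
Hypothesis mem_L : forall x y z, (z \in L x y) = (r x y z != 0).
Hypothesis r_ge0 : forall x y z, 0 <= r x y z.
Hypothesis r_sum : forall x y, \sum_(z <- L x y) r x y z = 1.

Definition conv_charge x y : {charge set BK -> \bar R} := weighted_charge (r x y) (L x y).
Definition conv_mass x y (E : set BK) : R := \sum_(z <- L x y) r x y z * \1_E z.
Local Notation m := conv_mass.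

Lemma conv_chargeE x y E : conv_charge x y E = (m x y E)%:E.
Proof. exact: weighted_chargeE. Qed.

Lemma notin_L x y z : z \notin L x y -> r x y z = 0.
Proof. by rewrite mem_L negbK => /eqP. Qed.

Lemma conv_mass_ge0 x y E : 0 <= m x y E.
Proof. by apply: sumr_ge0 => z _; rewrite mulr_ge0. Qed.

Lemma conv_mass_le1 x y E : m x y E <= 1.
Proof.
rewrite -(r_sum x y); apply: ler_sum => z _.
by rewrite indicE; case: (_ \in _); rewrite ?mulr1// mulr0.
Qed.

Lemma conv_mass_norm x y E : `|m x y E| <= 1.
Proof. by rewrite ger0_norm ?conv_mass_ge0// conv_mass_le1. Qed.

Lemma conv_mass0 x y : m x y set0 = 0.
Proof. by rewrite /m big1// => z _; rewrite indic0 mulr0. Qed.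

Lemma conv_mass_setT x y : m x y setT = 1.
Proof. by rewrite -(r_sum x y); apply: eq_bigr => z _; rewrite indicT mulr1. Qed.

Lemma conv_mass_set1 x y z : m x y [set z] = r x y z.
Proof.
have := weighted_charge_set1 (L_uniq x y) (@notin_L x y z).
by rewrite weighted_chargeE => -[].
Qed.

Lemma conv_charge_integral x y u : fbounded u ->
  charge_integral (conv_charge x y) u = \sum_(z <- L x y) r x y z * u z.
Proof. by apply: weighted_charge_integral => // z; exact: notin_L. Qed.

Lemma charge_integral_finite_support nu (Z : seq K) u : uniq Z ->
  (forall x, x \notin Z -> u x = 0) ->
  charge_integral nu u = \sum_(z <- Z) u z * fine (nu [set z]).
Proof.
move=> uZ u0; have uE : u = (fun x => \sum_(z <- Z) u z * \1_[set z] x).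
  apply/funext => x; have [xZ|xZ] := boolP (x \in Z).
    rewrite (bigD1_seq x)//= indicE mem_set// mulr1 big1 ?addr0// => y yx.
    by rewrite indicE memNset ?mulr0// => /= xy; rewrite xy eqxx in yx.
  rewrite u0// big_seq big1// => y yZ.
  by rewrite indicE memNset ?mulr0//= => xy; rewrite xy yZ in xZ.
rewrite {1}uE charge_integral_sum//; last by move=> z; apply/fboundedZ/fbounded_indic.
apply: eq_bigr => z _; rewrite charge_integralZ//; last exact: fbounded_indic.
by rewrite charge_integral_indic.
Qed.

Section ComposedCharge.
Variables nu mu : {charge set BK -> \bar R}.

Definition composed_mass (E : set BK) : R :=
  charge_integral nu (fun y => charge_integral mu (fun x => m x y E)).

Definition composed_charge (E : set BK) : \bar R := (composed_mass E)%:E.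

Let bounded_mass y E : fbounded (fun x => m x y E).
Proof. by exists 1 => x; exact: conv_mass_norm. Qed.

Lemma composed_bounded (E : set BK) :
  fbounded (fun y => charge_integral mu (fun x => m x y E)).
Proof.
by apply: (@charge_integral_bounded _ _ K_discrete _ _ _ 1) => y x; exact: conv_mass_norm.
Qed.

Let composed_charge0 : composed_charge set0 = 0%E.
Proof.
rewrite /composed_charge /composed_mass; congr EFin.
rewrite -[RHS](charge_integral0 K_discrete nu); congr charge_integral; apply/funext => y.
rewrite -[RHS](charge_integral0 K_discrete mu); congr charge_integral; apply/funext => x.
exact: conv_mass0.
Qed.

Let composed_charge_finite E : measurable E -> composed_charge E \is a fin_num.
Proof. by []. Qed.

Let partial_mass (F : nat -> set BK) x y n : trivIset setT F ->
  `|\sum_(0 <= i < n) m x y (F i)| <= 1.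
Proof.
move=> tF; have mK (E : set BK) : measurable E := borel_discrete_measurable K_discrete E.
have : conv_charge x y (\big[setU/set0]_(i < n) F i) = (\sum_(i < n) conv_charge x y (F i))%E.
  exact: (@charge_semi_additive _ _ _ (conv_charge x y) F n (fun k => mK _) tF (mK _)).
rewrite conv_chargeE.
rewrite (eq_bigr (fun i : 'I_n => (m x y (F i))%:E) (fun i _ => conv_chargeE x y (F i))).
rewrite sumEFin big_mkord => -[<-].
exact: conv_mass_norm.
Qed.

Let partial_mass_cvg (F : nat -> set BK) x y : trivIset setT F ->
  (\sum_(0 <= i < n) m x y (F i)) @[n --> \oo] --> m x y (\bigcup_n F n).
Proof.
move=> tF; have mK (E : set BK) : measurable E := borel_discrete_measurable K_discrete E.
have : (\sum_(0 <= i < n) conv_charge x y (F i))%E @[n --> \oo] -->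
    conv_charge x y (\bigcup_n F n).
  exact: (@charge_semi_sigma_additive _ _ _ (conv_charge x y) F (fun k => mK _) tF (mK _)).
rewrite conv_chargeE => /fine_cvg; apply: cvg_trans; apply: near_eq_cvg.
apply: nearW => n /=; under eq_bigr do rewrite conv_chargeE.
by rewrite sumEFin.
Qed.

(** Dominated convergence, in the inner and in the outer integral: for disjoint sets the partial
    sums of masses are masses of finite unions, hence at most 1. *)
Let composed_charge_sigma_additive : semi_sigma_additive composed_charge.
Proof.
move=> F _ tF _; rewrite /composed_charge.
under eq_fun do rewrite sumEFin.
apply: cvg_EFin; first exact: nearW.
suff : (\sum_(0 <= i < n) composed_mass (F i)) @[n --> \oo] -->
    composed_mass (\bigcup_n F n) by [].
(* Taking the pair of the number of terms and the point [y] as parameter gives one bound [M] uniform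
   in both, the dominating constant for the outer integral. *)
have [M hM] := @charge_integral_bounded _ _ K_discrete mu (nat * K)%type
  (fun p x => \sum_(0 <= i < p.1) m x p.2 (F i)) 1 (fun p x => partial_mass x p.2 p.1 tF).
have E n : \sum_(0 <= i < n) composed_mass (F i) = charge_integral nu (fun y =>
    charge_integral mu (fun x => \sum_(0 <= i < n) m x y (F i))).
  rewrite /composed_mass -charge_integral_sum//; last by move=> i; exact: composed_bounded.
  congr charge_integral; apply/funext => y.
  by rewrite charge_integral_sum.
under eq_fun do rewrite E.
apply: (@charge_integral_dct _ _ K_discrete _ _ _ M) => [n y|y].
  exact: (hM (n, y)).
apply: (@charge_integral_dct _ _ K_discrete _ _ _ 1) => [n x|x].
  exact: partial_mass.
exact: partial_mass_cvg.
Qed.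

HB.instance Definition _ := isCharge.Build _ _ _ composed_charge
  composed_charge0 composed_charge_finite composed_charge_sigma_additive.

Lemma composed_charge_concentrated :
  countably_concentrated nu -> countably_concentrated mu ->
  countably_concentrated composed_charge.
Proof.
move=> [S cS nuS] [T cT muT].
exists (\bigcup_(y in S) \bigcup_(x in T) [set` L x y]).
  apply: bigcup_countable => // y _; apply: bigcup_countable => // x _.
  exact: countable_seq.
move=> E ES; rewrite /composed_charge; congr EFin.
apply: (charge_integral_null K_discrete nuS); first exact: composed_bounded.
move=> y Sy; apply: (charge_integral_null K_discrete muT) => // x Tx.
rewrite /m big_seq big1// => z zL; rewrite indicE memNset ?mulr0// => Ez.
have : (E `&` \bigcup_(y in S) \bigcup_(x in T) [set` L x y]) z.
  by split=> //; exists y => //; exists x.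
by rewrite ES.
Qed.

(* For finitely supported functions both sides are finite sums over points. *)
Lemma composed_charge_integral (Z : seq K) u : uniq Z ->
  (forall x, x \notin Z -> u x = 0) ->
  charge_integral composed_charge u =
  charge_integral nu (fun y => charge_integral mu (fun x =>
    charge_integral (conv_charge x y) u)).
Proof.
move=> uZ u0; have sumE mu' := charge_integral_finite_support mu' uZ u0.
rewrite sumE; under [in RHS]eq_fun do under eq_fun do rewrite sumE.
under [in RHS]eq_fun => y.
  rewrite charge_integral_sum//; last first.
    by move=> z; apply: fboundedZ; under eq_fun do rewrite conv_chargeE; exact: bounded_mass.
  over.
rewrite charge_integral_sum//; last first.
  move=> z; have [M hM] := @composed_bounded [set z].
  exists (`|u z| * M) => y; rewrite charge_integralZ//; last first.
    by under eq_fun do rewrite conv_chargeE; exact: bounded_mass.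
  rewrite normrM ler_wpM2l//; under eq_fun do rewrite conv_chargeE.
  exact: hM.
apply: eq_bigr => z _.
rewrite -charge_integralZ//; last exact: composed_bounded.
congr charge_integral; apply/funext => y.
rewrite charge_integralZ//; last first.
  by under eq_fun do rewrite conv_chargeE; exact: bounded_mass.
by congr (_ * charge_integral _ _); apply/funext => x; rewrite conv_chargeE.
Qed.

End ComposedCharge.

Local Open Scope complex_scope.

(** * Complex measures: regularity and the extended convolution *)

Definition conv_measure x y : cmeasure R K := CMeasure (conv_charge x y) czero.

Lemma conv_measureE x y (E : set K) : mval (conv_measure x y) E = (m x y E)%:C.
Proof. by rewrite /mval /= conv_chargeE. Qed.

Lemma complex_inv_nat_eq0 (z : C) : 0 <= z ->
  (forall n, z < (n.+1%:R^-1 : R)%:C) -> z = 0.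
Proof.
case: z => a b; rewrite (@lecE R) /= => /andP[/eqP -> a0] zlt.
apply/eqP; rewrite eq_complex /= eqxx andbT eq_le a0 andbT leNgt; apply/negP => agt0.
have [n _ nlt] := near_infty_natSinv_lt (PosNum agt0).
have := zlt n; rewrite (@ltcE R) /= => /andP[_ h].
by have := lt_trans h (nlt n (leqnn n)); rewrite ltxx.
Qed.

(** Regularity of the whole space at precision 1/(n+1) gives a compact, hence finite, set [D n]. On
    a set that misses all of them the value is below every 1/(n+1), so the countable union is a
    carrier. *)
Lemma regular_concentrated (mu : cmeasure R K) : regular mu ->
  countably_concentrated (cmeasure_re mu) /\ countably_concentrated (cmeasure_im mu).
Proof.
move=> reg.
have /choice[D DP] (n : nat) : exists D : set K, finite_set D /\
    forall G : set K, G `&` D = set0 -> `|mval mu G| < (n.+1%:R^-1 : R)%:C.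
  have mT : measurable ([set: BK] : set BK) by [].
  have n0 : 0 < (n.+1%:R^-1 : R) by rewrite invr_gt0.
  have [D [U [cD _ _ TU DG]]] := reg _ _ mT n0.
  exists D; split; first exact/discrete_compact.
  move=> G GD; apply: DG; first exact: borel_discrete_measurable.
  by move=> x Gx; split; [exact: TU | move=> Dx; have : (G `&` D) x by []; rewrite GD].
pose S := \bigcup_n D n.
have cS : countable S.
  by apply: bigcup_countable => // n _; apply: finite_set_countable; case: (DP n).
have mu0 E : E `&` S = set0 -> mval mu E = 0.
  move=> ES; apply/eqP; rewrite -normr_eq0; apply/eqP.
  apply: complex_inv_nat_eq0; first exact: normr_ge0.
  move=> n; apply: (DP n).2; apply: subsetI_eq0 ES => //.
  exact: bigcup_sup.
split; exists S => // E ES; have /eqP := mu0 E ES; rewrite eq_complex /= => /andP[/eqP re0 /eqP im0].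
- by rewrite -[LHS]fineK ?fin_num_measure ?re0//; exact: borel_discrete_measurable.
- by rewrite -[LHS]fineK ?fin_num_measure ?im0//; exact: borel_discrete_measurable.
Qed.

(** The estimate must be uniform in [G]. The Jordan parts are monotone, so their values on the whole
    tail bound those on [G], and they tend to 0 because nothing is carried outside [S]. *)
Lemma charge_tail nu (S : set K) (D : nat -> set K) (E : set K) :
  concentrated nu S -> (forall n, D n `<=` S) ->
  (forall x, S x -> \forall n \near \oo, D n x) ->
  forall eps, 0 < eps -> \forall n \near \oo, forall G : set BK,
    G `<=` E `\` D n -> `|fine (nu G)| < eps.
Proof.
move=> nuS DS SD eps eps0.
have [p [q [P [N [pE qE nuE _]]]]] := charge_integralP K_discrete nu.
have tail (k : {finite_measure set BK -> \bar R}) (Q : set BK) (s : R) :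
    (forall E, k E = (s%:E * nu (E `&` Q))%E) ->
    fine (k (E `\` D n)) @[n --> \oo] --> 0.
  move=> kE; have k0 : Rintegral k [set: BK] \1_(E `\` S) = 0.
    rewrite (Rintegral_indic K_discrete) kE nuS ?mule0//.
    by rewrite -subset0 => x [[[_ nSx] _] /nSx].
  rewrite -k0; have -> : (fun n => fine (k (E `\` D n))) =
      (fun n => Rintegral k [set: BK] \1_(E `\` D n)).
    by apply/funext => n; rewrite (Rintegral_indic K_discrete).
  apply: (@Rintegral_dct _ _ K_discrete _ _ _ 1) => [n x|x].
    by rewrite indicE; case: (_ \in _); rewrite ?normr1 ?normr0.
  have indicDE (F : set K) : \1_(E `\` F) x = \1_E x * (1 - \1_F x) :> R.
    by rewrite !indicE in_setD; case: (x \in E); case: (x \in F);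
      rewrite /= ?subrr ?subr0 ?mulr0 ?mul0r ?mulr1.
  rewrite indicDE; under eq_fun do rewrite indicDE.
  apply: cvgM; first exact: cvg_cst.
  by apply: cvgB; [exact: cvg_cst | exact: indic_exhaustion].
have pT : fine (p (E `\` D n)) @[n --> \oo] --> 0.
  by apply: (tail p P 1) => F; rewrite mul1e.
have qT : fine (q (E `\` D n)) @[n --> \oo] --> 0.
  by apply: (tail q N (-1)) => F; rewrite mulN1e.
have e2 : 0 < eps / 2 by rewrite divr_gt0.
have pn := cvgr0_norm_lt _ pT _ e2; have qn := cvgr0_norm_lt _ qT _ e2.
near=> n; move=> G GE.
have kle (k : {finite_measure set BK -> \bar R}) :
    `|fine (k (E `\` D n))| < eps / 2 -> `|fine (k G)| < eps / 2.
  have mK (F : set BK) : measurable F := borel_discrete_measurable K_discrete F.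
  apply: le_lt_trans; rewrite !ger0_norm ?fine_ge0//.
  by apply: fine_le; rewrite ?fin_num_measure//; apply: le_measure; rewrite ?inE.
rewrite nuE fineB ?fin_num_measure; try exact: borel_discrete_measurable.
rewrite (le_lt_trans (ler_normB _ _))// (splitr eps) ltrD//.
  by apply: kle; near: n; exact: pn.
by apply: kle; near: n; exact: qn.
Unshelve. all: by end_near. Qed.

(** Every set is open, so [E] serves as its own outer approximation; the inner one is the trace on
    [E] of a finite stage of the exhaustion of the carrier. *)
Lemma concentrated_regular (mu : cmeasure R K) :
  countably_concentrated (cmeasure_re mu) -> countably_concentrated (cmeasure_im mu) ->
  regular mu.
Proof.
move=> [S1 cS1 muS1] [S2 cS2 muS2] E eps _ eps0.
pose S : set K := S1 `|` S2.
have cS : countable S.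
  by rewrite /S -bigcup2E; apply: bigcup_countable => // -[|[|n]] _ //=; exact: countable0.
have reS : concentrated (cmeasure_re mu) S.
  by apply: concentrated_sub muS1; exact: subsetUl.
have imS : concentrated (cmeasure_im mu) S.
  by apply: concentrated_sub muS2; exact: subsetUr.
have [D [finD DS SD]] := countable_exhaustion cS.
have e2 : 0 < eps / 2 by rewrite divr_gt0.
have [n [reG imG]] : exists n,
    (forall G : set BK, G `<=` E `\` D n -> `|fine (cmeasure_re mu G)| < eps / 2) /\
    (forall G : set BK, G `<=` E `\` D n -> `|fine (cmeasure_im mu G)| < eps / 2).
  have h1 := charge_tail E reS DS SD e2; have h2 := charge_tail E imS DS SD e2.
  by have [n hn] := filter_ex (filterI h1 h2); exists n.
exists (D n `&` E), E; split=> //.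
  by apply/discrete_compact => //; apply: sub_finite_set (finD n) => x [].
move=> G _ GE; have {}GE : G `<=` E `\` D n.
  by move=> x /GE[Ex nDE]; split=> // Dx; apply: nDE.
rewrite /mval [X in `|X|]complexE.
have normi : `|'i%C : C| = 1.
  by rewrite normc_def /= expr0n expr1n add0r sqrtr1.
have normR (a : R) : `|a%:C : C| = `|a|%:C.
  by rewrite normc_def /= expr0n addr0 sqrtr_sqr.
apply: le_lt_trans (ler_normD _ _) _ => /=; rewrite normrM normi mul1r !normR.
rewrite -rmorphD (splitr eps) (@ltcR R) ltrD//; [exact: reG | exact: imG].
Qed.

Lemma regularP (mu : cmeasure R K) : regular mu <->
  countably_concentrated (cmeasure_re mu) /\ countably_concentrated (cmeasure_im mu).
Proof.
by split=> [/regular_concentrated|[]]; last exact: concentrated_regular.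
Qed.

Lemma czero_concentrated : countably_concentrated (czero : {charge set BK -> \bar R}).
Proof. by exists set0. Qed.

Lemma cadd_concentrated (nu1 nu2 : {charge set BK -> \bar R}) :
  countably_concentrated nu1 -> countably_concentrated nu2 ->
  countably_concentrated (cadd nu1 nu2).
Proof.
move=> [S cS nuS] [T cT nuT]; exists (S `|` T).
  by rewrite -bigcup2E; apply: bigcup_countable => // -[|[|n]] _ //=; exact: countable0.
move=> E; rewrite setIUr setU_eq0 => -[ES ET].
by rewrite -[LHS]/(nu1 E + nu2 E)%E nuS// nuT// adde0.
Qed.

Lemma copp_concentrated (nu : {charge set BK -> \bar R}) :
  countably_concentrated nu -> countably_concentrated (copp nu).
Proof. by move=> [S cS nuS]; exists S => // E ES; rewrite -[LHS]/(- nu E)%E nuS ?oppe0. Qed.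

Lemma conv_charge_concentrated x y : countably_concentrated (conv_charge x y).
Proof.
exists [set` L x y]; first exact: countable_seq.
exact: weighted_charge_concentrated.
Qed.

Definition dirac_charge (x : K) : {charge set BK -> \bar R} :=
  charge_of_finite_measure (dirac (x : BK)).

Lemma dirac_chargeE x E : dirac_charge x E = (\1_E x)%:E.
Proof. by []. Qed.

Lemma dirac_concentrated x : concentrated (dirac_charge x) [set x].
Proof.
move=> E Ex; rewrite dirac_chargeE indicE memNset// => xE.
by have : (E `&` [set x]) x by []; rewrite Ex.
Qed.

Lemma dirac_integral x u : fbounded u -> charge_integral (dirac_charge x) u = u x.
Proof.
move=> bu; rewrite (charge_integral_seq K_discrete (@dirac_concentrated x) (L := [:: x]))//.
  by rewrite big_seq1 dirac_chargeE indicE mem_set// mulr1.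
by move=> y ->; rewrite mem_head.
Qed.

Lemma czero_integral u : fbounded u -> charge_integral (czero : {charge set BK -> \bar R}) u = 0.
Proof. by move=> bu; apply: (@charge_integral_null _ _ K_discrete _ set0). Qed.

Lemma conv_measure_regular x y : regular (conv_measure x y).
Proof.
by apply/regularP; split; [exact: conv_charge_concentrated | exact: czero_concentrated].
Qed.

(* cv is the integral of p_x * p_y dmu(x) dnu(y), split into real and imaginary parts. *)
Definition cv (mu nu : cmeasure R K) : cmeasure R K :=
  CMeasure
    (cadd (composed_charge (cmeasure_re nu) (cmeasure_re mu))
          (copp (composed_charge (cmeasure_im nu) (cmeasure_im mu))))
    (cadd (composed_charge (cmeasure_re nu) (cmeasure_im mu))
          (composed_charge (cmeasure_im nu) (cmeasure_re mu))).

Lemma cv_mval (mu nu : cmeasure R K) E : mval (cv mu nu) E =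
  (composed_mass (cmeasure_re nu) (cmeasure_re mu) E -
   composed_mass (cmeasure_im nu) (cmeasure_im mu) E) +i*
  (composed_mass (cmeasure_re nu) (cmeasure_im mu) E +
   composed_mass (cmeasure_im nu) (cmeasure_re mu) E).
Proof. by []. Qed.

Lemma cv_is_regular (mu nu : cmeasure R K) : regular mu -> regular nu -> regular (cv mu nu).
Proof.
move=> /regularP[mur mui] /regularP[nur nui]; apply/regularP; split.
  apply: cadd_concentrated; first exact: composed_charge_concentrated.
  by apply: copp_concentrated; exact: composed_charge_concentrated.
by apply: cadd_concentrated; exact: composed_charge_concentrated.
Qed.

Let bounded_mass y E : fbounded (fun x => m x y E).
Proof. by exists 1 => x; exact: conv_mass_norm. Qed.

(** Three terms because the real and the imaginary part of [k * mu1 + mu2] each have this shape, as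
    [mval_comb] records. *)
Lemma charge_integral_comb3 (nu nu1 nu2 nu3 : {charge set BK -> \bar R}) a b u :
  countably_concentrated nu -> countably_concentrated nu1 ->
  countably_concentrated nu2 -> countably_concentrated nu3 ->
  (forall E : set BK, fine (nu E) = a * fine (nu1 E) + b * fine (nu2 E) + fine (nu3 E)) ->
  fbounded u ->
  charge_integral nu u = a * charge_integral nu1 u + b * charge_integral nu2 u +
    charge_integral nu3 u.
Proof.
move=> cnu c1 c2 c3 nuE bu.
rewrite (@charge_integral_comb _ _ K_discrete nu _ [:: (a, nu1); (b, nu2); (1, nu3)] fst snd)//.
- by rewrite !big_cons big_nil /= mul1r addr0 addrA.
- by move=> j /= [<-|[<-|[<-|//]]].
- by move=> E; rewrite nuE !big_cons big_nil /= mul1r addr0 addrA.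
Qed.

Lemma composed_mass_comb (rho mu mu1 mu2 mu3 : {charge set BK -> \bar R}) a b E :
  countably_concentrated mu -> countably_concentrated mu1 ->
  countably_concentrated mu2 -> countably_concentrated mu3 ->
  (forall E : set BK, fine (mu E) = a * fine (mu1 E) + b * fine (mu2 E) + fine (mu3 E)) ->
  composed_mass rho mu E = a * composed_mass rho mu1 E + b * composed_mass rho mu2 E +
    composed_mass rho mu3 E.
Proof.
move=> cmu c1 c2 c3 muE; rewrite -addrA /composed_mass.
have b1 := composed_bounded mu1 E; have b2 := composed_bounded mu2 E.
have b3 := composed_bounded mu3 E.
rewrite -(charge_integral_linear K_discrete rho b b2 b3).
rewrite -(charge_integral_linear K_discrete rho a b1 (fboundedD (fboundedZ b b2) b3)).
congr charge_integral; apply/funext => y; rewrite addrA.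
exact: charge_integral_comb3.
Qed.

Lemma mval_comb (k : C) (mu mu1 mu2 : cmeasure R K) :
  (forall E : set BK, measurable E -> mval mu E = k * mval mu1 E + mval mu2 E) ->
  (forall E : set BK, fine (cmeasure_re mu E) = complex.Re k * fine (cmeasure_re mu1 E) +
     - complex.Im k * fine (cmeasure_im mu1 E) + fine (cmeasure_re mu2 E)) /\
  (forall E : set BK, fine (cmeasure_im mu E) = complex.Re k * fine (cmeasure_im mu1 E) +
     complex.Im k * fine (cmeasure_re mu1 E) + fine (cmeasure_im mu2 E)).
Proof.
move=> muE; split=> E; have := muE E (borel_discrete_measurable K_discrete E);
  rewrite /mval; case: k {muE} => a b /eqP; rewrite eq_complex /= => /andP[/eqP reE /eqP imE].
  by rewrite reE mulNr.
by rewrite imE.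
Qed.

Lemma cv_linear_left (k : C) (mu mu1 mu2 nu : cmeasure R K) :
  regular mu -> regular mu1 -> regular mu2 -> regular nu ->
  (forall E : set BK, measurable E -> mval mu E = k * mval mu1 E + mval mu2 E) ->
  forall E : set BK, measurable E ->
    mval (cv mu nu) E = k * mval (cv mu1 nu) E + mval (cv mu2 nu) E.
Proof.
move=> /regularP[mr mi] /regularP[mr1 mi1] /regularP[mr2 mi2] _.
move=> /mval_comb[reE imE] E _; rewrite !cv_mval.
have mu_re rho := composed_mass_comb rho E mr mr1 mi1 mr2 reE.
have mu_im rho := composed_mass_comb rho E mi mi1 mr1 mi2 imE.
rewrite !mu_re !mu_im; case: k {reE imE mu_re mu_im} => a b /=.
by apply/eqP; rewrite eq_complex /=; apply/andP; split; apply/eqP; ring.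
Qed.

Lemma cv_linear_right (k : C) (mu nu nu1 nu2 : cmeasure R K) :
  regular mu -> regular nu -> regular nu1 -> regular nu2 ->
  (forall E : set BK, measurable E -> mval nu E = k * mval nu1 E + mval nu2 E) ->
  forall E : set BK, measurable E ->
    mval (cv mu nu) E = k * mval (cv mu nu1) E + mval (cv mu nu2) E.
Proof.
move=> _ /regularP[nr ni] /regularP[nr1 ni1] /regularP[nr2 ni2].
move=> /mval_comb[reE imE] E _; rewrite !cv_mval.
have nu_re mu' : composed_mass (cmeasure_re nu) mu' E =
    complex.Re k * composed_mass (cmeasure_re nu1) mu' E
    + - complex.Im k * composed_mass (cmeasure_im nu1) mu' E
    + composed_mass (cmeasure_re nu2) mu' E.
  by apply: charge_integral_comb3 => //; exact: composed_bounded.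
have nu_im mu' : composed_mass (cmeasure_im nu) mu' E =
    complex.Re k * composed_mass (cmeasure_im nu1) mu' E
    + complex.Im k * composed_mass (cmeasure_re nu1) mu' E
    + composed_mass (cmeasure_im nu2) mu' E.
  by apply: charge_integral_comb3 => //; exact: composed_bounded.
rewrite !nu_re !nu_im; case: k {reE imE nu_re nu_im} => a b /=.
by apply/eqP; rewrite eq_complex /=; apply/andP; split; apply/eqP; ring.
Qed.

Lemma continuous_discrete (T T' : topologicalType) (g : T -> T') :
  (forall E : set T, open E) -> continuous g.
Proof. by move=> Tdiscrete; apply/continuousP => E _; exact: Tdiscrete. Qed.

Lemma prod_discrete (E : set (K * K)) : open E.
Proof.
rewrite openE => -[x y] Exy; exists ([set x], [set y]); last by case=> a b /= [-> ->].
by split; apply: open_nbhs_nbhs; split.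
Qed.

Lemma Cc_finite (f : K -> C) : Cc f -> exists2 Z : seq K, uniq Z &
  forall x, x \notin Z -> f x = 0.
Proof.
move=> [_ /(discrete_compact K_discrete) fin]; pose S := [set x | f x != 0].
have finS : finite_set S by apply: sub_finite_set fin; exact: subset_closure.
exists (finmap.enum_fset (fset_set S)); first exact: finmap.fset_uniq.
move=> x; have -> : (x \in finmap.enum_fset (fset_set S)) = (x \in S) by exact: in_fset_set.
by move=> /negP xS; apply/eqP; apply: contrapT => /negP fx; apply: xS; exact: mem_set.
Qed.

Lemma finite_support_bounded (Z : seq K) u : (forall x, x \notin Z -> u x = 0) -> fbounded u.
Proof.
move=> u0; exists (\sum_(z <- Z) `|u z|) => x.
have [xZ|/u0 ->] := boolP (x \in Z); last by rewrite normr0 sumr_ge0.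
elim: Z xZ {u0} => // z Z ih; rewrite inE big_cons => /orP[/eqP ->|/ih h].
  by rewrite lerDl sumr_ge0.
by rewrite (le_trans h)// lerDr.
Qed.

Lemma cv_cintegral (mu nu : cmeasure R K) (f : K -> C) : Cc f ->
  cintegral (cv mu nu) f =
  cintegral nu (fun y => cintegral mu (fun x => cintegral (conv_measure x y) f)).
Proof.
move=> /Cc_finite[Z uZ f0].
pose u x := complex.Re (f x); pose v x := complex.Im (f x).
have u0 x : x \notin Z -> u x = 0 by rewrite /u => /f0 ->.
have v0 x : x \notin Z -> v x = 0 by rewrite /v => /f0 ->.
have bu := finite_support_bounded u0; have bv := finite_support_bounded v0.
have convE x y : cintegral (conv_measure x y) f =
    charge_integral (conv_charge x y) u +i* charge_integral (conv_charge x y) v.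
  by rewrite /cintegral /= !czero_integral// subr0 addr0.
have bconv w : (forall x, x \notin Z -> w x = 0) ->
    exists M, forall y x, `|charge_integral (conv_charge x y) w| <= M.
  move=> w0; have [M wM] := finite_support_bounded w0; exists M => y x.
  rewrite conv_charge_integral; last by exists M.
  rewrite (le_trans (ler_norm_sum _ _ _))// -[leRHS]mul1r -(r_sum x y) mulr_suml.
  by apply: ler_sum => z _; rewrite normrM ger0_norm// ler_wpM2l.
have b1 w rho : (forall x, x \notin Z -> w x = 0) ->
    fbounded (fun y => charge_integral rho (fun x => charge_integral (conv_charge x y) w)).
  by move=> /bconv[M hM]; apply: (@charge_integral_bounded _ _ K_discrete _ _ _ M).
have b0 w y : (forall x, x \notin Z -> w x = 0) ->
    fbounded (fun x => charge_integral (conv_charge x y) w).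
  by move=> /bconv[M hM]; exists M.
have seqE (rho : {charge set BK -> \bar R}) w : (forall x, x \notin Z -> w x = 0) ->
    charge_integral rho w = \sum_(z <- Z) w z * fine (rho [set z]).
  exact: charge_integral_finite_support.
(* [J] is an opaque name for the iterated integral; once both sides are expressed through it, they
   are the same linear combination of four of its values. *)
have [J JD] : exists J : {charge set BK -> \bar R} -> {charge set BK -> \bar R} -> (K -> R) -> R,
    forall rho sigma w, charge_integral rho (fun y => charge_integral sigma (fun x =>
      charge_integral (conv_charge x y) w)) = J rho sigma w.
  by eexists.
have JE rho sigma w : (forall x, x \notin Z -> w x = 0) ->
    charge_integral (composed_charge rho sigma) w = J rho sigma w.
  by move=> w0; rewrite (composed_charge_integral rho sigma uZ w0) JD.
have addE (n1 n2 : {charge set BK -> \bar R}) w : (forall x, x \notin Z -> w x = 0) ->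
    charge_integral (cadd n1 n2) w = charge_integral n1 w + charge_integral n2 w.
  move=> w0; rewrite !seqE// -big_split; apply: eq_bigr => z _ /=.
  rewrite -mulrDr -[cadd n1 n2 _]/(n1 [set z] + n2 [set z])%E fineD//;
    by apply: fin_num_measure; exact: borel_discrete_measurable.
have oppE (n1 : {charge set BK -> \bar R}) w : (forall x, x \notin Z -> w x = 0) ->
    charge_integral (copp n1) w = - charge_integral n1 w.
  move=> w0; rewrite !seqE// -sumrN; apply: eq_bigr => z _ /=.
  by rewrite -mulrN -[copp n1 _]/(- n1 [set z])%E fineN.
have subE (rho : {charge set BK -> \bar R}) g h : fbounded g -> fbounded h ->
    charge_integral rho (fun x => g x - h x) = charge_integral rho g - charge_integral rho h.
  move=> bg bh; rewrite -[X in _ - X]mul1r -mulNr addrC.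
  rewrite -(charge_integral_linear K_discrete)//; congr charge_integral.
  by apply/funext => x; rewrite mulN1r addrC.
pose G y : C :=
    (charge_integral (cmeasure_re mu) (fun x => charge_integral (conv_charge x y) u) -
     charge_integral (cmeasure_im mu) (fun x => charge_integral (conv_charge x y) v)) +i*
    (charge_integral (cmeasure_re mu) (fun x => charge_integral (conv_charge x y) v) +
     charge_integral (cmeasure_im mu) (fun x => charge_integral (conv_charge x y) u)).
have GE : (fun y => cintegral mu (fun x => cintegral (conv_measure x y) f)) = G.
  apply/funext => y; rewrite (_ : (fun x => cintegral (conv_measure x y) f) = (fun x =>
    charge_integral (conv_charge x y) u +i* charge_integral (conv_charge x y) v))//.
  by apply/funext => x; exact: convE.
rewrite GE /cintegral /= -/u -/v !addE// !oppE// !JE//.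
rewrite !subE ?charge_integralD//; try exact: b1.
have re_eq (a b c d : R) : a - b - (c + d) = a - c - (d + b) by ring.
have im_eq (a b c d : R) : a - b + (c + d) = a + c + (d - b) by ring.
by rewrite !JD re_eq im_eq.
Qed.

(** * The hypergroup axioms from identities between weights *)

Variables (inv : K -> K) (e : K).
Hypothesis inv_inv : involutive inv.
Hypothesis r_assoc : forall x y z w,
  \sum_(d <- L y z) r y z d * r x d w = \sum_(d <- L x y) r x y d * r d z w.
Hypothesis r_unitl : forall x y, r e x y = (x == y)%:R.
Hypothesis r_unitr : forall x y, r x e y = (x == y)%:R.
Hypothesis r_inv : forall x y z, r (inv y) (inv x) (inv z) = r x y z.
Hypothesis r_unit_supp : forall x y, (r x (inv y) e != 0) = (x == y).

Lemma supp_conv x y : supp (conv_measure x y) = [set` L x y].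
Proof.
apply/seteqP; split=> z /=.
  move=> /(_ [set z] (K_discrete _) erefl); rewrite conv_measureE conv_mass_set1.
  by rewrite (@ltcR R) mem_L => /lt0r_neq0.
rewrite mem_L => rz U _ Uz; rewrite conv_measureE (@ltcR R).
rewrite /m (bigD1_seq z) ?mem_L ?L_uniq//=.
rewrite indicE mem_set// mulr1 ltr_pwDl ?lt0r ?rz ?r_ge0//.
by apply: sumr_ge0 => w _; rewrite mulr_ge0.
Qed.

Lemma conv_mass_widen x y E (Z : seq K) : uniq Z -> {subset L x y <= Z} ->
  m x y E = \sum_(z <- Z) r x y z * \1_E z.
Proof.
move=> uZ LZ; rewrite /m [RHS](bigID [in L x y]) /= [X in _ + X]big1 ?addr0; last first.
  by move=> z /notin_L ->; rewrite mul0r.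
rewrite -[RHS]big_filter; apply: perm_big; apply: uniq_perm => //.
  exact: filter_uniq.
by move=> z; rewrite mem_filter; case: (boolP (z \in L x y)) => // /LZ ->.
Qed.

(** The supports that occur differ from term to term; expanding both sides over a single list [Z]
    containing all of them reduces the claim to [r_assoc] at each point. *)
Lemma conv_mass_assoc x y z E :
  \sum_(d <- L y z) r y z d * m x d E = \sum_(d <- L x y) r x y d * m d z E.
Proof.
pose Z := undup (flatten [seq L x d | d <- L y z] ++ flatten [seq L d z | d <- L x y]).
have uZ : uniq Z := undup_uniq _.
transitivity (\sum_(w <- Z) (\sum_(d <- L y z) r y z d * r x d w) * \1_E w).
  rewrite big_seq; under eq_bigr => d dL.
    rewrite (@conv_mass_widen _ _ _ Z uZ); last first.
      move=> w wL; rewrite mem_undup mem_cat; apply/orP; left.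
      by apply/flattenP; exists (L x d) => //; exact: map_f.
    rewrite mulr_sumr; over.
  rewrite -big_seq exchange_big; apply: eq_bigr => w _ /=.
  by rewrite mulr_suml; apply: eq_bigr => d _; rewrite mulrA.
rewrite [RHS]big_seq; under [RHS]eq_bigr => d dL.
  rewrite (@conv_mass_widen _ _ _ Z uZ); last first.
    move=> w wL; rewrite mem_undup mem_cat; apply/orP; right.
    by apply/flattenP; exists (L d z) => //; exact: (map_f (fun d => L d z)).
  rewrite mulr_sumr; over.
rewrite -big_seq exchange_big; apply: eq_bigr => w _ /=.
by rewrite r_assoc mulr_suml; apply: eq_bigr => d _; rewrite mulrA.
Qed.

Lemma conv_mass_inv x y E : m x y (inv @^-1` E) = m (inv y) (inv x) E.
Proof.
have Lperm : perm_eq (L (inv y) (inv x)) [seq inv z | z <- L x y].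
  apply: uniq_perm => //; first by rewrite map_inj_uniq//; exact: inv_inj.
  move=> z; rewrite -[z]inv_inv mem_map; last exact: inv_inj.
  by rewrite !mem_L r_inv.
rewrite /m (perm_big _ Lperm) big_map; apply: eq_bigr => z _.
by rewrite r_inv !indicE.
Qed.

Lemma conv_mass_delta x y w E : (forall z, r x y z = (w == z)%:R) -> m x y E = \1_E w.
Proof.
move=> rE; rewrite (@conv_mass_widen x y E [:: w])// => [|z].
  by rewrite big_seq1 rE eqxx mul1r.
by rewrite mem_L rE inE [z == w]eq_sym; case: (w == z); rewrite ?eqxx.
Qed.

Lemma point_measureE x (E : set K) : mval (point_measure R x) E = (\1_E x)%:C.
Proof. exact: (congr1 (fun a => fine a +i* 0) (dirac_chargeE x E)). Qed.

Lemma discrete_hypergroup : DJS_hypergroup conv_measure inv e.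
Proof.
split.
- move=> x _; rewrite withinET; exists [set x]; first by apply: open_nbhs_nbhs; split.
  split; first exact: compact_set1.
  by rewrite -[[set x]]setCK; apply: open_closedC; exact: K_discrete.
- rewrite open_hausdorff => x y xy; exists ([set x], [set y]).
    by split; rewrite inE.
  split; try exact: K_discrete.
  by apply/eqP; rewrite -subset0 => z [-> /eqP]; rewrite (negPf xy).
- move=> x y; split; first exact: conv_measure_regular.
    by move=> E _; rewrite conv_measureE (@ler0c R) conv_mass_ge0.
  by rewrite conv_measureE conv_mass_setT.
- by move=> f _; apply: continuous_discrete; exact: prod_discrete.
- exact: inv_inv.
- exact: continuous_discrete.
- exists cv; first split.
  + exact: cv_is_regular.
  + exact: cv_linear_left.
  + exact: cv_linear_right.
  + by move=> mu nu _ _ f Cf; exact: cv_cintegral.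
  (* Point measures and the measures [conv_measure] have zero imaginary charge, so only the
     composition of the real charges remains, a finite sum on either side. *)
  + move=> x y z E _; rewrite !cv_mval /=.
    have c0 mu : composed_mass czero mu E = 0.
      by rewrite /composed_mass czero_integral//; exact: composed_bounded.
    have c1 nu : composed_mass nu czero E = 0.
      rewrite /composed_mass -[RHS](charge_integral0 K_discrete nu).
      by congr charge_integral; apply/funext => w; rewrite czero_integral.
    rewrite !c0 !c1 !subr0 !addr0; congr (_ +i* _).
    rewrite /composed_mass conv_charge_integral; last exact: composed_bounded.
    rewrite [RHS]dirac_integral; last exact: composed_bounded.
    rewrite conv_charge_integral// -conv_mass_assoc; apply: eq_bigr => d _.
    by rewrite dirac_integral.
- by move=> x y; rewrite supp_conv; apply: finite_compact; exact: finite_seq.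
- by move=> x y E _; rewrite !conv_measureE conv_mass_inv.
- move=> x E _; rewrite conv_measureE point_measureE (@conv_mass_delta _ _ x)//.
- move=> x E _; rewrite conv_measureE point_measureE (@conv_mass_delta _ _ x)//.
- by move=> x y; rewrite supp_conv /= mem_L r_unit_supp; split=> [/eqP|->].
- move=> x y; rewrite supp_conv; case E : (L x y) => [|z l].
    by have := r_sum x y; rewrite E big_nil => /eqP; rewrite eq_sym oner_eq0.
  by exists z; rewrite /= mem_head.
- by move=> U V _ _; exact: prod_discrete.
Qed.

End DiscreteConvolution.

(** * The dual of a quantum Gelfand pair as a discrete hypergroup *)

Theorem theorem6p2 (R : realType) (A : cqgAlgebra (complexField R)) (B : subCQG A)
  (gelfand : quantum_gelfand_pair B)
  (t : cqg_dual A -> iurep A)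
  (t_class : forall alpha, class_of (t alpha) = alpha)
  (t_biinvariant : forall alpha : spherical_space B,
     biinvariant B (t (dual_of alpha) ord0 ord0))
  (F : forall alpha, 'M[complexField R]_((deg (t alpha)).+1))
  (F_matrix : forall alpha, is_F_matrix (t alpha) (F alpha))
  (f : complexField R -> {scalar A})
  (f_val : forall z alpha i j, f z (t alpha i j) = mxpow (F alpha) z i j)
  (c : spherical_space B -> spherical_space B -> spherical_space B -> complexField R)
  (c_finite : forall alpha beta,
     finite_set [set gamma | c alpha beta gamma != 0])
  (c_linearization : forall alpha beta : spherical_space B,
     t (dual_of alpha) ord0 ord0 * t (dual_of beta) ord0 ord0 =
     \sum_(gamma \in [set: spherical_space B])
       c alpha beta gamma *: t (dual_of gamma) ord0 ord0) :
  exists (conv : spherical_space B -> spherical_space B ->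
                 cmeasure R (spherical_space B))
         (inv : spherical_space B -> spherical_space B),
    [/\ forall alpha beta gamma,
          mval (conv alpha beta) [set gamma] = c alpha beta gamma,
        forall alpha,
          exists h : irr_unitary_corep (map_mx (second_star f) (t (dual_of alpha))),
            class_of (IURep h) = dual_of (inv alpha)
      & DJS_hypergroup conv inv (trivial_point B)].
Proof.
have K_discrete (E : set (spherical_space B)) : open E by exact: discrete_open.
pose s := spherical_function t : spherical_space B -> A.
(* One [gamma], the class of the plain conjugate, carries both properties: the relation to the star,
   from which the axioms follow, and the class of the second involution, which the statement
   prescribes. *)
have /choice[inv invP] (alpha : spherical_space B) : exists gamma : spherical_space B,
    s gamma = star (s alpha) /\
    exists h : irr_unitary_corep (map_mx (second_star f) (t (dual_of alpha))),
      class_of (IURep h) = dual_of gamma.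
  have [beta [M [M' [MM' M'M ME]]]] := conj_class t_class (dual_of alpha).
  have [gamma gE sE] := spherical_conj gelfand t_class t_biinvariant MM' M'M ME.
  exists gamma; split=> //; rewrite gE.
  exact: (second_star_corep t_class F_matrix f_val MM' M'M ME).
have inv_star alpha := (invP alpha).1.
have lin : forall alpha beta, s alpha * s beta =
  \sum_(gamma \in [set: spherical_space B]) c alpha beta gamma *: s gamma := c_linearization.
have c_ge0 := coefficient_ge0 t_class c_finite lin.
(* Weights of charges are real; nothing is lost, since a nonnegative complex number equals its real
   part. *)
pose r alpha beta gamma := complex.Re (c alpha beta gamma).
have cE alpha beta gamma : c alpha beta gamma = (r alpha beta gamma)%:C%C.
  have := c_ge0 alpha beta gamma; rewrite (@lecE R) => /andP[/eqP c0 _].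
  by apply/eqP; rewrite eq_complex /= c0 !eqxx.
have c_eq0 alpha beta gamma : (c alpha beta gamma == 0) = (r alpha beta gamma == 0).
  by rewrite cE fmorph_eq0.
pose L := csupp c.
have L_uniq alpha beta : uniq (L alpha beta) by exact: csupp_uniq.
have mem_L alpha beta gamma : (gamma \in L alpha beta) = (r alpha beta gamma != 0).
  by rewrite /L (mem_csupp c_finite) c_eq0.
have r_ge0 alpha beta gamma : 0 <= r alpha beta gamma.
  by have := c_ge0 alpha beta gamma; rewrite cE (@ler0c R).
have r_sum alpha beta : \sum_(gamma <- L alpha beta) r alpha beta gamma = 1.
  apply: (@complexI R); rewrite rmorph_sum -[RHS](coefficient_sum c_finite lin alpha beta).
  by apply: eq_bigr => gamma _; exact: esym (cE _ _ _).
have r_assoc x y z w : \sum_(d <- L y z) r y z d * r x d w =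
    \sum_(d <- L x y) r x y d * r d z w.
  apply: (@complexI R); rewrite !rmorph_sum.
  transitivity (\sum_(d <- L y z) c y z d * c x d w).
    by apply: eq_bigr => d _; rewrite !cE; exact: rmorphM.
  rewrite (coefficient_assoc t_class c_finite lin); apply: eq_bigr => d _.
  by rewrite !cE; exact: esym (rmorphM _ _ _).
have r_unitl x y : r (trivial_point B) x y = (x == y)%:R.
  apply: (@complexI R); rewrite -cE (coefficient_unitl t_class c_finite lin).
  by rewrite rmorph_nat.
have r_unitr x y : r x (trivial_point B) y = (x == y)%:R.
  apply: (@complexI R); rewrite -cE (coefficient_unitr t_class c_finite lin).
  by rewrite rmorph_nat.
have r_inv x y z : r (inv y) (inv x) (inv z) = r x y z.
  by rewrite /r (coefficient_inv t_class c_finite lin inv_star).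
have r_unit_supp x y : (r x (inv y) (trivial_point B) != 0) = (x == y).
  by rewrite -c_eq0 (coefficient_unit_neq0 t_class c_finite lin inv_star).
exists (conv_measure r L), inv; split.
- move=> alpha beta gamma; rewrite conv_measureE (conv_mass_set1 L_uniq mem_L); exact: esym (cE _ _ _).
- by move=> alpha; have [] := invP alpha.
- exact: (discrete_hypergroup K_discrete L_uniq mem_L r_ge0 r_sum
    (inv_involutive t_class inv_star) r_assoc r_unitl r_unitr r_inv r_unit_supp).
Qed.
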